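(* Let $t_0=[u_0:v_0]\in\mathbb P^1$ (i.e. $t_0=u_0/v_0$), and let $(U_\varphi,C)$ be the neighborhood formally equivalent to $(U_{1,0,0},C)$ with cocycle $\varphi=(\varphi_{i,i+1})_{i\in\mathbb Z_4}$ such that $$\varphi_{1,4}=\left(X(1+XYe^Y)^{-\beta_0},\ Y(1+XYe^Y)^{\alpha_0}\right),\quad\alpha_0=\tau(v_0-u_0),\ \beta_0=u_0,$$ where $\varphi_{1,4}:=\varphi_{4,1}^{-1}$, and $\varphi_{i,i+1}=\mathrm{Id}$ for $i=1,2,3$. Then $\hat{\mathcal F}_{t_0}$ is the unique convergent foliation in the formal pencil $(\hat{\mathcal F}_t)_{t\in\mathbb P^1}$ on $(U_\varphi,C)$.
   Context: Fix $\tau\in\mathbb C$, $\Im\tau>0$, $\varpi=\arg\tau\in]0,\pi[$, $q=e^{2i\pi\tau}$, $C=\mathbb C^*_z/\langle z\mapsto qz\rangle$, $\tilde C=\{y=0\}\subset\mathbb C^*_z\times\mathbb C_y$, $\xi=1/y$. $(U_{1,0,0},C)$ is the quotient of the germ $(\mathbb C^*_z\times\mathbb C_y,\tilde C)$ by $F_{1,0,0}(z,\xi)=(qz,\xi-1)$. A neighborhood $(U,C)$ (germ of smooth surface along $C$) formally equivalent to it (formal isomorphism inducing the identity on $C$) can be written $(\mathbb C^*_z\times\mathbb C_y,\tilde C)/\langle F\rangle$ with $F(z,y)=(qz+O(y^2),y+y^2+y^3+O(y^4))$, and there is a formal diffeomorphism $\hat\Psi=(z+\sum_{n\ge1}a_n(z)y^n,y+\sum_{n\ge2}b_n(z)y^n)$,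 $a_n,b_n\in\mathcal O(\mathbb C^* )$, with $\hat\Psi\circ F=F_{1,0,0}\circ\hat\Psi$. Pencil: on $U_{1,0,0}$, $\mathcal F_t$ is the foliation $\omega_0+t\omega_\infty=0$ ($\mathcal F_\infty:\omega_\infty=0$), $\omega_0=d\xi$, $\omega_\infty=\frac1{2i\pi\tau}\frac{dz}{z}$. On $(U,C)$, $\hat{\mathcal F}_t=\hat\Psi^*\mathcal F_t$ (independent of $\hat\Psi$); it is convergent if it is a holomorphic foliation germ on $(U,C)$. Lines: in $\mathbb P^1_X\times\mathbb P^1_Y$ set $L_1=\{Y=0\}$, $L_2=\{X=\infty\}$, $L_3=\{Y=\infty\}$, $L_4=\{X=0\}$, $D=\bigcup L_i$, $p_{i,i+1}=L_i\cap L_{i+1}$ ($i\in\mathbb Z_4$). A cocycle is $\varphi=(\varphi_{i,i+1})_{i\in\mathbb Z_4}$ where $\varphi_{i,i+1}$ is a germ of biholomorphism at $p_{i,i+1}$ preserving the two branches of $D$ and tangent to the identity at $p_{i,i+1}$. $(U_\varphi,C)$ denotes the neighborhood formally equivalent to $(U_{1,0,0},C)$ whose cocycle is $\varphi$ (every cocycle occurs, and determines the neighborhood up to analytic equivalence): let $I_1=]-\varpi,\pi-\varpi[$, $I_2=]-\pi,0[$, $I_3=I_1+\pi$, $I_4=I_2+\pi$ (values of $\arg\xi$ mod $2\pi$); for each $i$ there is a biholomorphism onto its image $\Psi_i$ on a transversely sectorial open set of opening $I_i=]\theta_1,\theta_2[$ (i.e. containing, for all large $c$ and small $\varepsilon>0$,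 some $\{\arg\xi\in]\theta_1+\varepsilon,\theta_2-\varepsilon[,|\xi|>R,e^{-c}<|z|<e^c\}$), with asymptotic expansion $\hat\Psi$ (uniform on these sets) and $\Psi_i\circ F=F_{1,0,0}\circ\Psi_i$; with $\Pi(z,\xi)=(e^{2i\pi\xi},ze^{2i\pi\tau\xi})$ the cocycle is given by $\Pi\circ\Psi_i=\varphi_{i,i+1}\circ\Pi\circ\Psi_{i+1}$ on overlaps. *)

(* Defs.v *)
From HB Require Import structures.
From mathcomp Require Import all_boot all_order all_algebra.
From mathcomp Require Import all_classical all_reals all_analysis.
From mathcomp Require Import complex.

Set Implicit Arguments.
Unset Strict Implicit.
Unset Printing Implicit Defensive.

Import Order.TTheory GRing.Theory Num.Theory numFieldNormedType.Exports.

Local Open Scope classical_set_scope.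
Local Open Scope ring_scope.
Local Open Scope complex_scope.

(* MathComp-Analysis puts the normed module structure on R[i]^o only; this
   transfers it to R[i], so that R[i] * R[i] is a normed module over R[i] and
   [differentiable] on it means complex (Frechet) differentiability. *)
HB.instance Definition _ (R : rcfType) := NormedModule.copy R[i] (R[i])^o.

Section Exponential.
Variable R : realType.
Local Notation C := R[i].

Definition cexp (z : C) : C :=
  (expR (complex.Re z))%:C * (cos (complex.Im z) +i* sin (complex.Im z)).

(* Principal logarithm on C minus ]-oo, 0], where
   arg z = 2 atan (Im z / (|z| + Re z)); only its germ at 1 is used. *)
Definition clog (z : C) : C :=
  ln (complex.Re `|z|) +i* (2 * atan (complex.Im z / (complex.Re `|z| + complex.Re z))).

Definition cpow (z s : C) : C := cexp (s * clog z).

Definition twopii : C := 0 +i* (2 * pi).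

End Exponential.

Section Holomorphy.
Variables (R : realType) (V W : normedModType R[i]).

Definition holomorphic_on (D : set V) (f : V -> W) :=
  forall p, D p -> differentiable f p.

End Holomorphy.

Definition biholomorphic_on (R : realType) (V W : normedModType R[i])
    (D : set V) (f : V -> W) :=
  [/\ open D, holomorphic_on D f, open (f @` D) &
      exists g : W -> V,
        holomorphic_on (f @` D) g /\ forall p, D p -> g (f p) = p].

(* Points of C^*_z x C_y are pairs p = (z, y) with p.1 != 0; the curve is
   p.2 = 0, and xi = 1 / y. *)
Section Neighborhoods.
Variable R : realType.
Local Notation C := R[i].
Local Notation C2 := (C * C)%type.

Definition ambient : set C2 := [set p | p.1 != 0].
Definition ambient_minus_curve : set C2 := [set p | p.1 != 0 /\ p.2 != 0].

(* The curve itself is excluded: forms with poles along it are compared below,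
   and for holomorphic functions O(y^k) extends to y = 0 by continuity. *)
Definition off_curve (z0 : C) : set_system C2 :=
  within [set p : C2 | p.2 != 0] (nbhs (z0, 0 : C)).

Definition bigO_y (W : normedModType C) (k : nat) (z0 : C) (f : C2 -> W) :=
  let G := off_curve z0 in f =O_G (fun p : C2 => p.2 ^+ k).

Definition qof (tau : C) : C := cexp (twopii R * tau).

(* F is (a representative of) a germ of biholomorphism along the curve with
   F(z,y) = (q z + O(y^2), y + y^2 + y^3 + O(y^4)). *)
Definition neighborhood_germ (tau : C) (F : C2 -> C2) :=
  (exists D : set C2,
     [/\ forall z, z != 0 -> D (z, 0), D `<=` ambient,
         F @` D `<=` ambient & biholomorphic_on D F]) /\
  forall z0 : C, z0 != 0 ->
    bigO_y 2 z0 (fun p => (F p).1 - qof tau * p.1) /\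
    bigO_y 4 z0 (fun p => (F p).2 - (p.2 + p.2 ^+ 2 + p.2 ^+ 3)).

(* (z, xi) |-> (q z, xi - 1) in the coordinates (z, y), y = 1 / xi. *)
Definition F100 (tau : C) (p : C2) : C2 := (qof tau * p.1, p.2 / (1 - p.2)).

(* The formal diffeomorphism
   (z + sum_(n >= 1) a_n(z) y^n, y + sum_(n >= 2) b_n(z) y^n)
   is given by its coefficients and handled through its truncations. *)
Definition trunc (a b : nat -> C -> C) (N : nat) (p : C2) : C2 :=
  (p.1 + \sum_(1 <= n < N.+1) a n p.1 * p.2 ^+ n,
   p.2 + \sum_(2 <= n < N.+1) b n p.1 * p.2 ^+ n).

Definition formal_coefs (a b : nat -> C -> C) :=
  (forall n, (1 <= n)%N -> holomorphic_on [set z | z != 0] (a n)) /\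
  (forall n, (2 <= n)%N -> holomorphic_on [set z | z != 0] (b n)).

(* An expression w in a formal diffeomorphism vanishes as a formal series in y
   near z0 iff its values w N at the N-truncations tend to 0 y-adically. *)
Definition formally_zero (W : normedModType C) (z0 : C) (w : nat -> C2 -> W) :=
  forall k : nat, \forall N \near \oo, bigO_y k z0 (w N).

Definition formal_conjugacy (tau : C) (F : C2 -> C2) (a b : nat -> C -> C) :=
  formal_coefs a b /\
  forall z0 : C, z0 != 0 ->
    formally_zero z0
      (fun N p => trunc a b N (F p) - F100 tau (trunc a b N p)).

(* 1-forms f dz + g dy are represented by p |-> (f p, g p). *)
Definition omega0 (p : C2) : C2 := (0, - (p.2 ^- 2)).

Definition omegaoo (tau : C) (p : C2) : C2 := ((twopii R * tau * p.1)^-1, 0).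

(* Defines F_t for t = [u : v], i.e. t = u / v. *)
Definition pencil (tau u v : C) (p : C2) : C2 :=
  v *: omega0 p + u *: omegaoo tau p.

Definition pullback (Phi : C2 -> C2) (w : C2 -> C2) (p : C2) : C2 :=
  let w' := w (Phi p) in
  (w'.1 * 'D_(1, 0) (fst \o Phi) p + w'.2 * 'D_(1, 0) (snd \o Phi) p,
   w'.1 * 'D_(0, 1) (fst \o Phi) p + w'.2 * 'D_(0, 1) (snd \o Phi) p).

Definition wedge (v w : C2) : C := v.1 * w.2 - v.2 * w.1.

(* The pull-back of F_[u:v] is a regular formal foliation.  It is convergent
   when near each point of the curve it is defined by a nowhere vanishing
   holomorphic 1-form eta; these local foliations glue, and are invariant
   under F, because each one is determined by the formal foliation. *)
Definition convergent (tau : C) (a b : nat -> C -> C) (u v : C) :=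
  forall z0 : C, z0 != 0 -> exists eta : C2 -> C2,
    [/\ \forall p \near (z0, 0 : C), differentiable eta p,
        eta (z0, 0) != 0 &
        formally_zero z0 (fun N p =>
          wedge (eta p) (pullback (trunc a b N) (pencil tau u v) p))].

Definition sector (I : R * R) (c eps r : R) : set C2 :=
  [set p | [/\ (expR (- c))%:C < `|p.1|, `|p.1| < (expR c)%:C &
    exists rho theta : R,
      [/\ r < rho, I.1 + eps < theta, theta < I.2 - eps &
          p.2^-1 = rho%:C * (cos theta +i* sin theta)]]].

(* Psi is a sectorial normalization of F on D, of opening I. *)
Definition sectorial_normalization (tau : C) (F : C2 -> C2)
    (a b : nat -> C -> C) (I : R * R) (D : set C2) (Psi : C2 -> C2) :=
  [/\ D `<=` ambient_minus_curve, Psi @` D `<=` ambient_minus_curve,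
      biholomorphic_on D Psi &
      forall c eps : R, 0 < c -> 0 < eps -> exists r : R,
        [/\ 0 < r, sector I c eps r `<=` D,
            forall p, sector I c eps r p ->
              D (F p) /\ Psi (F p) = F100 tau (Psi p) &
            forall N : nat, exists M : R, forall p, sector I c eps r p ->
              `|Psi p - trunc a b N p| <= M%:C * `|p.2| ^+ N.+1]].

(* Indices i = 1, 2, 3, 4 live in 'Z_4, so 4 is 0. *)
Definition opening (varpi : R) (i : 'Z_4) : R * R :=
  match nat_of_ord i with
  | 1 => (- varpi, pi - varpi)
  | 2 => (- pi, 0)
  | 3 => (- varpi + pi, pi - varpi + pi)
  | _ => (- pi + pi, 0 + pi)
  end.

(* (z, xi) |-> (X, Y) = (e^(2 i pi xi), z e^(2 i pi tau xi)), with xi = 1 / y. *)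
Definition PiXY (tau : C) (p : C2) : C2 :=
  (cexp (twopii R * p.2^-1), p.1 * cexp (twopii R * tau * p.2^-1)).

(* Local coordinates of P^1_X x P^1_Y centered at p_(i,i+1):
   p_12 = (oo, 0), p_23 = (oo, oo), p_34 = (0, oo), p_41 = (0, 0). *)
Definition corner_chart (i : 'Z_4) (p : C2) : C2 :=
  match nat_of_ord i with
  | 1 => (p.1^-1, p.2)
  | 2 => (p.1^-1, p.2^-1)
  | 3 => (p.1, p.2^-1)
  | _ => p
  end.

(* phi i is the germ phi_(i,i+1) written in the chart corner_chart i. *)
Definition is_cocycle (phi : 'Z_4 -> C2 -> C2) :=
  forall i,
    [/\ exists D : set C2,
          [/\ D 0, biholomorphic_on D (phi i),
              forall p, D p -> p.1 = 0 -> (phi i p).1 = 0 &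
              forall p, D p -> p.2 = 0 -> (phi i p).2 = 0],
        phi i 0 = 0 &
        forall h : C2, 'd (phi i) 0 h = h].

(* The overlap of the sectors i and i+1 is taken modulo 2 pi in arg xi, since
   sectors are sets of points. *)
Definition has_cocycle (tau : C) (varpi : R) (F : C2 -> C2)
    (a b : nat -> C -> C) (phi : 'Z_4 -> C2 -> C2) :=
  exists (D : 'Z_4 -> set C2) (Psi : 'Z_4 -> C2 -> C2),
    (forall i, sectorial_normalization tau F a b (opening varpi i)
                 (D i) (Psi i)) /\
    forall (i : 'Z_4) (c eps : R), 0 < c -> 0 < eps -> exists2 r : R, 0 < r &
      forall p, sector (opening varpi i) c eps r p ->
                sector (opening varpi (i + 1)) c eps r p ->
        corner_chart i (PiXY tau (Psi i p)) =
        phi i (corner_chart i (PiXY tau (Psi (i + 1) p))).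

(* (X (1 + X Y e^Y)^(-beta0), Y (1 + X Y e^Y)^alpha0) *)
Definition phi14 (alpha0 beta0 : C) (p : C2) : C2 :=
  let w := 1 + p.1 * p.2 * cexp p.2 in
  (p.1 * cpow w (- beta0), p.2 * cpow w alpha0).

End Neighborhoods.

(* Main.v *)
Require Import Defs.
From HB Require Import structures.
From mathcomp Require Import all_boot all_order all_algebra.
From mathcomp Require Import all_classical all_reals all_analysis.
From mathcomp Require Import complex ring lra.

Set Implicit Arguments.
Unset Strict Implicit.
Unset Printing Implicit Defensive.

Import Order.TTheory GRing.Theory Num.Theory numFieldNormedType.Exports.

Local Open Scope classical_set_scope.
Local Open Scope ring_scope.
Local Open Scope complex_scope.

(* Near a point z0 of the curve, F_[u:v] has the first integral
   H = v / y + (u / (2 i pi tau)) log (z / z0).  Put H_i = H o Psi_i.  The cocycle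
   is trivial at p_12, p_23, p_34, so there H_i = H_(i+1), while H_1 - H_4 is
   (u v0 - v u0) / (2 i pi) times log (1 + X Y e^Y) o Pi o Psi_4.

   For [u : v] = t0 the H_i therefore glue to a function H on a punctured
   neighborhood, H - v0 / y extends across y = 0, and dH defines the foliation.

   Conversely, let F_[u:v] be defined by a holomorphic form eta.  The functions
   f_i = eta /\ dH_i (on z = z0) are flat at y = 0, agree on three overlaps, and
   f_1 - f_4 is exponentially small.  In the variable w = - log y they glue to a
   flat function on a strip of width 3 pi - varpi > 2 pi whose variation under
   w |-> w + 2 i pi is exponentially small in e^w.  Cauchy's formula on a
   rectangle of height 2 pi, with the kernel 1 / (e^(w - c) - 1), shows that it is
   itself exponentially small, and Watson's lemma that it vanishes.  If
   [u : v] <> t0, then log (1 + X Y e^Y) and H have dependent differentials, which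
   is the relation (v - u) (1 + Y) = u / tau; as Y tends to 0 without vanishing,
   u = v = 0. *)

(** The exponents alpha0 and beta0 are tuned so that the jumps of v / y and of the logarithm combine
    into a multiple of the determinant of [u : v] and t0. The factor e^Y serves uniqueness: with X Y
    alone the final relation would read v - u = u / tau, which a second member of the pencil
    satisfies; for that member the jump would be a function of H, and its foliation would survive
    too. Flatness on a sector of opening pi proves nothing, and the exponential bound on f_1 - f_4
    is known only where the sectors 4 and 1 overlap. The rectangle spreads it: e^(N w) and the
    kernel have period 2 i pi, so the horizontal sides see only the jump, and the formula for f e^(N
    w) gives |f| e^(N Re w) <= A (D (N + 1))^(N + 1). With N close to e^(Re w) / (e D), f decays
    like exp (- B e^(Re w)), which Watson's lemma excludes on a strip of height above pi unless f =
    0. Working on z = z0 loses nothing: vanishing at a single y near 0 makes dH and d log (1 + X Y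
    e^Y) both proportional to eta there. *)

Section Modulus.
Variable R : realType.
Local Notation C := R[i].

(** Real-valued counterpart of [|z|], which lives in [R[i]]: the estimates become inequalities in
    [R], within reach of [lra] and [nra]. *)
Definition nm (z : C) : R := complex.Re `|z|.

Lemma normE (z : C) : `|z| = (nm z)%:C.
Proof. by rewrite /nm normc_def. Qed.

Lemma nm_ge0 (z : C) : 0 <= nm z.
Proof. by rewrite -lecR -normE normr_ge0. Qed.

Lemma nm0 : nm 0 = 0.
Proof. by rewrite /nm normr0. Qed.

Lemma nm1 : nm 1 = 1.
Proof. by rewrite /nm normr1. Qed.

Lemma nm_eq0 (z : C) : (nm z == 0) = (z == 0).
Proof. by rewrite -[RHS]normr_eq0 normE -(inj_eq (@complexI R)). Qed.

Lemma nm_gt0 (z : C) : (0 < nm z) = (z != 0).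
Proof. by rewrite lt_neqAle nm_ge0 andbT eq_sym nm_eq0. Qed.

Lemma nmM (z w : C) : nm (z * w) = nm z * nm w.
Proof. by apply: complexI; rewrite -normE normrM !normE -rmorphM. Qed.

Lemma nmD (z w : C) : nm (z + w) <= nm z + nm w.
Proof. by rewrite -lecR rmorphD /= -!normE ler_normD. Qed.

Lemma nmN (z : C) : nm (- z) = nm z.
Proof. by rewrite /nm normrN. Qed.

Lemma nmBC (z w : C) : nm (z - w) = nm (w - z).
Proof. by rewrite -nmN opprB. Qed.

Lemma nmB (z w : C) : nm (z - w) <= nm z + nm w.
Proof. by rewrite -(nmN w) nmD. Qed.

Lemma nm_sub (z w : C) : nm z - nm w <= nm (z - w).
Proof. by rewrite lerBlDr -{1}(subrK w z) nmD. Qed.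

Lemma nm_tri (w z t : C) : nm (z - t) <= nm (z - w) + nm (w - t).
Proof. by rewrite (_ : z - t = z - w + (w - t)) ?nmD // addrA subrK. Qed.

Lemma nmV (z : C) : nm z^-1 = (nm z)^-1.
Proof.
have [->|z0] := eqVneq z 0; first by rewrite !(invr0, nm0).
by apply: (mulfI (x := nm z)); rewrite ?nm_eq0 // -nmM !divff ?nm1 ?nm_eq0.
Qed.

Lemma nmX (z : C) n : nm (z ^+ n) = nm z ^+ n.
Proof. by elim: n => [|n IH]; rewrite ?expr0 ?nm1 // !exprS nmM IH. Qed.

Lemma nmR (x : R) : nm x%:C = `|x|.
Proof. by rewrite /nm normc_def /= expr0n addr0 sqrtr_sqr. Qed.

Lemma nmi : nm 'i = 1.
Proof. by rewrite /nm normc_def /= expr0n add0r expr1n sqrtr1. Qed.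

Lemma Re_le_nm (z : C) : `|complex.Re z| <= nm z.
Proof.
by case: z => a b; rewrite /nm normc_def /= -sqrtr_sqr ler_wsqrtr // lerDl sqr_ge0.
Qed.

Lemma Im_le_nm (z : C) : `|complex.Im z| <= nm z.
Proof.
by case: z => a b; rewrite /nm normc_def /= -sqrtr_sqr ler_wsqrtr // lerDr sqr_ge0.
Qed.

Lemma complexE (z : C) : z = (complex.Re z)%:C + 'i * (complex.Im z)%:C.
Proof. by case: z => a b; simpc. Qed.

Lemma nm_le_ReIm (z : C) : nm z <= `|complex.Re z| + `|complex.Im z|.
Proof. by rewrite {1}[z]complexE (le_trans (nmD _ _)) // nmM nmi mul1r !nmR. Qed.

Lemma nm_sqr (z : C) : nm z ^+ 2 = complex.Re z ^+ 2 + complex.Im z ^+ 2.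
Proof.
by case: z => a b; rewrite /nm normc_def /= sqr_sqrtr // addr_ge0 ?sqr_ge0.
Qed.

Lemma cReD (z w : C) : complex.Re (z + w) = complex.Re z + complex.Re w.
Proof. by case: z; case: w. Qed.

Lemma cImD (z w : C) : complex.Im (z + w) = complex.Im z + complex.Im w.
Proof. by case: z; case: w. Qed.

Lemma cReN (z : C) : complex.Re (- z) = - complex.Re z.
Proof. by case: z. Qed.

Lemma cImN (z : C) : complex.Im (- z) = - complex.Im z.
Proof. by case: z. Qed.

Lemma cReM (z w : C) : complex.Re (z * w) =
  complex.Re z * complex.Re w - complex.Im z * complex.Im w.
Proof. by case: z; case: w. Qed.

Lemma cImM (z w : C) : complex.Im (z * w) =
  complex.Re z * complex.Im w + complex.Im z * complex.Re w.
Proof. by case: z; case: w. Qed.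

Lemma complex_eq (z w : C) :
  complex.Re z = complex.Re w -> complex.Im z = complex.Im w -> z = w.
Proof. by case: z; case: w => a b c d /= -> ->. Qed.

Lemma nm_le0 (z : C) : nm z <= 0 -> z = 0.
Proof. by move=> z0; apply/eqP; rewrite -nm_eq0 eq_le z0 nm_ge0. Qed.

End Modulus.

(** * Complex derivatives in one and two variables *)

Section Differentiability.
Variable R : realType.
Local Notation C := R[i].
Local Notation nm := (@nm R).

(* [f t = f0 + L t + o(s t)] as the size [s t] of the increment [t] tends to 0 *)
Definition lin (T : Type) (s : T -> R) (f : T -> C) (f0 : C) (L : T -> C) :=
  forall e, 0 < e -> exists2 d, 0 < d &
    forall t, s t < d -> nm (f t - f0 - L t) <= e * s t.

Definition dif (f : C -> C) (c l : C) :=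
  lin nm (fun h => f (c + h)) (f c) (fun h => l * h).

Definition nm2 (t : C * C) : R := nm t.1 + nm t.2.

Definition dif2 (f : C -> C -> C) (x y a b : C) :=
  lin nm2 (fun t => f (x + t.1) (y + t.2)) (f x y) (fun t => a * t.1 + b * t.2).

Definition hol f c := exists l, dif f c l.
Definition hol2 f x y := exists a b, dif2 f x y a b.

Lemma nm2_ge0 t : 0 <= nm2 t.
Proof. by rewrite addr_ge0 ?nm_ge0. Qed.

(** One chain rule behind sums, products and compositions in one and in two variables. The bounds by
    [K] replace linearity: [L] and [M] may be any maps controlled by the size of the increment, such
    as real and imaginary parts. *)
Lemma lin_comp2 (T : Type) (s : T -> R) (f g : T -> C) f0 g0 L M
    (G : C -> C -> C) a b K :
  (forall t, 0 <= s t) -> (forall t, nm (L t) <= K * s t) ->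
  (forall t, nm (M t) <= K * s t) ->
  lin s f f0 L -> lin s g g0 M -> dif2 G f0 g0 a b ->
  lin s (fun t => G (f t) (g t)) (G f0 g0) (fun t => a * L t + b * M t).
Proof.
move=> s0 LK MK lf lg dG e e0.
pose K' := `|K| + 1; have K'0 : 0 < K' by rewrite ltr_wpDl.
have KK' : K + 1 <= K' by rewrite lerD2r ler_norm.
pose A := nm a + nm b + 1.
have A0 : 0 < A by rewrite ltr_wpDl // addr_ge0 ?nm_ge0.
have [d dp dGe] := dG (e / (4 * K')) (divr_gt0 e0 (mulr_gt0 (ltr0n _ 4) K'0)).
(* [e2 <= 1] keeps the increments of [f] and [g] below [K' * s t], and [e2 * A <= e / 4] absorbs
   their first order errors after multiplication by [a] and [b]. *)
pose e2 := Num.min 1 (e / (4 * A)).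
have e20 : 0 < e2 by rewrite lt_min ltr01 divr_gt0 // mulr_gt0.
have e21 : e2 <= 1 by rewrite ge_min lexx.
have e2A : e2 * A <= e / 4.
  apply: (le_trans (ler_wpM2r (ltW A0) (_ : _ <= e / (4 * A)))).
    by rewrite ge_min lexx orbT.
  by rewrite le_eqVlt; apply/orP; left; apply/eqP; field; rewrite gt_eqF.
have [d1 d1p fe] := lf _ e20; have [d2 d2p ge] := lg _ e20.
exists (Num.min (Num.min d1 d2) (d / (2 * K'))).
  by rewrite !lt_min d1p d2p divr_gt0 // mulr_gt0.
move=> t; rewrite !lt_min => /andP[/andP[/fe ft /ge gt] td].
have st := s0 t.
have e2s : e2 * s t <= s t by rewrite ler_piMl.
have Kst : (K + 1) * s t <= K' * s t by rewrite ler_wpM2r.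
have hb : nm (f t - f0) <= K' * s t.
  have := LK t; have := nmD (f t - f0 - L t) (L t); rewrite subrK.
  by move: ft Kst; lra.
have kb : nm (g t - g0) <= K' * s t.
  have := MK t; have := nmD (g t - g0 - M t) (M t); rewrite subrK.
  by move: gt Kst; lra.
have K'd : K' * s t <= d / 2.
  have -> : d / 2 = K' * (d / (2 * K')) by field; rewrite gt_eqF.
  by rewrite ler_wpM2l ?ltW.
have := dGe (f t - f0, g t - g0); rewrite /nm2 /= !(addrC _ (_ - _)) !subrK.
have [st0|st0] := eqVneq (s t) 0.
  have h0 : f t - f0 = 0.
    by apply: nm_le0; rewrite (le_trans hb) // st0 mulr0.
  have k0 : g t - g0 = 0.
    by apply: nm_le0; rewrite (le_trans kb) // st0 mulr0.
  have l0 : L t = 0 by apply: nm_le0; rewrite (le_trans (LK t)) // st0 mulr0.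
  have m0 : M t = 0 by apply: nm_le0; rewrite (le_trans (MK t)) // st0 mulr0.
  move=> _; move/eqP: h0; move/eqP: k0; rewrite !subr_eq0 => /eqP -> /eqP ->.
  by rewrite l0 m0 !mulr0 addr0 !subrr nm0 st0 mulr0.
have st1 : 0 < s t by rewrite lt_neqAle eq_sym st0.
have K's : K' * s t < d / 2.
  have -> : d / 2 = K' * (d / (2 * K')) by field; rewrite gt_eqF.
  by rewrite ltr_pM2l.
move=> /(_ ltac:(lra)) Ge.
have -> : G (f t) (g t) - G f0 g0 - (a * L t + b * M t) =
  (G (f t) (g t) - G f0 g0 - (a * (f t - f0) + b * (g t - g0)))
  + (a * (f t - f0 - L t) + b * (g t - g0 - M t)) by ring.
apply: (le_trans (nmD _ _)).
have B1 : e / (4 * K') * (nm (f t - f0) + nm (g t - g0)) <= e / 2 * s t.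
  have -> : e / 2 * s t = e / (4 * K') * (K' * s t + K' * s t).
    by field; rewrite gt_eqF.
  by rewrite ler_wpM2l ?lerD // ltW // divr_gt0 // mulr_gt0.
have B2 : nm (a * (f t - f0 - L t) + b * (g t - g0 - M t)) <= e / 4 * s t.
  apply: (le_trans (nmD _ _)); rewrite !nmM.
  apply: (@le_trans _ _ (nm a * (e2 * s t) + nm b * (e2 * s t))).
    by rewrite lerD // ler_wpM2l ?nm_ge0.
  rewrite -mulrDl mulrA (mulrC _ e2); apply: ler_wpM2r => //.
  by apply: le_trans e2A; apply: ler_wpM2l; [exact: ltW | rewrite /A; lra].
by have := mulr_gt0 e0 st1; lra.
Qed.

Lemma lin_ext (T : Type) (s : T -> R) (f g : T -> C) f0 L d :
  0 < d -> (forall t, s t < d -> f t = g t) -> lin s f f0 L -> lin s g f0 L.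
Proof.
move=> d0 fg lf e /lf[d1 d10 fe]; exists (Num.min d d1); rewrite ?lt_min ?d0 //.
by move=> t; rewrite lt_min => /andP[td /fe]; rewrite fg.
Qed.

Lemma lin_eqL (T : Type) (s : T -> R) (f : T -> C) f0 L M :
  L =1 M -> lin s f f0 L -> lin s f f0 M.
Proof. by move=> /funext ->. Qed.

Lemma lin_exact (T : Type) (s : T -> R) (f : T -> C) f0 L :
  (forall t, 0 <= s t) -> (forall t, f t = f0 + L t) -> lin s f f0 L.
Proof.
move=> s0 E e e0; exists 1 => // t _; rewrite E.
have -> : f0 + L t - f0 - L t = 0 by ring.
by rewrite nm0 mulr_ge0 // ltW.
Qed.

Lemma dif2_lin_bound (a b : C) t : nm (a * t.1 + b * t.2) <= (nm a + nm b) * nm2 t.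
Proof.
apply: (le_trans (nmD _ _)); rewrite !nmM mulrDl.
by rewrite lerD // ler_wpM2l ?nm_ge0 // /nm2 ?lerDl ?lerDr nm_ge0.
Qed.

Lemma dif_comp2 G (f g : C -> C) c l m a b :
  dif f c l -> dif g c m -> dif2 G (f c) (g c) a b ->
  dif (fun z => G (f z) (g z)) c (a * l + b * m).
Proof.
move=> df dg dG; apply: (@lin_eqL _ _ _ _ (fun h => a * (l * h) + b * (m * h))).
  by move=> h; ring.
apply: (@lin_comp2 _ nm (fun h => f (c + h)) (fun h => g (c + h)) _ _ _ _
  G a b (nm l + nm m)) => //= t; rewrite ?nm_ge0 //;
  by rewrite nmM ler_wpM2r ?nm_ge0 // ?lerDl ?lerDr nm_ge0.
Qed.

Lemma dif2_comp2 G (f g : C -> C -> C) x y a1 b1 a2 b2 a b :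
  dif2 f x y a1 b1 -> dif2 g x y a2 b2 -> dif2 G (f x y) (g x y) a b ->
  dif2 (fun z w => G (f z w) (g z w)) x y (a * a1 + b * a2) (a * b1 + b * b2).
Proof.
move=> df dg dG.
apply: (@lin_eqL _ _ _ _ (fun t => a * (a1 * t.1 + b1 * t.2)
                                + b * (a2 * t.1 + b2 * t.2))).
  by move=> h; ring.
apply: (@lin_comp2 _ nm2 (fun t => f (x + t.1) (y + t.2))
  (fun t => g (x + t.1) (y + t.2)) _ _ _ _
  G a b (nm a1 + nm b1 + (nm a2 + nm b2))) => //= t; rewrite ?nm2_ge0 //;
  apply: (le_trans (dif2_lin_bound _ _ _));
  by rewrite ler_wpM2r ?nm2_ge0 // ?lerDl ?lerDr addr_ge0 ?nm_ge0.
Qed.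

Lemma dif2_fst x y : dif2 (fun z _ => z) x y 1 0.
Proof. by apply: lin_exact => [|t]; [exact: nm2_ge0 | ring]. Qed.

Lemma dif2_snd x y : dif2 (fun _ w => w) x y 0 1.
Proof. by apply: lin_exact => [|t]; [exact: nm2_ge0 | ring]. Qed.

Lemma dif2_cst k x y : dif2 (fun _ _ => k) x y 0 0.
Proof. by apply: lin_exact => [|t]; [exact: nm2_ge0 | ring]. Qed.

Lemma dif_id c : dif id c 1.
Proof. by apply: lin_exact => [|t]; [exact: nm_ge0 | rewrite /=; ring]. Qed.

Lemma dif_cst k c : dif (fun=> k) c 0.
Proof. by apply: lin_exact => [|t]; [exact: nm_ge0 | ring]. Qed.

Lemma dif_dif2 f x y l : dif f x l -> dif2 (fun z _ => f z) x y l 0.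
Proof.
move=> df e e0; have [d d0 de] := df e e0; exists d => // t; rewrite /nm2 => td.
rewrite mul0r addr0.
have t2 := nm_ge0 t.2; have t1 := nm_ge0 t.1.
apply: (le_trans (de _ _)); [lra | by rewrite mulrDr lerDl mulr_ge0 // ltW].
Qed.

Lemma dif2_add x y : dif2 (fun z w => z + w) x y 1 1.
Proof. by apply: lin_exact => [|t]; [exact: nm2_ge0 | ring]. Qed.

Lemma dif2_mul x y : dif2 (fun z w => z * w) x y y x.
Proof.
move=> e e0; exists e => // t te.
have -> : (x + t.1) * (y + t.2) - x * y - (y * t.1 + x * t.2) = t.1 * t.2 by ring.
rewrite nmM; move: te; rewrite /nm2.
by have := nm_ge0 t.1; have := nm_ge0 t.2; nra.
Qed.

Lemma dif_add f g c l m : dif f c l -> dif g c m -> dif (fun z => f z + g z) c (l + m).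
Proof.
move=> df dg; rewrite -[l]mul1r -[m]mul1r.
exact: (@dif_comp2 (fun z w => z + w) _ _ _ _ _ _ _ df dg (dif2_add _ _)).
Qed.

Lemma dif_mul f g c l m : dif f c l -> dif g c m ->
  dif (fun z => f z * g z) c (l * g c + m * f c).
Proof.
move=> df dg; rewrite (mulrC l) (mulrC m).
exact: (@dif_comp2 (fun z w => z * w) _ _ _ _ _ _ _ df dg (dif2_mul _ _)).
Qed.

Lemma dif_comp g f c l m : dif f c l -> dif g (f c) m -> dif (fun z => g (f z)) c (m * l).
Proof.
move=> df dg; have := dif_comp2 df (dif_cst 0 c) (@dif_dif2 g (f c) 0 m dg).
by rewrite mul0r addr0.
Qed.

Lemma dif2_addf f g x y a1 b1 a2 b2 : dif2 f x y a1 b1 -> dif2 g x y a2 b2 ->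
  dif2 (fun z w => f z w + g z w) x y (a1 + a2) (b1 + b2).
Proof.
move=> df dg.
by have := dif2_comp2 df dg (dif2_add (f x y) (g x y)); rewrite !mul1r.
Qed.

Lemma dif2_mulf f g x y a1 b1 a2 b2 : dif2 f x y a1 b1 -> dif2 g x y a2 b2 ->
  dif2 (fun z w => f z w * g z w) x y (a1 * g x y + a2 * f x y) (b1 * g x y + b2 * f x y).
Proof.
move=> df dg; rewrite (mulrC a1) (mulrC a2) (mulrC b1) (mulrC b2).
exact: (dif2_comp2 df dg (dif2_mul (f x y) (g x y))).
Qed.

Lemma dif2_comp g f x y a b m : dif2 f x y a b -> dif g (f x y) m ->
  dif2 (fun z w => g (f z w)) x y (m * a) (m * b).
Proof.
move=> df dg.
have := dif2_comp2 df (dif2_cst 0 x y) (@dif_dif2 g (f x y) 0 m dg).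
by rewrite !mul0r !addr0.
Qed.

Lemma dif_opp c : dif (fun z => - z) c (-1).
Proof. by apply: lin_exact => [|t]; [exact: nm_ge0 | ring]. Qed.

Lemma dif_inv c : c != 0 -> dif (fun z => z^-1) c (- c ^- 2).
Proof.
move=> c0 e e0; have nc : 0 < nm c by rewrite nm_gt0.
exists (Num.min (nm c / 2) (e * (nm c ^+ 3 / 2))).
  by rewrite lt_min divr_gt0 //= mulr_gt0 // divr_gt0 // exprn_gt0.
move=> h; rewrite lt_min => /andP[h1 h2].
have ch : nm c / 2 <= nm (c + h).
  by have := nm_sub c (- h); rewrite nmN opprK; lra.
have ch0 : 0 < nm (c + h) by lra.
have ch0' : c + h != 0 by rewrite -nm_gt0.
have -> : (c + h)^-1 - c^-1 - - c ^- 2 * h = h * (h / (c ^+ 2 * (c + h))).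
  by field; rewrite ch0' c0.
rewrite nmM mulrC ler_wpM2r ?nm_ge0 // nmM nmV nmM nmX.
have D0 : 0 < nm c ^+ 2 * nm (c + h) by rewrite mulr_gt0 // exprn_gt0.
rewrite ler_pdivrMr // (le_trans (ltW h2)) // ler_pM2l //.
by rewrite exprSr -mulrA ler_pM2l // exprn_gt0.
Qed.

(** Small positive real increments are enough to separate two complex slopes. *)
Lemma lin_unique1 (l : C) f f0 :
  (forall e, 0 < e -> exists2 d, 0 < d & forall t, nm t < d ->
     nm (f t - f0 - l * t) <= e * nm t) ->
  forall m, (forall e, 0 < e -> exists2 d, 0 < d & forall t, nm t < d ->
     nm (f t - f0 - m * t) <= e * nm t) -> l = m.
Proof.
move=> fl m fm; apply/eqP; rewrite -subr_eq0 -nm_eq0 eq_le nm_ge0 andbT leNgt.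
apply/negP => lm; pose e := nm (l - m) / 4.
have e0 : 0 < e by rewrite divr_gt0.
have [d d0 de] := fl e e0; have [d' d'0 de'] := fm e e0.
pose t := Num.min d d' / 2.
have t0 : 0 < t by rewrite divr_gt0 // lt_min d0.
have nt : nm t%:C = t by rewrite nmR gtr0_norm.
have md : Num.min d d' <= d /\ Num.min d d' <= d' by rewrite !ge_min !lexx orbT.
have /de A : nm t%:C < d by rewrite nt /t; case: md; lra.
have /de' B : nm t%:C < d' by rewrite nt /t; case: md; lra.
have := nmB (f t%:C - f0 - m * t%:C) (f t%:C - f0 - l * t%:C).
rewrite (_ : _ - _ - _ - _ = (l - m) * t%:C); last by ring.
by rewrite nmM; move: A B; rewrite nt /e; nra.
Qed.

Lemma dif_unique f c l m : dif f c l -> dif f c m -> l = m.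
Proof. by move=> D D'; exact: (@lin_unique1 l (fun t => f (c + t)) (f c) D m D'). Qed.

Lemma dif2_unique f x y a b a' b' :
  dif2 f x y a b -> dif2 f x y a' b' -> a = a' /\ b = b'.
Proof.
move=> D D'; split.
  apply: (@lin_unique1 _ (fun t => f (x + t) y) (f x y)) => e e0.
    have [d d0 de] := D _ e0; exists d => // t td.
    by have := de (t, 0); rewrite /nm2 /= nm0 mulr0 !addr0; exact.
  have [d d0 de] := D' _ e0; exists d => // t td.
  by have := de (t, 0); rewrite /nm2 /= nm0 mulr0 !addr0; exact.
apply: (@lin_unique1 _ (fun t => f x (y + t)) (f x y)) => e e0.
  have [d d0 de] := D _ e0; exists d => // t td.
  by have := de (0, t); rewrite /nm2 /= nm0 mulr0 !(add0r, addr0); exact.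
have [d d0 de] := D' _ e0; exists d => // t td.
by have := de (0, t); rewrite /nm2 /= nm0 mulr0 !(add0r, addr0); exact.
Qed.

Lemma dif2_dif1 f x y a b : dif2 f x y a b -> dif (f^~ y) x a.
Proof.
move=> D e /D[d d0 de]; exists d => // t td.
by have := de (t, 0); rewrite /nm2 /= nm0 mulr0 !addr0; exact.
Qed.

Lemma dif2_dif2 f x y a b : dif2 f x y a b -> dif (f x) y b.
Proof.
move=> D e /D[d d0 de]; exists d => // t td.
by have := de (0, t); rewrite /nm2 /= nm0 mulr0 !(add0r, addr0); exact.
Qed.

Lemma dif_ext f g c l d : 0 < d -> (forall z, nm (z - c) < d -> f z = g z) ->
  dif f c l -> dif g c l.
Proof.
move=> d0 fg; rewrite /dif -(fg c) ?subrr ?nm0 //; apply: (lin_ext d0) => t td.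
by rewrite fg // addrC addKr.
Qed.

Lemma dif2_ext f g x y a b d : 0 < d ->
  (forall z w, nm (z - x) < d -> nm (w - y) < d -> f z w = g z w) ->
  dif2 f x y a b -> dif2 g x y a b.
Proof.
move=> d0 fg; rewrite /dif2 -(fg x y) ?subrr ?nm0 //; apply: (lin_ext d0) => t.
rewrite /nm2 => td; rewrite fg //= addrC addKr;
by have := nm_ge0 t.1; have := nm_ge0 t.2; lra.
Qed.

Lemma hol_cts f c : hol f c -> forall e, 0 < e -> exists2 d, 0 < d &
  forall z, nm (z - c) < d -> nm (f z - f c) <= e.
Proof.
move=> [l D] e e0; have [d d0 de] := D 1 ltr01.
have L0 : 0 < nm l + 1 by rewrite ltr_wpDl ?nm_ge0.
exists (Num.min d (e / (nm l + 1))); rewrite ?lt_min ?d0 ?divr_gt0 //.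
move=> z; rewrite lt_min => /andP[/de]; rewrite (addrC c) subrK ltr_pdivlMr // => A B.
have := nmD (f z - f c - l * (z - c)) (l * (z - c)); rewrite subrK nmM.
by move: A B; rewrite mul1r; lra.
Qed.

Lemma hol2_cts f x y : hol2 f x y -> forall e, 0 < e -> exists2 d, 0 < d &
  forall z w, nm (z - x) < d -> nm (w - y) < d -> nm (f z w - f x y) <= e.
Proof.
move=> [a [b D]] e e0; have [d d0 de] := D 1 ltr01.
pose L := nm a + nm b + 1; have ab : 0 <= nm a + nm b by rewrite addr_ge0 ?nm_ge0.
have L0 : 0 < L by rewrite /L; lra.
exists (Num.min (d / 2) (e / (2 * L))).
  by rewrite lt_min !divr_gt0 // mulr_gt0.
move=> z w; rewrite !lt_min => /andP[z1 z2] /andP[w1 w2].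
have := de (z - x, w - y); rewrite /nm2 /= !(addrC _ (_ - _)) !subrK.
move=> /(_ ltac:(lra)) A.
have := nmD (f z w - f x y - (a * (z - x) + b * (w - y))) (a * (z - x) + b * (w - y)).
rewrite subrK; have := @dif2_lin_bound a b (z - x, w - y); rewrite /nm2 /=.
have : L * (nm (z - x) + nm (w - y)) <= e.
  have -> : e = L * (e / (2 * L) + e / (2 * L)) by field; rewrite gt_eqF.
  by rewrite ler_pM2l //; lra.
by move: A; rewrite /L mul1r; lra.
Qed.

End Differentiability.

(** * Cauchy theory *)

Section SegmentIntegral.
Variable R : realType.
Local Notation C := R[i].
Local Notation nm := (@nm R).
Local Notation mu := (@lebesgue_measure R).

Definition cint (a b : R) (f : R -> C) : C :=
  \int[mu]_(x in `[a, b]) complex.Re (f x) +i* \int[mu]_(x in `[a, b]) complex.Im (f x).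

(** The neighbor [x'] is not confined to the segment, so continuity is two-sided also at the ends
    [a] and [b]. *)
Definition rcts (a b : R) (f : R -> C) := forall x, a <= x <= b ->
  forall e, 0 < e -> exists2 d, 0 < d & forall x', `|x' - x| < d -> nm (f x' - f x) <= e.

Lemma rcts_sub a b a' b' f : a <= a' -> b' <= b -> rcts a b f -> rcts a' b' f.
Proof.
by move=> aa bb fc x /andP[ax xb]; apply: fc; rewrite (le_trans aa) // (le_trans xb).
Qed.

Lemma rcts_part (p : C -> R) a b f :
  (forall z w, `|p z - p w| <= nm (z - w)) -> rcts a b f ->
  mu.-integrable `[a, b] (EFin \o (fun x => p (f x))).
Proof.
move=> pl fc; apply: continuous_compact_integrable; first exact: segment_compact.
apply: continuous_in_subspaceT => x; rewrite inE /= in_itv /= => xab.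
apply/cvgrPdist_le => e e0; have [d d0 de] := fc x xab e e0.
apply/nbhs_ballP; exists d => //= y; rewrite /ball /= => xy.
by rewrite (le_trans (pl _ _)) // nmBC de // distrC.
Qed.

Lemma Re_lip (z w : C) : `|complex.Re z - complex.Re w| <= nm (z - w).
Proof. by rewrite -cReN -cReD Re_le_nm. Qed.

Lemma Im_lip (z w : C) : `|complex.Im z - complex.Im w| <= nm (z - w).
Proof. by rewrite -cImN -cImD Im_le_nm. Qed.

Let Rei a b f := @rcts_part _ a b f Re_lip.
Let Imi a b f := @rcts_part _ a b f Im_lip.
Let itvm (a b : R) : measurable `[a, b]. Proof. exact: measurable_itv. Qed.

Lemma cintD a b f g : rcts a b f -> rcts a b g ->
  cint a b (fun x => f x + g x) = cint a b f + cint a b g.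
Proof.
move=> fc gc; apply: complex_eq; rewrite ?cReD ?cImD /=.
  rewrite -RintegralD //; [|exact: Rei..].
  by apply: eq_Rintegral => x _; rewrite cReD.
rewrite -RintegralD //; [|exact: Imi..].
by apply: eq_Rintegral => x _; rewrite cImD.
Qed.

Lemma rcts_scale k a b f : rcts a b f -> rcts a b (fun x => k * f x).
Proof.
move=> fc x xab e e0; have K0 : 0 < nm k + 1 by rewrite ltr_wpDl ?nm_ge0.
have [d d0 de] := fc x xab _ (divr_gt0 e0 K0); exists d => // x' /de h.
rewrite -mulrBr nmM; rewrite ler_pdivlMr // in h.
by have := nm_ge0 (f x' - f x); lra.
Qed.

Lemma rctsD a b f g : rcts a b f -> rcts a b g -> rcts a b (fun x => f x + g x).
Proof.
move=> fc gc x xab e e0; have e2 : 0 < e / 2 by rewrite divr_gt0.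
have [d d0 de] := fc x xab _ e2; have [d' d'0 de'] := gc x xab _ e2.
exists (Num.min d d'); first by rewrite lt_min d0.
move=> x'; rewrite lt_min => /andP[/de A /de' B]; rewrite opprD addrACA.
by apply: (le_trans (nmD _ _)); lra.
Qed.

Lemma rcts_cst k a b : rcts a b (fun=> k).
Proof. by move=> x _ e e0; exists 1 => // x' _; rewrite subrr nm0 ltW. Qed.

Lemma cintZ k a b f : rcts a b f -> cint a b (fun x => k * f x) = k * cint a b f.
Proof.
move=> fc; have [Fr Fi] := (Rei fc, Imi fc).
have D (c d : R) : \int[mu]_(x in `[a, b]) (c * complex.Re (f x) + d * complex.Im (f x))
   = c * complex.Re (cint a b f) + d * complex.Im (cint a b f).
  have Jr : mu.-integrable `[a, b] (EFin \o (fun x => c * complex.Re (f x))).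
    have := Rei (rcts_scale c%:C fc).
    rewrite (_ : (fun x => complex.Re (c%:C * f x)) = (fun x => c * complex.Re (f x))) //.
    by apply/funext => x; rewrite cReM /= mul0r subr0.
  have Ji : mu.-integrable `[a, b] (EFin \o (fun x => d * complex.Im (f x))).
    have := Imi (rcts_scale d%:C fc).
    rewrite (_ : (fun x => complex.Im (d%:C * f x)) = (fun x => d * complex.Im (f x))) //.
    by apply/funext => x; rewrite cImM /= mul0r addr0.
  by rewrite RintegralD ?RintegralZl //; exact: itvm.
apply: complex_eq; rewrite ?cReM ?cImM.
  by rewrite -mulNr -D; apply: eq_Rintegral => x _; rewrite cReM mulNr.
by rewrite addrC -D; apply: eq_Rintegral => x _; rewrite cImM addrC.
Qed.

Lemma eq_cint a b f g : (forall x, a <= x <= b -> f x = g x) -> cint a b f = cint a b g.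
Proof.
move=> fg; apply: complex_eq; apply: eq_Rintegral => x;
  by rewrite inE /= in_itv /= => /fg ->.
Qed.

Let mu_itv (a b : R) : a <= b -> fine (mu `[a, b]) = b - a.
Proof.
rewrite le_eqVlt => /orP[/eqP ->|ab]; first by rewrite set_itv1 lebesgue_measure_set1 subrr.
by rewrite lebesgue_measure_itv /= lte_fin ab.
Qed.

Lemma Re_cint_le a b f M : a <= b -> rcts a b f ->
  (forall x, a <= x <= b -> complex.Re (f x) <= M) -> complex.Re (cint a b f) <= M * (b - a).
Proof.
move=> ab fc fM; rewrite -mu_itv // -Rintegral_cst; last exact: itvm.
apply: le_Rintegral; [exact: itvm|exact: Rei|exact: (Rei (@rcts_cst M%:C a b))|].
by move=> x /=; rewrite in_itv /=; exact: fM.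
Qed.

Lemma cint_le a b f M : a <= b -> rcts a b f ->
  (forall x, a <= x <= b -> nm (f x) <= M) -> nm (cint a b f) <= M * (b - a).
Proof.
move=> ab fc fM; have [->|I0] := eqVneq (cint a b f) 0.
  rewrite nm0 mulr_ge0 ?subr_ge0 //.
  by apply: le_trans (nm_ge0 _) (fM a _); rewrite lexx.
(* Rotation by the unimodular [u] turns the integral into a nonnegative real, so that a bound on
   real parts suffices. *)
pose u := (nm (cint a b f))%:C / cint a b f.
have nu : nm u = 1 by rewrite nmM nmV nmR ger0_norm ?nm_ge0 // divff // nm_eq0.
have -> : nm (cint a b f) = complex.Re (cint a b (fun x => u * f x)).
  by rewrite cintZ // /u divfK.
apply: Re_cint_le => //; first exact: rcts_scale.
move=> x /fM; rewrite -[nm (f x)]mul1r -nu -nmM; apply: le_trans.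
by rewrite (le_trans (ler_norm _)) // Re_le_nm.
Qed.

Lemma Im_cint_ge a b f M : a <= b -> rcts a b f ->
  (forall x, a <= x <= b -> M <= complex.Im (f x)) -> M * (b - a) <= complex.Im (cint a b f).
Proof.
move=> ab fc fM; have := @Re_cint_le a b (fun x => 'i * f x) (- M) ab (rcts_scale _ fc).
rewrite cintZ // cReM /= mul0r mul1r sub0r mulNr lerN2; apply => x /fM.
by rewrite cReM /= mul0r mul1r sub0r lerN2.
Qed.

Lemma cint_cat b a c f : a <= b -> b <= c -> rcts a c f ->
  cint a c f = cint a b f + cint b c f.
Proof.
move=> ab bc fc.
have P (p : C -> R) : (forall z w, `|p z - p w| <= nm (z - w)) ->
    \int[mu]_(x in `[a, c]) p (f x) =
    \int[mu]_(x in `[a, b]) p (f x) + \int[mu]_(x in `[b, c]) p (f x).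
  move=> pl; have I := rcts_part pl fc.
  apply/eqP; rewrite addrC -subr_eq; apply/eqP.
  rewrite (Rintegral_itvB I) ?bnd_simp //.
  by rewrite Rintegral_itv_obnd_cbnd //; apply: (integrableS _ _ _ I) => //;
    apply: subset_itvr; rewrite bnd_simp.
by apply: complex_eq; rewrite ?cReD ?cImD /=; apply: P; [exact: Re_lip | exact: Im_lip].
Qed.

Lemma cint_cst k a b : a <= b -> cint a b (fun=> k) = k * (b - a)%:C.
Proof.
move=> ab; apply: complex_eq; rewrite ?cReM ?cImM /= !mulr0 ?subr0 ?addr0 ?add0r;
  by rewrite Rintegral_cst ?mu_itv //; exact: itvm.
Qed.

End SegmentIntegral.

(** * Integrals over the boundary of a rectangle, Goursat's lemma *)

Section RectangleIntegral.
Variable R : realType.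
Local Notation C := R[i].
Local Notation nm := (@nm R).

Definition ccts (f : C -> C) c := forall e, 0 < e -> exists2 d, 0 < d &
  forall z, nm (z - c) < d -> nm (f z - f c) <= e.

Lemma ccts_cst k c : ccts (fun=> k) c.
Proof. by move=> e e0; exists 1 => // z _; rewrite subrr nm0 ltW. Qed.

Lemma cctsD f g c : ccts f c -> ccts g c -> ccts (fun z => f z + g z) c.
Proof.
move=> fc gc e e0; have e2 : 0 < e / 2 by rewrite divr_gt0.
have [d d0 de] := fc _ e2; have [d' d'0 de'] := gc _ e2.
exists (Num.min d d'); first by rewrite lt_min d0.
move=> z; rewrite lt_min => /andP[/de A /de' B]; rewrite opprD addrACA.
by apply: (le_trans (nmD _ _)); lra.
Qed.

Lemma cctsZ k f c : ccts f c -> ccts (fun z => k * f z) c.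
Proof.
move=> fc e e0; have K0 : 0 < nm k + 1 by rewrite ltr_wpDl ?nm_ge0.
have [d d0 de] := fc _ (divr_gt0 e0 K0); exists d => // z /de h.
rewrite -mulrBr nmM; rewrite ler_pdivlMr // in h.
by have := nm_ge0 (f z - f c); lra.
Qed.

Lemma ccts_id c : ccts id c.
Proof. by move=> e e0; exists e => // z /ltW. Qed.

(** The contour is counterclockwise; the factor ['i] is dz / dy on the vertical sides. *)
Definition rint (f : C -> C) (x0 x1 y0 y1 : R) : C :=
  cint x0 x1 (fun x => f (x +i* y0)) + 'i * cint y0 y1 (fun y => f (x1 +i* y))
  - cint x0 x1 (fun x => f (x +i* y1)) - 'i * cint y0 y1 (fun y => f (x0 +i* y)).

Definition inrect (x0 x1 y0 y1 : R) (z : C) : bool :=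
  (x0 <= complex.Re z <= x1) && (y0 <= complex.Im z <= y1).

Definition bdry (x0 x1 y0 y1 : R) (z : C) : bool :=
  inrect x0 x1 y0 y1 z && [|| complex.Re z == x0, complex.Re z == x1,
    complex.Im z == y0 | complex.Im z == y1].

Lemma rcts_hor f x0 x1 y : (forall x, x0 <= x <= x1 -> ccts f (x +i* y)) ->
  rcts x0 x1 (fun x => f (x +i* y)).
Proof.
move=> fc x xx e e0; have [d d0 de] := fc x xx e e0; exists d => // x' xd.
apply: de; rewrite (_ : _ - _ = (x' - x)%:C) ?nmR //.
by apply: complex_eq => /=; ring.
Qed.

Lemma rcts_ver f x y0 y1 : (forall y, y0 <= y <= y1 -> ccts f (x +i* y)) ->
  rcts y0 y1 (fun y => f (x +i* y)).
Proof.
move=> fc y yy e e0; have [d d0 de] := fc y yy e e0; exists d => // y' yd.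
apply: de; rewrite (_ : _ - _ = 'i * (y' - y)%:C) ?nmM ?nmi ?mul1r ?nmR //.
by apply: complex_eq => /=; ring.
Qed.

Lemma bdry_rcts f x0 x1 y0 y1 : x0 <= x1 -> y0 <= y1 ->
  (forall z, bdry x0 x1 y0 y1 z -> ccts f z) ->
  [/\ rcts x0 x1 (fun x => f (x +i* y0)), rcts x0 x1 (fun x => f (x +i* y1)),
      rcts y0 y1 (fun y => f (x0 +i* y)) & rcts y0 y1 (fun y => f (x1 +i* y))].
Proof.
move=> xx yy fc.
by split; [apply: rcts_hor|apply: rcts_hor|apply: rcts_ver|apply: rcts_ver] => t tt;
  apply: fc; rewrite /bdry /inrect /= tt ?lexx ?xx ?yy ?eqxx ?orbT.
Qed.

Lemma rintD f g x0 x1 y0 y1 : x0 <= x1 -> y0 <= y1 ->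
  (forall z, bdry x0 x1 y0 y1 z -> ccts f z) ->
  (forall z, bdry x0 x1 y0 y1 z -> ccts g z) ->
  rint (fun z => f z + g z) x0 x1 y0 y1 = rint f x0 x1 y0 y1 + rint g x0 x1 y0 y1.
Proof.
move=> xx yy /(bdry_rcts xx yy)[f1 f2 f3 f4] /(bdry_rcts xx yy)[g1 g2 g3 g4].
by rewrite /rint !cintD //; ring.
Qed.

Lemma rintZ k f x0 x1 y0 y1 : x0 <= x1 -> y0 <= y1 ->
  (forall z, bdry x0 x1 y0 y1 z -> ccts f z) ->
  rint (fun z => k * f z) x0 x1 y0 y1 = k * rint f x0 x1 y0 y1.
Proof.
by move=> xx yy /(bdry_rcts xx yy)[f1 f2 f3 f4]; rewrite /rint !cintZ //; ring.
Qed.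

Lemma rint_le f x0 x1 y0 y1 M : x0 <= x1 -> y0 <= y1 ->
  (forall z, bdry x0 x1 y0 y1 z -> ccts f z) ->
  (forall z, bdry x0 x1 y0 y1 z -> nm (f z) <= M) ->
  nm (rint f x0 x1 y0 y1) <= 2 * M * ((x1 - x0) + (y1 - y0)).
Proof.
move=> xx yy /(bdry_rcts xx yy)[f1 f2 f3 f4] fM.
have B (x y : R) : x0 <= x <= x1 -> y0 <= y <= y1 ->
    [|| x == x0, x == x1, y == y0 | y == y1] -> nm (f (x +i* y)) <= M.
  by move=> a b c; apply: fM; rewrite /bdry /inrect /= a b c.
have X0 : x0 <= x0 <= x1 by rewrite lexx. have X1 : x0 <= x1 <= x1 by rewrite lexx xx.
have Y0 : y0 <= y0 <= y1 by rewrite lexx. have Y1 : y0 <= y1 <= y1 by rewrite lexx yy.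
have := cint_le xx f1 (fun x h => B x y0 h Y0 ltac:(by rewrite eqxx ?orbT)).
have := cint_le xx f2 (fun x h => B x y1 h Y1 ltac:(by rewrite eqxx ?orbT)).
have := cint_le yy f3 (fun y h => B x0 y X0 h ltac:(by rewrite eqxx ?orbT)).
have := cint_le yy f4 (fun y h => B x1 y X1 h ltac:(by rewrite eqxx ?orbT)).
rewrite /rint => h4 h3 h2 h1.
apply: (le_trans (nmB _ _)); rewrite nmM nmi mul1r.
have := nmB (cint x0 x1 (fun x => f (x +i* y0)) + 'i * cint y0 y1 (fun y => f (x1 +i* y)))
  (cint x0 x1 (fun x => f (x +i* y1))).
have := nmD (cint x0 x1 (fun x => f (x +i* y0))) ('i * cint y0 y1 (fun y => f (x1 +i* y))).
by rewrite nmM nmi mul1r; lra.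
Qed.

Lemma rint_splitx xm f x0 x1 y0 y1 : x0 <= xm -> xm <= x1 ->
  rcts x0 x1 (fun x => f (x +i* y0)) -> rcts x0 x1 (fun x => f (x +i* y1)) ->
  rint f x0 x1 y0 y1 = rint f x0 xm y0 y1 + rint f xm x1 y0 y1.
Proof. by move=> a b c d; rewrite /rint !(cint_cat a b) //; ring. Qed.

Lemma rint_splity ym f x0 x1 y0 y1 : y0 <= ym -> ym <= y1 ->
  rcts y0 y1 (fun y => f (x0 +i* y)) -> rcts y0 y1 (fun y => f (x1 +i* y)) ->
  rint f x0 x1 y0 y1 = rint f x0 x1 y0 ym + rint f x0 x1 ym y1.
Proof. by move=> a b c d; rewrite /rint !(cint_cat a b) //; ring. Qed.

(** Opposite sides differ by a translation, hence each pair contributes a constant, and the two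
    constants cancel. In [goursat] this allows subtracting a first order expansion without any
    primitive. *)
Lemma rint_affine k m x0 x1 y0 y1 : x0 <= x1 -> y0 <= y1 ->
  rint (fun z => k + m * z) x0 x1 y0 y1 = 0.
Proof.
move=> xx yy.
have fc z : ccts (fun z => k + m * z) z.
  by apply: cctsD; [exact: ccts_cst | exact: cctsZ (@ccts_id z)].
have H (y : R) : rcts x0 x1 (fun x => k + m * (x +i* y)) by exact: rcts_hor (fun x _ => fc _).
have V (x : R) : rcts y0 y1 (fun y => k + m * (x +i* y)) by exact: rcts_ver (fun x _ => fc _).
have E1 : cint x0 x1 (fun x => k + m * (x +i* y1)) =
    cint x0 x1 (fun x => k + m * (x +i* y0)) + m * 'i * (y1 - y0)%:C * (x1 - x0)%:C.
  rewrite -cint_cst // -cintD //; last exact: rcts_cst.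
  apply: eq_cint => x _; rewrite (_ : x +i* y1 = x +i* y0 + 'i * (y1 - y0)%:C); first by ring.
  by apply: complex_eq => /=; ring.
have E2 : cint y0 y1 (fun y => k + m * (x1 +i* y)) =
    cint y0 y1 (fun y => k + m * (x0 +i* y)) + m * (x1 - x0)%:C * (y1 - y0)%:C.
  rewrite -cint_cst // -cintD //; last exact: rcts_cst.
  apply: eq_cint => y _; rewrite (_ : x1 +i* y = x0 +i* y + (x1 - x0)%:C); first by ring.
  by apply: complex_eq => /=; ring.
by rewrite /rint E1 E2; ring.
Qed.

Lemma inrect_sub x0 x1 y0 y1 x0' x1' y0' y1' :
  [&& x0 <= x0', x1' <= x1, y0 <= y0' & y1' <= y1] -> forall z,
  inrect x0' x1' y0' y1' z -> inrect x0 x1 y0 y1 z.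
Proof.
case/and4P=> a b c d z /andP[/andP[e f] /andP[g h]]; rewrite /inrect.
by rewrite (le_trans a) // (le_trans f) // (le_trans c) // (le_trans h).
Qed.

Lemma rint_quarter xm ym f x0 x1 y0 y1 : x0 <= xm -> xm <= x1 -> y0 <= ym -> ym <= y1 ->
  (forall z, inrect x0 x1 y0 y1 z -> ccts f z) ->
  rint f x0 x1 y0 y1 = rint f x0 xm y0 ym + rint f x0 xm ym y1
    + (rint f xm x1 y0 ym + rint f xm x1 ym y1).
Proof.
move=> a b c d fc; have ab := le_trans a b; have cd := le_trans c d.
rewrite (rint_splitx a b) ?(rint_splity c d) //;
  by (apply: rcts_hor || apply: rcts_ver) => t tt; apply: fc;
  rewrite /inrect /= tt ?lexx ?a ?b ?c ?d ?ab ?cd.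
Qed.

Lemma two_pow_gt (x : R) : exists n : nat, x < 2 ^+ n.
Proof.
exists (Num.bound x); apply: (le_lt_trans (ler_norm x)).
apply: (lt_le_trans (archi_boundP (normr_ge0 x))).
rewrite (_ : Num.bound `|x| = Num.bound x); last by rewrite /Num.bound normr_id.
by rewrite -natrX ler_nat ltnW // ltn_expl.
Qed.

(** The intervals [x n, x n + w / 2^n] are nested, and the supremum of their left ends lies in all
    of them. Goursat's rectangles are treated one coordinate at a time. *)
Lemma nested_halving (w : R) (x : nat -> R) : 0 <= w ->
  (forall n, x n <= x n.+1 /\ x n.+1 + w / 2 ^+ n.+1 <= x n + w / 2 ^+ n) ->
  exists c, forall n, x n <= c <= x n + w / 2 ^+ n.
Proof.
move=> w0 xs; have wn n : 0 <= w / 2 ^+ n by rewrite divr_ge0 // exprn_ge0.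
have up n m : x n <= x (n + m)%N.
  by elim: m => [|m IH]; rewrite ?addn0 // addnS (le_trans IH) //; case: (xs (n + m)%N).
have dn n m : x (n + m)%N + w / 2 ^+ (n + m) <= x n + w / 2 ^+ n.
  elim: m => [|m IH]; rewrite ?addn0 // addnS (le_trans _ IH) //.
  by case: (xs (n + m)%N).
have ub n m : x m <= x n + w / 2 ^+ n.
  have := up m n; have := dn n m; rewrite (addnC m); have := wn (n + m)%N; lra.
have hs : has_sup [set t | exists n, t = x n].
  split; first by exists (x 0%N), 0%N.
  by exists (x 0%N + w / 2 ^+ 0) => _ [n ->].
exists (sup [set t | exists n, t = x n]) => n; apply/andP; split.
  by apply: sup_upper_bound => //; exists n.
by apply: ge_sup => [|_ [m ->]]; [case: hs | exact: ub].
Qed.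

Lemma goursat f x0 x1 y0 y1 : x0 <= x1 -> y0 <= y1 ->
  (forall z, inrect x0 x1 y0 y1 z -> hol f z) -> rint f x0 x1 y0 y1 = 0.
Proof.
move=> xx yy fh; pose w := x1 - x0; pose h := y1 - y0.
have w0 : 0 <= w by rewrite subr_ge0. have h0 : 0 <= h by rewrite subr_ge0.
suff K e : 0 < e -> nm (rint f x0 x1 y0 y1) <= e * (w + h) ^+ 2.
  apply: nm_le0; rewrite leNgt; apply/negP => p.
  have D0 : 0 < (w + h) ^+ 2 + 1 by rewrite ltr_wpDl ?sqr_ge0.
  have := K _ (divr_gt0 p (mulr_gt0 (ltr0n _ 2) D0)).
  rewrite leNgt => /negP; apply; set r := nm _.
  rewrite -mulrA -[ltRHS]mulr1 ltr_pM2l // mulrC ltr_pdivrMr ?mulr_gt0 //; lra.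
move=> e0; rewrite leNgt; apply/negP => bad0.
pose W n : R := w / 2 ^+ n; pose H n : R := h / 2 ^+ n.
have WS n : W n = W n.+1 + W n.+1.
  by rewrite /W exprS; field; rewrite expf_neq0 ?pnatr_eq0.
have HS n : H n = H n.+1 + H n.+1.
  by rewrite /H exprS; field; rewrite expf_neq0 ?pnatr_eq0.
have W0 n : 0 <= W n by rewrite divr_ge0 // exprn_ge0.
have H0 n : 0 <= H n by rewrite divr_ge0 // exprn_ge0.
pose I n (p : R * R) := rint f p.1 (p.1 + W n) p.2 (p.2 + H n).
(* The threshold is [e] times the square of the half perimeter. Each quarter of a rectangle has a
   fourth of it, so a bad rectangle has a bad quarter, and [step] selects one. *)
pose bad n p := e * (W n + H n) ^+ 2 < nm (I n p).
pose q (i j : bool) n (p : R * R) := (p.1 + i%:R * W n.+1, p.2 + j%:R * H n.+1).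
pose step n p := let b i j := bad n.+1 (q i j n p) in
  if b false false then q false false n p else if b false true then q false true n p
  else if b true false then q true false n p else q true true n p.
pose s := fix s n := if n is n'.+1 then step n' (s n') else (x0, y0).
pose inn n (p : R * R) := [&& x0 <= p.1, p.1 + W n <= x1, y0 <= p.2 & p.2 + H n <= y1].
have stepP n p : exists i j, step n p = q i j n p.
  by rewrite /step; do 3?case: ifP => _; eexists; eexists.
have inS n p : inn n p -> inn n.+1 (step n p).
  case: (stepP n p) => i [j ->] /and4P[a b c d].
  have B (k : bool) (t u : R) : 0 <= u -> t <= t + k%:R * u /\ k%:R * u <= u.
    by move=> u0; case: k; rewrite ?mul1r ?mul0r ?addr0 ?lerDl.
  have [B1 B2] := B i p.1 _ (W0 n.+1); have [B3 B4] := B j p.2 _ (H0 n.+1).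
  rewrite /inn /q /= (le_trans a) // (le_trans c) //= (le_trans _ b) ?(le_trans _ d) //.
    by rewrite (HS n) -addrA lerD2l lerD2r.
  by rewrite (WS n) -addrA lerD2l lerD2r.
have badS n p : inn n p -> bad n p -> bad n.+1 (step n p).
  case: p => x y ip; rewrite {1}/bad => bp.
  have ic z : inrect x (x + W n) y (y + H n) z -> ccts f z.
    by move=> zz; apply: hol_cts; apply: fh; apply: (inrect_sub ip).
  have E : I n (x, y) = I n.+1 (q false false n (x, y)) + I n.+1 (q false true n (x, y)) +
      (I n.+1 (q true false n (x, y)) + I n.+1 (q true true n (x, y))).
    have xs : x + W n.+1 + W n.+1 = x + W n by rewrite -addrA -WS.
    have ys : y + H n.+1 + H n.+1 = y + H n by rewrite -addrA -HS.
    rewrite /I /q /= !mul0r !mul1r !addr0 xs ys.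
    by apply: rint_quarter; rewrite ?lerDl // lerD2l ?(WS n) ?(HS n) lerDl.
  rewrite /step; case: ifP => // /negbT; rewrite -leNgt => b1.
  case: ifP => // /negbT; rewrite -leNgt => b2.
  case: ifP => // /negbT; rewrite -leNgt => b3.
  rewrite /bad ltNge; apply/negP => b4; move: bp; rewrite ltNge => /negP; apply.
  rewrite E WS HS.
  have -> : e * (W n.+1 + W n.+1 + (H n.+1 + H n.+1)) ^+ 2 =
    e * (W n.+1 + H n.+1) ^+ 2 + e * (W n.+1 + H n.+1) ^+ 2 +
    (e * (W n.+1 + H n.+1) ^+ 2 + e * (W n.+1 + H n.+1) ^+ 2) by ring.
  by apply: (le_trans (nmD _ _)); apply: lerD; apply: (le_trans (nmD _ _)); apply: lerD.
have inv n : inn n (s n) && bad n (s n).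
  elim: n => [|n /andP[a b]] /=; last by rewrite inS ?badS.
  rewrite /inn /bad /I /W /H /= expr0 !divr1 /w /h !subrKC !lexx /=.
  exact: bad0.
have [a ha] := @nested_halving w (fun n => (s n).1) w0 ltac:(move=> n; rewrite -/(W n)
  -/(W n.+1) /=; case: (stepP n (s n)) => i [j ->]; rewrite /q /=; have := WS n;
  have := W0 n.+1; case: i => /=; lra).
have [b hb] := @nested_halving h (fun n => (s n).2) h0 ltac:(move=> n; rewrite -/(H n)
  -/(H n.+1) /=; case: (stepP n (s n)) => i [j ->]; rewrite /q /=; have := HS n;
  have := H0 n.+1; case: j => /=; lra).
pose c := a +i* b.
have [l D] : hol f c.
  apply: fh; have /andP[/and4P[p1 p2 p3 p4] _] := inv 0%N.
  move: (ha 0%N) (hb 0%N); rewrite -/(W 0%N) -/(H 0%N) /inrect /= => A B.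
  by apply/andP; split; move: p1 p2 p3 p4 => /=; lra.
have [d d0 de] := D (e / 2) (divr_gt0 e0 (ltr0n _ 2)).
have [n n2] := two_pow_gt ((w + h) / d).
have WHd : W n + H n < d.
  rewrite /W /H -mulrDl ltr_pdivrMr ?exprn_gt0 // mulrC -ltr_pdivrMr //.
move: (ha n) (hb n) (inv n); rewrite -/(W n) -/(H n); case: (s n) => x y /=.
move=> xa yb /andP[xi]; rewrite /bad ltNge => /negP; apply.
have x1' : x <= x + W n by have := W0 n; lra.
have y1' : y <= y + H n by have := H0 n; lra.
(* [g] is [f] minus its first order expansion at the common point [c]; its integral is the same by
   [rint_affine], but it is small on a small rectangle. *)
pose g z := f z + ((l * c - f c) + (- l) * z).
have gE z : g z = f (c + (z - c)) - f c - l * (z - c).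
  by rewrite /g [c + (z - c)]addrC subrK; ring.
have bin z : bdry x (x + W n) y (y + H n) z -> nm (z - c) <= W n + H n.
  case/andP => /andP[zx zy] _; apply: (le_trans (nm_le_ReIm _)).
  by rewrite cReD cImD cReN cImN /=; apply: lerD; rewrite ler_norml; lra.
have fc z : bdry x (x + W n) y (y + H n) z -> ccts f z.
  by case/andP => zz _; apply: hol_cts; apply: fh; apply: (inrect_sub xi).
have gc z : bdry x (x + W n) y (y + H n) z -> ccts g z.
  move=> zz; apply: (cctsD (fc z zz)); apply: cctsD; first exact: ccts_cst.
  exact: cctsZ (@ccts_id z).
have -> : I n (x, y) = rint g x (x + W n) y (y + H n).
  rewrite /I /= (rintD x1' y1' fc) ?rint_affine ?addr0 // => z _.
  by apply: cctsD; [exact: ccts_cst | exact: cctsZ (@ccts_id z)].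
have := @rint_le g _ _ _ _ (e / 2 * (W n + H n)) x1' y1' gc.
have -> : x + W n - x + (y + H n - y) = W n + H n by ring.
move=> B; apply: (le_trans (B _)); last by rewrite le_eqVlt; apply/orP; left; apply/eqP; field.
move=> z zb; rewrite gE; have zc := bin z zb.
apply: (le_trans (de _ (le_lt_trans zc WHd))).
by rewrite ler_pM2l // divr_gt0.
Qed.

End RectangleIntegral.

(** * Residues, Cauchy's formula and Cauchy's estimates *)

Section CauchyFormula.
Variable R : realType.
Local Notation C := R[i].
Local Notation nm := (@nm R).

(** Around the hole, [goursat] applies to four rectangles: two of full height on the left and on the
    right, and the pieces below and above. *)
Lemma rint_hole (a b c d : R) (f : C -> C) x0 x1 y0 y1 :
  x0 <= a -> a <= b -> b <= x1 -> y0 <= c -> c <= d -> d <= y1 ->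
  (forall z, inrect x0 x1 y0 y1 z ->
     ~~ ((a < complex.Re z < b) && (c < complex.Im z < d)) -> hol f z) ->
  rint f x0 x1 y0 y1 = rint f a b c d.
Proof.
move=> xa ab bx yc cd dy fh.
have ax := le_trans ab bx; have xb := le_trans xa ab; have xx := le_trans xa ax.
have cy := le_trans cd dy; have yd := le_trans yc cd; have yy := le_trans yc cy.
have hor y x' x'' : x0 <= x' -> x'' <= x1 -> (y0 <= y <= c) || (d <= y <= y1) ->
    rcts x' x'' (fun x => f (x +i* y)).
  move=> p q h; apply: rcts_hor => x /andP[u v]; apply: hol_cts; apply: fh.
    rewrite /inrect /= (le_trans p) // (le_trans v) //=.
    by case/orP: h => /andP[h1 h2]; rewrite ?h1 ?h2 ?(le_trans h2) ?(le_trans _ h1).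
  by rewrite /= !negb_and -!leNgt; case/orP: h => /andP[h1 h2]; rewrite ?h1 ?h2 ?orbT ?orbT.
have ver x : (x0 <= x <= a) || (b <= x <= x1) -> rcts y0 y1 (fun y => f (x +i* y)).
  move=> h; apply: rcts_ver => y yy'; apply: hol_cts; apply: fh.
    rewrite /inrect /= yy' andbT.
    by case/orP: h => /andP[h1 h2]; rewrite ?h1 ?h2 ?(le_trans h2) ?(le_trans _ h1).
  by rewrite /= !negb_and -!leNgt; case/orP: h => /andP[h1 h2]; rewrite ?h1 ?h2 ?orbT ?orbT.
rewrite (rint_splitx xa ax); [|by apply: hor; rewrite ?lexx ?yc ?dy /= ?orbT..].
rewrite (rint_splitx ab bx); [|by apply: hor; rewrite ?lexx ?yc ?dy /= ?orbT..].
rewrite (@rint_splity _ c f a b y0 y1 yc cy);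
  [|by apply: ver; rewrite ?lexx ?xa ?bx /= ?orbT..].
have V x : (x0 <= x <= a) || (b <= x <= x1) -> rcts c y1 (fun y => f (x +i* y)).
  by move=> /ver; apply: rcts_sub.
rewrite (@rint_splity _ d f a b c y1 cd dy);
  [|by apply: V; rewrite ?lexx ?xa ?bx /= ?orbT..].
rewrite (goursat xa yy) ?(goursat bx yy) ?(goursat ab yc) ?(goursat ab dy)
  ?add0r ?addr0 // => z /andP[/andP[z1 z2] /andP[z3 z4]];
  (apply: fh; [by apply/andP; split; apply/andP; split; lra
             | apply/negP => /andP[/andP[u v] /andP[p q]]; lra]).
Qed.

Definition inrect_o (x0 x1 y0 y1 : R) (z : C) : bool :=
  (x0 < complex.Re z < x1) && (y0 < complex.Im z < y1).

Definition sqint (f : C -> C) (c : C) s :=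
  rint f (complex.Re c - s) (complex.Re c + s) (complex.Im c - s) (complex.Im c + s).

Definition sqbdry (c : C) s :=
  bdry (complex.Re c - s) (complex.Re c + s) (complex.Im c - s) (complex.Im c + s).

Lemma sqbdry_nm (c : C) s z : 0 < s -> sqbdry c s z -> s <= nm (z - c) <= 2 * s.
Proof.
move=> s0 /andP[/andP[/andP[z1 z2] /andP[z3 z4]] zb]; apply/andP; split; last first.
  apply: (le_trans (nm_le_ReIm _)); rewrite cReD cImD cReN cImN.
  rewrite (_ : 2 * s = s + s); last by ring.
  by apply: lerD; rewrite ler_norml; apply/andP; split; lra.
have := Re_le_nm (z - c); have := Im_le_nm (z - c).
rewrite cReD cImD cReN cImN => A B.
case/or4P: zb => /eqP h.
- apply: le_trans B; rewrite ler_normr; apply/orP; right; lra.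
- apply: le_trans B; rewrite ler_normr; apply/orP; left; lra.
- apply: le_trans A; rewrite ler_normr; apply/orP; right; lra.
- apply: le_trans A; rewrite ler_normr; apply/orP; left; lra.
Qed.

Lemma sqint_le (f : C -> C) (c : C) s M : 0 < s -> (forall z, sqbdry c s z -> ccts f z) ->
  (forall z, sqbdry c s z -> nm (f z) <= M) -> nm (sqint f c s) <= 8 * s * M.
Proof.
move=> s0 fc fM; have le (x : R) : x - s <= x + s by lra.
apply: (le_trans (rint_le (le _) (le _) fc fM)).
by rewrite le_eqVlt; apply/orP; left; apply/eqP; ring.
Qed.

Lemma rint_small_square (f : C -> C) c x0 x1 y0 y1 : inrect_o x0 x1 y0 y1 c ->
  (forall z, inrect x0 x1 y0 y1 z -> z != c -> hol f z) ->
  exists2 s0, 0 < s0 & forall s, 0 < s <= s0 ->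
    rint f x0 x1 y0 y1 = sqint f c s /\ forall z, sqbdry c s z -> hol f z.
Proof.
move=> /andP[/andP[c1 c2] /andP[c3 c4]] fh.
exists (Num.min (Num.min (complex.Re c - x0) (x1 - complex.Re c))
  (Num.min (complex.Im c - y0) (y1 - complex.Im c))).
  by rewrite !lt_min !subr_gt0 c1 c2 c3 c4.
move=> s /andP[s0]; rewrite !le_min => /andP[/andP[s1 s2] /andP[s3 s4]].
split; last first.
  move=> z zb; have /andP[zn _] := sqbdry_nm s0 zb; apply: fh; last first.
    by rewrite -subr_eq0 -nm_gt0 (lt_le_trans s0).
  by case/andP: zb => zi _; apply: inrect_sub zi; apply/and4P; split; lra.
apply: rint_hole; try lra.
move=> z zr zc; apply: fh => //; apply: contraNneq zc => ->.
by apply/andP; split; apply/andP; split; lra.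
Qed.

(** The contour shrinks to a square of half side s about [c], of length 8 s, on which |f| <= e /
    s. *)
Lemma rint_removable (f : C -> C) c x0 x1 y0 y1 : inrect_o x0 x1 y0 y1 c ->
  (forall z, inrect x0 x1 y0 y1 z -> z != c -> hol f z) ->
  (forall e, 0 < e -> exists2 d, 0 < d &
    forall z, 0 < nm (z - c) < d -> nm ((z - c) * f z) <= e) ->
  rint f x0 x1 y0 y1 = 0.
Proof.
move=> cr fh lim; have [s0 s00 hs] := rint_small_square cr fh.
suff K e : 0 < e -> nm (rint f x0 x1 y0 y1) <= 8 * e.
  apply: nm_le0; rewrite leNgt; apply/negP => p.
  by have := K (nm (rint f x0 x1 y0 y1) / 16) ltac:(by rewrite divr_gt0); lra.
move=> e0; have [d d0 de] := lim e e0.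
pose s := Num.min s0 (d / 4).
have s_gt0 : 0 < s by rewrite lt_min s00 divr_gt0.
have [ss0 sd] : s <= s0 /\ s <= d / 4 by rewrite !ge_min !lexx orbT.
have [-> hb] := hs s ltac:(by rewrite s_gt0).
apply: (le_trans (sqint_le (M := e / s) s_gt0 _ _)) => [z /hb /hol_cts //|z zb|].
  have /andP[zs zs2] := sqbdry_nm s_gt0 zb.
  rewrite ler_pdivlMr // mulrC.
  have /de : 0 < nm (z - c) < d by apply/andP; split; lra.
  by rewrite nmM; apply: le_trans; rewrite ler_wpM2r ?nm_ge0.
by rewrite le_eqVlt; apply/orP; left; apply/eqP; field; rewrite gt_eqF.
Qed.

Lemma dif_sub_inv (c z : C) : z != c -> dif (fun w => (w - c)^-1) z (- (z - c) ^- 2).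
Proof.
move=> zc; rewrite -[X in dif _ _ X]mulr1; apply: dif_comp; last first.
  by apply: dif_inv; rewrite subr_eq0.
by rewrite -[1]addr0; apply: dif_add (@dif_id _ z) (@dif_cst _ (- c) z).
Qed.

Lemma hol_add (f g : C -> C) c : hol f c -> hol g c -> hol (fun z => f z + g z) c.
Proof. by move=> [l D] [m E]; eexists; exact: dif_add D E. Qed.

Lemma hol_mul (f g : C -> C) c : hol f c -> hol g c -> hol (fun z => f z * g z) c.
Proof. by move=> [l D] [m E]; eexists; exact: dif_mul D E. Qed.

Lemma hol_cst k c : hol (fun=> k : C) c.
Proof. by eexists; exact: dif_cst. Qed.

Lemma hol_id c : hol (id : C -> C) c.
Proof. by eexists; exact: dif_id. Qed.

Lemma hol_sub_inv (c z : C) : z != c -> hol (fun w => (w - c)^-1) z.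
Proof. by eexists; exact: dif_sub_inv. Qed.

Lemma hol_exp (f : C -> C) n c : hol f c -> hol (fun z => f z ^+ n) c.
Proof.
move=> fc; elim: n => [|n IH].
  by rewrite (_ : (fun z => f z ^+ 0) = fun=> 1) //; exact: hol_cst.
rewrite (_ : (fun z => f z ^+ n.+1) = fun z => f z * f z ^+ n); first exact: hol_mul.
by apply/funext => z; rewrite exprS.
Qed.

Lemma bdry_neq x0 x1 y0 y1 (c z : C) : inrect_o x0 x1 y0 y1 c ->
  bdry x0 x1 y0 y1 z -> z != c.
Proof.
move=> /andP[/andP[c1 c2] /andP[c3 c4]] /andP[_ zb]; apply: contraTneq zb => ->.
by rewrite !negb_or (gt_eqF c1) (lt_eqF c2) (gt_eqF c3) (lt_eqF c4).
Qed.

Lemma inrect_o_le x0 x1 y0 y1 (c : C) : inrect_o x0 x1 y0 y1 c -> x0 <= x1 /\ y0 <= y1.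
Proof. by move=> /andP[/andP[c1 c2] /andP[c3 c4]]; split; apply: ltW; apply: lt_trans; eauto. Qed.

(** Subtracting L / (z - c) leaves a singularity that [rint_removable] ignores. The integral of 1 /
    (z - c) is kept as it is, so that 2 i pi never has to be computed. *)
Lemma residue (f : C -> C) L c x0 x1 y0 y1 : inrect_o x0 x1 y0 y1 c ->
  (forall z, inrect x0 x1 y0 y1 z -> z != c -> hol f z) ->
  (forall e, 0 < e -> exists2 d, 0 < d &
    forall z, 0 < nm (z - c) < d -> nm ((z - c) * f z - L) <= e) ->
  rint f x0 x1 y0 y1 = L * rint (fun z => (z - c)^-1) x0 x1 y0 y1.
Proof.
move=> cr fh lim; have [xx yy] := inrect_o_le cr.
have bi z : bdry x0 x1 y0 y1 z -> inrect x0 x1 y0 y1 z by case/andP.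
have gh z : z != c -> hol (fun z => - L * (z - c)^-1) z.
  by move=> zc; apply: hol_mul; [exact: hol_cst | exact: hol_sub_inv].
have := @rint_removable (fun z => f z + - L * (z - c)^-1) c x0 x1 y0 y1 cr.
rewrite rintD //; last 2 first.
- by move=> z zb; apply: hol_cts; apply: fh; [exact: bi | exact: bdry_neq cr zb].
- by move=> z zb; apply: hol_cts; apply: gh; exact: bdry_neq cr zb.
rewrite rintZ //; last first.
  by move=> z zb; apply: hol_cts; apply: hol_sub_inv; exact: bdry_neq cr zb.
move=> H; apply/eqP; rewrite -subr_eq0 -mulNr; apply/eqP; apply: H.
  by move=> z zr zc; apply: hol_add; [exact: fh | exact: gh].
move=> e /lim[d d0 de]; exists d => // z zd; have := de z zd.
have zc : z - c != 0 by case/andP: zd; rewrite nm_gt0.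
by congr (nm _ <= _); field.
Qed.

(* This is 2 i pi, but only |kappa| >= 1 is used. *)
Definition kappa : C := sqint (fun z => (z - 0)^-1) 0 1.

(** Both integrals move to a square of half side s about 0. There 1 / (z - c) - 1 / z is O(|c| /
    s^2) on a contour of length 8 s, so they differ by O(1 / s) for every large s. *)
Lemma winding_square_indep c x0 x1 y0 y1 : inrect_o x0 x1 y0 y1 c ->
  rint (fun z => (z - c)^-1) x0 x1 y0 y1 = kappa.
Proof.
move=> cr; have [xx yy] := inrect_o_le cr.
(* For s >= m the square about 0 contains the given rectangle, and |z - c| >= s / 2 on its
   boundary. *)
pose m := 2 * (nm c + `|x0| + `|x1| + `|y0| + `|y1| + 1).
have nx0 := normr_ge0 x0; have nx1 := normr_ge0 x1.
have ny0 := normr_ge0 y0; have ny1 := normr_ge0 y1; have nc := nm_ge0 c.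
have m2 : 2 <= m by rewrite /m; lra.
have big s : m <= s -> nm (rint (fun z => (z - c)^-1) x0 x1 y0 y1 - kappa) <= 16 * nm c / s.
  move=> ms; have s0 : 0 < s by lra.
  have -> : rint (fun z => (z - c)^-1) x0 x1 y0 y1 = sqint (fun z => (z - c)^-1) 0 s.
    have a1 := ler_norm x1; have a2 := ler_norm y1.
    have a3 : - x0 <= `|x0| by rewrite -normrN ler_norm.
    have a4 : - y0 <= `|y0| by rewrite -normrN ler_norm.
    have ms' := ms; rewrite /m in ms'.
    symmetry; rewrite /sqint /= !(add0r, sub0r); apply: rint_hole;
      try by clear -ms' a1 a2 a3 a4 nx0 nx1 ny0 ny1 nc xx yy; lra.
    move=> z _ zi; apply: hol_sub_inv; apply: contraNneq zi => ->; exact: cr.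
  have -> : kappa = sqint (fun z => (z - 0)^-1) 0 s.
    symmetry; rewrite /kappa /sqint /= !(add0r, sub0r); apply: rint_hole; try lra.
    by move=> z _ zi; apply: hol_sub_inv; apply: contraNneq zi => -> /=; rewrite oppr_lt0 ltr01.
  have le : - s <= s by lra.
  have zn z : sqbdry 0 s z -> s <= nm z by move/(sqbdry_nm s0); rewrite subr0 => /andP[].
  have zcn z : sqbdry 0 s z -> s / 2 <= nm (z - c).
    by move=> /zn zs; have := nm_sub z c; rewrite /m in ms; lra.
  have h1 z : sqbdry 0 s z -> hol (fun z => (z - c)^-1) z.
    by move=> /zcn zs; apply: hol_sub_inv; rewrite -subr_eq0 -nm_gt0; lra.
  have h2 z : sqbdry 0 s z -> hol (fun z => (z - 0)^-1) z.
    by move=> /zn zs; apply: hol_sub_inv; rewrite -nm_gt0; lra.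
  have h3 z : sqbdry 0 s z -> hol (fun z => -1 * (z - 0)^-1) z.
    by move=> /h2; apply: hol_mul; exact: hol_cst.
  rewrite -[- sqint _ _ _]mulN1r /sqint -rintZ ?sub0r ?add0r //; last first.
    by move=> z zb; apply: hol_cts; apply: h2; rewrite /sqbdry !(add0r, sub0r).
  rewrite -rintD //; last 2 first.
  - by move=> z zb; apply: hol_cts; apply: h1; rewrite /sqbdry !(add0r, sub0r).
  - by move=> z zb; apply: hol_cts; apply: h3; rewrite /sqbdry !(add0r, sub0r).
  have := @sqint_le (fun z => (z - c)^-1 + -1 * (z - 0)^-1) 0 s (nm c * 2 / s ^+ 2) s0.
  rewrite /sqint !(add0r, sub0r) => B; apply: (le_trans (B _ _)).
  - by move=> z zb; apply: hol_cts; apply: hol_add; [exact: h1 | exact: h3].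
  - move=> z zb; have A := zcn z zb; have D := zn z zb.
    have A0 : 0 < nm (z - c) by lra. have D0 : 0 < nm z by lra.
    have -> : (z - c)^-1 + -1 * (z - 0)^-1 = c / ((z - c) * z).
      by rewrite subr0; field; rewrite -!nm_gt0 A0 D0.
    rewrite nmM nmV nmM -mulrA ler_wpM2l ?nm_ge0 //.
    have -> : 2 / s ^+ 2 = (s / 2 * s)^-1 by field; rewrite gt_eqF.
    rewrite lef_pV2 ?posrE ?mulr_gt0 ?divr_gt0 //.
    by apply: ler_pM => //; lra.
  by rewrite le_eqVlt; apply/orP; left; apply/eqP; field; rewrite gt_eqF.
apply/eqP; rewrite -subr_eq0; apply/eqP; apply: nm_le0; rewrite leNgt; apply/negP.
set r := nm _ => r0.
pose s := m + 16 * nm c / r.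
have q0 : 0 <= 16 * nm c / r by rewrite divr_ge0 ?mulr_ge0 // ltW.
have := big s ltac:(by rewrite /s lerDl); rewrite -/r leNgt => /negP; apply.
have s0 : 0 < s by rewrite /s; lra.
rewrite ltr_pdivrMr // /s.
have -> : r * (m + 16 * nm c / r) = r * m + 16 * nm c by field; rewrite gt_eqF.
by rewrite ltrDr mulr_gt0 //; lra.
Qed.

(** Each side of the square contributes a nonnegative imaginary part, and the bottom side, where it
    is the integral of 1 / (x^2 + 1) over [-1, 1], at least 1. *)
Lemma nm_kappa : 1 <= nm kappa.
Proof.
rewrite (le_trans _ (Im_le_nm _)) // (le_trans _ (ler_norm _)) //.
have Ii (z : C) : complex.Im (z^-1) = - complex.Im z / (complex.Re z ^+ 2 + complex.Im z ^+ 2).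
  by case: z => a b /=; rewrite mulNr.
have Ri (z : C) : complex.Re (z^-1) = complex.Re z / (complex.Re z ^+ 2 + complex.Im z ^+ 2).
  by case: z.
have hc z : sqbdry 0 1 z -> ccts (fun z => (z - 0)^-1) z.
  move=> /(sqbdry_nm ltr01)/andP[z1 _]; apply: hol_cts; apply: hol_sub_inv.
  by rewrite -subr_eq0 -nm_gt0; lra.
have le : (- 1 : R) <= 1 by lra.
have [R0 I0] : complex.Re (0 : C) = 0 /\ complex.Im (0 : C) = 0 by [].
rewrite /kappa /sqint R0 I0 !(add0r, sub0r); move: hc; rewrite /sqbdry R0 I0 !(add0r, sub0r).
move=> /(bdry_rcts le le)[h1 h2 h3 h4].
have S0 (x y : R) : 0 <= x ^+ 2 + y ^+ 2 by rewrite addr_ge0 ?sqr_ge0.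
have H1 : 1 <= complex.Im (@cint R (- 1) 1 (fun x => ((x +i* -1) - 0)^-1)).
  have E : 2^-1 * (1 - (- 1)) = 1 :> R by lra.
  rewrite -[X in X <= _]E; apply: Im_cint_ge => // x /andP[xa xb].
  rewrite subr0 Ii /= opprK div1r sqrrN expr1n lef_pV2 ?posrE //; nra.
have H2 : 0 <= complex.Im (@cint R (- 1) 1 (fun x => -1 * ((x +i* 1) - 0)^-1)).
  have := Im_cint_ge (M := 0) le; rewrite mul0r; apply; first exact: rcts_scale.
  move=> x _; rewrite subr0 mulN1r cImN Ii /= mulNr opprK divr_ge0 //.
have H3 : 0 <= complex.Im (@cint R (- 1) 1 (fun x => - 'i * ((-1 +i* x) - 0)^-1)).
  have := Im_cint_ge (M := 0) le; rewrite mul0r; apply; first exact: rcts_scale.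
  move=> x _; rewrite subr0 cImM Ri Ii /= oppr0 mul0r add0r mulrA mulrNN mul1r.
  by rewrite divr_ge0.
have H4 : 0 <= complex.Im (@cint R (- 1) 1 (fun x => 'i * ((1 +i* x) - 0)^-1)).
  have := Im_cint_ge (M := 0) le; rewrite mul0r; apply; first exact: rcts_scale.
  move=> x _; rewrite subr0 cImM Ri Ii /= mul0r add0r mul1r.
  by rewrite divr_ge0.
move: H1 H2 H3 H4; rewrite !cintZ //.
set a := cint _ _ _; set b := cint _ _ _; set d := cint _ _ _; set e := cint _ _ _.
by rewrite mulN1r mulNr /rint -/a !cImD !cImN; lra.
Qed.

Lemma kappa_neq0 : kappa != 0.
Proof. by rewrite -nm_gt0; have := nm_kappa; lra. Qed.

Lemma cauchy_formula (f : C -> C) w x0 x1 y0 y1 : inrect_o x0 x1 y0 y1 w ->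
  (forall z, inrect x0 x1 y0 y1 z -> hol f z) ->
  rint (fun z => f z / (z - w)) x0 x1 y0 y1 = f w * kappa.
Proof.
move=> wr fh; rewrite -(winding_square_indep wr); apply: residue => //.
  by move=> z zr zw; apply: hol_mul; [exact: fh | exact: hol_sub_inv].
have wi : inrect x0 x1 y0 y1 w.
  by case/andP: wr => /andP[a b] /andP[c d]; rewrite /inrect !ltW.
move=> e e0; have [d d0 de] := hol_cts (fh w wi) e0; exists d => // z /andP[z0 zd].
by rewrite mulrC divfK ?de // -nm_gt0.
Qed.

Section Estimates.
Variables (f : C -> C) (c : C) (r M : R).
Hypotheses (r0 : 0 < r) (fh : forall z, nm (z - c) <= 2 * r -> hol f z).

Let inn w : nm (w - c) < r -> inrect_o (complex.Re c - r) (complex.Re c + r)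
  (complex.Im c - r) (complex.Im c + r) w.
Proof.
have := Re_le_nm (w - c); have := Im_le_nm (w - c); rewrite cReD cImD cReN cImN.
rewrite !ler_norml => /andP[a b] /andP[d e] h.
by apply/andP; split; apply/andP; split; lra.
Qed.

Let inn2 w : inrect (complex.Re c - r) (complex.Re c + r)
  (complex.Im c - r) (complex.Im c + r) w -> nm (w - c) <= 2 * r.
Proof.
move=> /andP[/andP[a b] /andP[d e]]; apply: (le_trans (nm_le_ReIm _)).
rewrite cReD cImD cReN cImN (_ : 2 * r = r + r); last by ring.
by apply: lerD; rewrite ler_norml; apply/andP; split; lra.
Qed.

Let ccts_bd g : (forall z, sqbdry c r z -> hol g z) -> forall z, sqbdry c r z -> ccts g z.
Proof. by move=> h z /h/hol_cts. Qed.

Let bd_hol z : sqbdry c r z -> hol f z.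
Proof. by case/andP=> /inn2 /fh. Qed.

Let bd_neq w z : nm (w - c) < r -> sqbdry c r z -> z != w.
Proof. by move=> wc zb; apply: bdry_neq (inn wc) zb. Qed.

Let cc : nm (c - c) < r. Proof. by rewrite subrr nm0. Qed.
Let le_r (x : R) : x - r <= x + r. Proof. by move: r0; lra. Qed.

Lemma cauchy_square w : nm (w - c) < r ->
  sqint (fun z => f z / (z - w)) c r = f w * kappa.
Proof. by move=> wc; apply: cauchy_formula (inn wc) _ => z /inn2 /fh. Qed.

Definition cauchy_d := sqint (fun z => f z / (z - c) ^+ 2) c r / kappa.

Hypothesis fM : forall z, nm (z - c) <= 2 * r -> nm (f z) <= M.

(** The remainder is the integral of f z (w - c)^2 / ((z - w) (z - c)^2), divided by [kappa]. The
    square of half side r lies in the disc of radius 2 r about [c], whence the radius in the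
    hypotheses on [f]. *)
Lemma cauchy_taylor_d w : nm (w - c) <= r / 2 ->
  nm (f w - f c - cauchy_d * (w - c)) <= 16 * M / r ^+ 2 * nm (w - c) ^+ 2.
Proof.
move=> wc; have wr : nm (w - c) < r by move: r0 wc; lra.
have K0 := kappa_neq0.
have h1 z : sqbdry c r z -> hol (fun z => f z / (z - w)) z.
  by move=> zb; apply: hol_mul (bd_hol zb) (hol_sub_inv (bd_neq wr zb)).
have h2 z : sqbdry c r z -> hol (fun z => -1 * (f z / (z - c))) z.
  move=> zb; apply: hol_mul (hol_cst _ _) _.
  by apply: hol_mul (bd_hol zb) (hol_sub_inv (bd_neq cc zb)).
have h3' z : sqbdry c r z -> hol (fun z => f z / (z - c) ^+ 2) z.
  move=> zb; apply: hol_mul (bd_hol zb) _.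
  rewrite (_ : (fun z => _) = (fun z => ((z - c)^-1) ^+ 2)); last first.
    by apply/funext => t; rewrite exprVn.
  exact: hol_exp (hol_sub_inv (bd_neq cc zb)).
have h3 z : sqbdry c r z -> hol (fun z => - (w - c) * (f z / (z - c) ^+ 2)) z.
  by move=> zb; apply: hol_mul (hol_cst _ _) (h3' z zb).
have E : (f w - f c - cauchy_d * (w - c)) * kappa = sqint (fun z =>
    f z / (z - w) + (-1 * (f z / (z - c)) + - (w - c) * (f z / (z - c) ^+ 2))) c r.
  rewrite /sqint !rintD ?rintZ //; try (apply: ccts_bd => //).
  - by rewrite -!/(sqint _ _ _) !cauchy_square // /cauchy_d; field.
  - by move=> z zb; apply: hol_mul (bd_hol zb) (hol_sub_inv (bd_neq cc zb)).
  - by move=> z zb; apply: hol_add (h2 z zb) (h3 z zb).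
have KK : nm (f w - f c - cauchy_d * (w - c)) <= nm ((f w - f c - cauchy_d * (w - c)) * kappa).
  by rewrite nmM ler_peMr ?nm_ge0 // nm_kappa.
apply: (le_trans KK); rewrite E.
have M0 : 0 <= M by apply: le_trans (nm_ge0 _) (fM (z := c) _); rewrite subrr nm0 mulr_ge0 // ltW.
apply: (le_trans (sqint_le (M := 2 * M / r ^+ 3 * nm (w - c) ^+ 2) r0 _ _)).
- move=> z zb; apply: hol_cts; apply: hol_add (h1 z zb) _.
  exact: hol_add (h2 z zb) (h3 z zb).
- move=> z zb; have /andP[zc _] := sqbdry_nm r0 zb.
  have zw : r / 2 <= nm (z - w) by have := nm_tri w z c; move: r0 wc zc; lra.
  have r2 : 0 < r / 2 by rewrite divr_gt0.
  have zw0 : z - w != 0 by rewrite -nm_gt0; lra.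
  have zc0 : z - c != 0 by rewrite -nm_gt0; move: r0 zc; lra.
  have -> : f z / (z - w) + (-1 * (f z / (z - c)) + - (w - c) * (f z / (z - c) ^+ 2))
    = f z * ((w - c) ^+ 2 / ((z - w) * (z - c) ^+ 2)) by field; rewrite zw0 zc0.
  rewrite nmM (nmM (_ ^+ 2)) nmV (nmM (z - w)) !nmX.
  rewrite (_ : 2 * M / r ^+ 3 * nm (w - c) ^+ 2 =
    M * (nm (w - c) ^+ 2 / (r / 2 * r ^+ 2))); last by field; rewrite gt_eqF.
  have n1 := nm_ge0 (w - c); have n2 := nm_ge0 (z - w); have n3 := nm_ge0 (z - c).
  have p1 : 0 < nm (z - w) * nm (z - c) ^+ 2 by rewrite mulr_gt0 ?exprn_gt0 ?nm_gt0.
  have p2 : 0 < r / 2 * r ^+ 2 by rewrite mulr_gt0 ?exprn_gt0.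
  apply: ler_pM; first exact: nm_ge0.
  - by apply: divr_ge0; [rewrite exprn_ge0 | exact: ltW].
  - by apply: fM; case/andP: zb => /inn2.
  apply: ler_wpM2l; first by rewrite exprn_ge0.
  rewrite lef_pV2 ?posrE //; apply: ler_pM => //; first exact: ltW.
    by apply: exprn_ge0; exact: ltW.
  by rewrite lerXn2r ?nnegrE // ?ltW.
by rewrite le_eqVlt; apply/orP; left; apply/eqP; field; rewrite gt_eqF.
Qed.

Lemma dif_cauchy_d : dif f c cauchy_d.
Proof.
move=> e e0; pose K := `|16 * M / r ^+ 2| + 1.
have K0 : 0 < K by rewrite ltr_wpDl.
exists (Num.min (r / 2) (e / K)); first by rewrite lt_min !divr_gt0.
move=> h; rewrite lt_min => /andP[h1 h2].
have := @cauchy_taylor_d (c + h); rewrite (addrC c) addrK => /(_ (ltW h1)) B.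
apply: (le_trans B); rewrite expr2 mulrA ler_wpM2r ?nm_ge0 //.
apply: (@le_trans _ _ (K * nm h)); last by rewrite mulrC -ler_pdivlMr // ltW.
by rewrite ler_wpM2r ?nm_ge0 // (le_trans (ler_norm _)) // lerDl.
Qed.

Lemma nm_cauchy_d : nm cauchy_d <= 8 * M / r.
Proof.
rewrite /cauchy_d nmM nmV ler_pdivrMr ?nm_gt0 ?kappa_neq0 //.
have M0 : 0 <= M by apply: le_trans (nm_ge0 _) (fM (z := c) _); rewrite subrr nm0 mulr_ge0 // ltW.
have P : 0 <= 8 * M / r by rewrite divr_ge0 ?mulr_ge0 // ltW.
apply: (@le_trans _ _ (8 * M / r)); last by rewrite ler_peMr // nm_kappa.
apply: (le_trans (sqint_le (M := M / r ^+ 2) r0 _ _)).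
- move=> z zb; apply: hol_cts; apply: hol_mul (bd_hol zb) _.
  rewrite (_ : (fun z => _) = (fun z => ((z - c)^-1) ^+ 2)); last first.
    by apply/funext => t; rewrite exprVn.
  exact: hol_exp (hol_sub_inv (bd_neq cc zb)).
- move=> z zb; have /andP[zc _] := sqbdry_nm r0 zb.
  have zc1 : 0 < nm (z - c) by move: r0 zc; lra.
  rewrite nmM nmV nmX; apply: ler_pM; rewrite ?nm_ge0 // ?invr_ge0 ?exprn_ge0 ?nm_ge0 //.
    by apply: fM; case/andP: zb => /inn2.
  by rewrite lef_pV2 ?posrE ?exprn_gt0 // lerXn2r ?nnegrE ?nm_ge0 ?(ltW r0).
by rewrite le_eqVlt; apply/orP; left; apply/eqP; field; rewrite gt_eqF.
Qed.

Lemma cauchy_lipschitz w : nm (w - c) <= r / 2 -> nm (f w - f c) <= 16 * M / r * nm (w - c).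
Proof.
move=> wc; have M0 : 0 <= M.
  by apply: le_trans (nm_ge0 _) (fM (z := c) _); rewrite subrr nm0 mulr_ge0 // ltW.
have := nmD (f w - f c - cauchy_d * (w - c)) (cauchy_d * (w - c)); rewrite subrK nmM.
move=> B; apply: (le_trans B).
have A1 := cauchy_taylor_d wc.
have A2 : nm cauchy_d * nm (w - c) <= 8 * M / r * nm (w - c).
  by rewrite ler_wpM2r ?nm_ge0 // nm_cauchy_d.
have A3 : 16 * M / r ^+ 2 * nm (w - c) ^+ 2 <= 8 * M / r * nm (w - c).
  rewrite (_ : 8 * M / r * nm (w - c) = 16 * M / r ^+ 2 * (nm (w - c) * (r / 2))); last first.
    by field; rewrite gt_eqF.
  rewrite ler_wpM2l ?divr_ge0 ?mulr_ge0 ?exprn_ge0 ?(ltW r0) //.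
  by rewrite expr2 ler_wpM2l ?nm_ge0.
have -> : 16 * M / r * nm (w - c) = 8 * M / r * nm (w - c) + 8 * M / r * nm (w - c).
  by field; rewrite gt_eqF.
by lra.
Qed.

End Estimates.

End CauchyFormula.

(** * Maximum principle on a rectangle *)

Section MaximumPrinciple.
Variable R : realType.
Local Notation C := R[i].
Local Notation nm := (@nm R).

Lemma le_of_powers (a b K : R) : 0 <= a -> 0 <= b ->
  (forall n : nat, a ^+ n <= K * b ^+ n) -> a <= b.
Proof.
move=> a0 b0 ab; rewrite leNgt; apply/negP => ba.
have [b00|bn0] := eqVneq b 0.
  by have := ab 1%N; rewrite !expr1 b00 mulr0; move: ba; rewrite b00; lra.
have b1 : 0 < b by rewrite lt_neqAle eq_sym bn0.
pose t := a / b; have t1 : 1 < t by rewrite ltr_pdivlMr // mul1r.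
have tK n : t ^+ n <= K by rewrite expr_div_n ler_pdivrMr ?exprn_gt0.
have bern n : n%:R * (t - 1) <= t ^+ n.
  elim: n => [|n IH]; first by rewrite mul0r expr0 ler01.
  have t_ge1 : 1 <= t ^+ n by rewrite exprn_ege1 // ltW.
  by rewrite exprS -natr1; nra.
pose n := Num.bound (K / (t - 1)).
have := archi_boundP (normr_ge0 (K / (t - 1))).
rewrite (_ : Num.bound `|K / (t - 1)| = n); last by rewrite /n /Num.bound normr_id.
move=> /(le_lt_trans (ler_norm _)); rewrite ltr_pdivrMr ?subr_gt0 //.
by have := bern n; have := tK n; lra.
Qed.

(** Landau's trick: Cauchy's formula for f^n gives |f w|^n <= K M^n with K independent of n, and
    [le_of_powers] removes K. *)
Lemma maximum_principle (f : C -> C) (M : R) x0 x1 y0 y1 w :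
  inrect_o x0 x1 y0 y1 w -> (forall z, inrect x0 x1 y0 y1 z -> hol f z) ->
  (forall z, bdry x0 x1 y0 y1 z -> nm (f z) <= M) -> nm (f w) <= M.
Proof.
move=> wr fh fM; have [xx yy] := inrect_o_le wr.
have M0 : 0 <= M.
  apply: le_trans (nm_ge0 _) (fM (x0 +i* y0) _).
  by rewrite /bdry /inrect /= !lexx xx yy eqxx.
pose d := Num.min (Num.min (complex.Re w - x0) (x1 - complex.Re w))
  (Num.min (complex.Im w - y0) (y1 - complex.Im w)).
have d0 : 0 < d.
  by case/andP: wr => /andP[a b] /andP[e g]; rewrite !lt_min !subr_gt0 a b e g.
have wd z : bdry x0 x1 y0 y1 z -> d <= nm (z - w).
  have := Re_le_nm (z - w); have := Im_le_nm (z - w).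
  rewrite cReD cImD cReN cImN => A B /andP[_].
  have [[d1 d2] [d3 d4]] : (d <= complex.Re w - x0 /\ d <= x1 - complex.Re w) /\
      (d <= complex.Im w - y0 /\ d <= y1 - complex.Im w).
    by rewrite !ge_min !lexx !orbT.
  have A1 := le_trans (ler_norm _) A; have B1 := le_trans (ler_norm _) B.
  rewrite -normrN in A; rewrite -normrN in B.
  have A2 := le_trans (ler_norm _) A; have B2 := le_trans (ler_norm _) B.
  by case/or4P => /eqP h; lra.
pose K := 2 / d * (x1 - x0 + (y1 - y0)).
apply: (@le_of_powers _ _ K) => // [|n]; first exact: nm_ge0.
have zw z : bdry x0 x1 y0 y1 z -> z != w by apply: bdry_neq.
have gh z : bdry x0 x1 y0 y1 z -> ccts (fun z => f z ^+ n / (z - w)) z.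
  move=> zb; apply: hol_cts; apply: hol_mul; last by apply: hol_sub_inv; exact: zw.
  by apply: hol_exp; apply: fh; case/andP: zb.
have := @cauchy_formula _ (fun z => f z ^+ n) w x0 x1 y0 y1 wr (fun z zi => hol_exp n (fh z zi)).
move=> E; rewrite -nmX; apply: (@le_trans _ _ (nm (f w ^+ n * kappa R))).
  by rewrite nmM ler_peMr ?nm_ge0 // nm_kappa.
rewrite -E; apply: (le_trans (rint_le (M := M ^+ n / d) xx yy gh _)) => [z zb|].
  rewrite nmM nmV nmX; have dz := wd z zb; have nz : 0 < nm (z - w) := lt_le_trans d0 dz.
  apply: ler_pM; first by rewrite exprn_ge0 ?nm_ge0.
  - by rewrite invr_ge0 nm_ge0.
  - by rewrite lerXn2r ?nnegrE ?nm_ge0 // fM.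
  - by rewrite lef_pV2 ?posrE.
by rewrite le_eqVlt; apply/orP; left; apply/eqP; rewrite /K; ring.
Qed.

End MaximumPrinciple.

(** * Partial derivatives of holomorphic functions of two variables *)

Section PartialDerivatives.
Variable R : realType.
Local Notation C := R[i].
Local Notation nm := (@nm R).

(** A total function, with value 0 where [f] is not differentiable. [d2] is defined from it by
    exchanging the variables, so that results on [d1] transfer through [dif2_flip]. *)
Definition d1 (f : C -> C -> C) x y : C := xget 0 [set a | exists b, dif2 f x y a b].
Definition d2 (f : C -> C -> C) x y : C := d1 (fun z w => f w z) y x.

Lemma dif2_flip (f : C -> C -> C) x y a b :
  dif2 f x y a b -> dif2 (fun z w => f w z) y x b a.
Proof.
move=> D e /D[d d0 de]; exists d => // t; have := de (t.2, t.1).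
by rewrite /nm2 /= (addrC (nm t.2)) (addrC (a * _)).
Qed.

Lemma d1E (f : C -> C -> C) x y a b : dif2 f x y a b -> d1 f x y = a.
Proof.
move=> D; rewrite /d1; case: xgetP => [l -> [b' D']|/(_ a)]; last by case; exists b.
by case: (dif2_unique D D').
Qed.

Lemma d2E (f : C -> C -> C) x y a b : dif2 f x y a b -> d2 f x y = b.
Proof. by move=> /dif2_flip /d1E. Qed.

Lemma dif2_d (f : C -> C -> C) x y : hol2 f x y -> dif2 f x y (d1 f x y) (d2 f x y).
Proof. by move=> [a [b D]]; rewrite (d1E D) (d2E D). Qed.

Definition pdisc (x y : C) (r : R) (P : C -> C -> Prop) :=
  forall z w, nm (z - x) <= r -> nm (w - y) <= r -> P z w.

Lemma pdisc_sub (x y : C) r x' y' r' P : nm (x' - x) + r' <= r -> nm (y' - y) + r' <= r ->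
  pdisc x y r P -> pdisc x' y' r' P.
Proof.
move=> hx hy H z w zx wy; apply: H.
  by have := nm_tri x' z x; lra.
by have := nm_tri y' w y; lra.
Qed.

Lemma dif2_dif_aff (f : C -> C -> C) x y h k s a b :
  dif2 f (x + s * h) (y + s * k) a b ->
  dif (fun s => f (x + s * h) (y + s * k)) s (a * h + b * k).
Proof.
have A (c l : C) : dif (fun t => c + t * l) s l.
  have := dif_add (dif_cst c s) (dif_mul (@dif_id _ s) (dif_cst l s)).
  by rewrite mul1r mul0r addr0 add0r.
exact: (@dif_comp2 _ f (fun t => x + t * h) (fun t => y + t * k) s h k a b (A x h) (A y k)).
Qed.

(** Restriction to the complex line through (x, y) in the direction (h, k), normalized by m = |h| +
    |k|, reduces the estimate to [cauchy_taylor_d] at the point m of that line. *)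
Lemma taylor2 (f : C -> C -> C) x y r M a b h k : 0 < r ->
  pdisc x y (2 * r) (fun z w => hol2 f z w /\ nm (f z w) <= M) ->
  dif2 f x y a b -> nm h + nm k <= r / 2 ->
  nm (f (x + h) (y + k) - f x y - (a * h + b * k)) <= 16 * M / r ^+ 2 * (nm h + nm k) ^+ 2.
Proof.
move=> r0 H D hk; pose m := nm h + nm k.
have h0 := nm_ge0 h; have k0 := nm_ge0 k.
have M0 : 0 <= M.
  apply: le_trans (nm_ge0 _) (H x y _ _).2; by rewrite subrr nm0 mulr_ge0 // ltW.
have [m0|mn] := eqVneq m 0.
  have -> : h = 0 by apply: nm_le0; move: m0; rewrite /m; lra.
  have -> : k = 0 by apply: nm_le0; move: m0; rewrite /m; lra.
  by rewrite !mulr0 !addr0 subrr subr0 nm0 ?addr0 expr0n mulr0.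
have m1 : 0 < m by rewrite lt_neqAle eq_sym mn addr_ge0.
have mC : m%:C != 0 by rewrite -nm_gt0 nmR gtr0_norm.
have nmm : nm m%:C = m by rewrite nmR gtr0_norm.
pose h' := h / m%:C; pose k' := k / m%:C.
have h'1 : nm h' <= 1 by rewrite nmM nmV nmm ler_pdivrMr // mul1r lerDl.
have k'1 : nm k' <= 1 by rewrite nmM nmV nmm ler_pdivrMr // mul1r lerDr.
have mh : m%:C * h' = h by rewrite mulrC divfK.
have mk : m%:C * k' = k by rewrite mulrC divfK.
pose F s := f (x + s * h') (y + s * k').
have small s l : nm (s - 0) <= 2 * r -> nm l <= 1 -> nm (s * l) <= 2 * r.
  by rewrite subr0 nmM => s1 l1; apply: le_trans s1; rewrite ler_piMr ?nm_ge0.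
have Hs s : nm (s - 0) <= 2 * r -> hol F s /\ nm (F s) <= M.
  move=> s1; have [||A B] := H (x + s * h') (y + s * k').
  - by rewrite addrC addKr small.
  - by rewrite addrC addKr small.
  split=> //; case: A => a' [b' A]; exists (a' * h' + b' * k'); exact: dif2_dif_aff.
have := @cauchy_taylor_d _ F 0 r M r0 (fun s h => (Hs s h).1) (fun s h => (Hs s h).2) m%:C.
rewrite subr0 nmm => /(_ hk).
have -> : cauchy_d F 0 r = a * h' + b * k'.
  apply: (@dif_unique _ F 0).
    exact: (dif_cauchy_d r0 (fun s h => (Hs s h).1) (fun s h => (Hs s h).2)).
  by apply: dif2_dif_aff; rewrite !mul0r !addr0.
rewrite /F mh mk !mul0r !addr0.
by rewrite (_ : (a * h' + b * k') * m%:C = a * h + b * k) // -mh -mk; ring.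
Qed.

Lemma slice1 (f : C -> C -> C) x y r M :
  pdisc x y r (fun z w => hol2 f z w /\ nm (f z w) <= M) -> 0 <= r ->
  forall z, nm (z - x) <= r -> hol (f^~ y) z /\ nm (f z y) <= M.
Proof.
move=> H r0 z zx; have [|[a [b D]] B] := H z y zx; first by rewrite subrr nm0.
by split=> //; exists a; exact: dif2_dif1 D.
Qed.

Lemma pdisc_flip (f : C -> C -> C) x y r M :
  pdisc x y r (fun z w => hol2 f z w /\ nm (f z w) <= M) ->
  pdisc y x r (fun z w => hol2 (fun z w => f w z) z w /\ nm (f w z) <= M).
Proof.
move=> H z w zy wx; have [[a [b D]] B] := H w z wx zy.
by split=> //; exists b, a; exact: dif2_flip.
Qed.

Lemma d1_le (f : C -> C -> C) x y r M : 0 < r ->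
  pdisc x y r (fun z w => hol2 f z w /\ nm (f z w) <= M) ->
  nm (d1 f x y) <= 16 * M / r.
Proof.
move=> r0 H; have S := slice1 H (ltW r0).
have [||[a [b D]] _] := H x y _ _; rewrite ?subrr ?nm0 ?(ltW r0) //.
rewrite (d1E D); have r2 : 0 < r / 2 by rewrite divr_gt0.
have E : 2 * (r / 2) = r by field.
have fh z : nm (z - x) <= 2 * (r / 2) -> hol (f^~ y) z by rewrite E => /S[].
have fM z : nm (z - x) <= 2 * (r / 2) -> nm (f z y) <= M by rewrite E => /S[].
rewrite -(dif_unique (dif_cauchy_d r2 fh fM) (dif2_dif1 D)).
apply: (le_trans (nm_cauchy_d r2 fh fM)).
by rewrite le_eqVlt; apply/orP; left; apply/eqP; field; rewrite gt_eqF.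
Qed.

Lemma d2_le (f : C -> C -> C) x y r M : 0 < r ->
  pdisc x y r (fun z w => hol2 f z w /\ nm (f z w) <= M) ->
  nm (d2 f x y) <= 16 * M / r.
Proof. by move=> r0 /pdisc_flip H; exact: d1_le H. Qed.

Lemma cctsM (f g : C -> C) c : ccts f c -> ccts g c -> ccts (fun z => f z * g z) c.
Proof.
move=> fc gc e e0; pose A := nm (f c) + nm (g c) + 1.
have f0 := nm_ge0 (f c); have g0 := nm_ge0 (g c).
have A1 : 1 <= A by rewrite /A; lra.
pose e1 := Num.min 1 (e / A / 2).
have A0 : 0 < A by lra.
have e10 : 0 < e1 by rewrite lt_min ltr01 !divr_gt0.
have [d d0 de] := fc _ e10; have [d' d'0 de'] := gc _ e10.
exists (Num.min d d'); first by rewrite lt_min d0.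
move=> z; rewrite lt_min => /andP[/de B /de' D].
have -> : f z * g z - f c * g c = (f z - f c) * (g z - g c) +
  ((f z - f c) * g c + f c * (g z - g c)) by ring.
have E1 : e1 <= 1 by rewrite ge_min lexx.
have E2 : e1 * A <= e / 2.
  apply: (@le_trans _ _ (e / A / 2 * A)); last by rewrite mulrAC divfK ?gt_eqF.
  by rewrite ler_wpM2r ?ge_min ?lexx ?orbT // ltW.
have X := nm_ge0 (f z - f c); have Y := nm_ge0 (g z - g c).
apply: (le_trans (nmD _ _)); rewrite nmM.
have := nmD ((f z - f c) * g c) (f c * (g z - g c)); rewrite !nmM.
have P1 : nm (f z - f c) * nm (g z - g c) <= e1 * 1.
  by apply: ler_pM => //; exact: le_trans D E1.
have P2 : nm (f z - f c) * nm (g c) <= e1 * nm (g c) by rewrite ler_wpM2r.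
have P3 : nm (f c) * nm (g z - g c) <= e1 * nm (f c) by rewrite mulrC ler_wpM2r.
have : e1 * A = e1 * nm (f c) + e1 * nm (g c) + e1 * 1 by rewrite /A; ring.
lra.
Qed.

Definition coefx (m : C -> C -> C) x y r : C :=
  sqint (fun z => m z y / (z - x) ^+ 2) x r / kappa R.

(** Cauchy's integral is continuous for uniform convergence, and it makes sense for the limit [m],
    of which only continuity is known at this stage. *)
Lemma coefx_approx (m f : C -> C -> C) x y r M e : 0 < r -> 0 < e ->
  (forall z, nm (z - x) <= 2 * r -> ccts (m^~ y) z) ->
  pdisc x y (2 * r) (fun z w => hol2 f z w /\ nm (f z w) <= M) ->
  pdisc x y (2 * r) (fun z w => nm (f z w - m z w) <= e) ->
  nm (d1 f x y - coefx m x y r) <= 8 * e / r.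
Proof.
move=> r0 e0 mc H fm; have r2 : 0 <= 2 * r by rewrite mulr_ge0 // ltW.
have S := slice1 H r2.
have [||[a [b D]] _] := H x y _ _; rewrite ?subrr ?nm0 //.
rewrite (d1E D) -(dif_unique (dif_cauchy_d r0 (fun z h => (S z h).1) (fun z h => (S z h).2))
  (dif2_dif1 D)) /cauchy_d /coefx -mulrBl nmM nmV.
have bd z : sqbdry x r z -> nm (z - x) <= 2 * r by case/(sqbdry_nm r0)/andP.
have bx z : sqbdry x r z -> 0 < nm (z - x) by case/(sqbdry_nm r0)/andP; lra.
have ih z : sqbdry x r z -> hol (fun z => ((z - x) ^+ 2)^-1) z.
  move=> /bx zx; rewrite (_ : (fun z => _) = (fun z => ((z - x)^-1) ^+ 2)).
    by apply: hol_exp; apply: hol_sub_inv; rewrite -subr_eq0 -nm_gt0.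
  by apply/funext => t; rewrite exprVn.
have le (t : R) : t - r <= t + r by lra.
have cf z : sqbdry x r z -> ccts (fun z => f z y / (z - x) ^+ 2) z.
  move=> zb; apply: cctsM; last exact: hol_cts (ih z zb).
  by apply: hol_cts; case: (S z (bd z zb)).
have cm z : sqbdry x r z -> ccts (fun z => m z y / (z - x) ^+ 2) z.
  by move=> zb; apply: cctsM; [exact: mc (bd z zb) | exact: hol_cts (ih z zb)].
have cm' z : sqbdry x r z -> ccts (fun z => -1 * (m z y / (z - x) ^+ 2)) z.
  by move=> zb; exact: cctsZ (cm z zb).
rewrite -[X in _ + X]mulN1r /sqint -rintZ // -rintD // ler_pdivrMr; last first.
  by rewrite nm_gt0 kappa_neq0.
apply: (@le_trans _ _ (8 * e / r)); last first.
  by rewrite ler_peMr ?nm_kappa // divr_ge0 ?mulr_ge0 ?ltW.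
rewrite -/(sqint (fun z => f z y / (z - x) ^+ 2 + -1 * (m z y / (z - x) ^+ 2)) x r).
apply: (le_trans (sqint_le (M := e / r ^+ 2) r0 _ _)) => [z zb|z zb|].
- exact: cctsD (cf z zb) (cm' z zb).
- have -> : f z y / (z - x) ^+ 2 + -1 * (m z y / (z - x) ^+ 2) =
    (f z y - m z y) / (z - x) ^+ 2 by rewrite mulrBl mulN1r.
  have /andP[zx zx2] := sqbdry_nm r0 zb; have zx0 := bx z zb.
  rewrite nmM nmV nmX; apply: ler_pM; rewrite ?nm_ge0 ?invr_ge0 ?exprn_ge0 ?nm_ge0 //.
    by apply: fm; rewrite ?zx2 // subrr nm0.
  by rewrite lef_pV2 ?posrE ?exprn_gt0 // lerXn2r ?nnegrE ?nm_ge0 ?(ltW r0).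
by rewrite le_eqVlt; apply/orP; left; apply/eqP; field; rewrite gt_eqF.
Qed.

(* A locally uniform limit of holomorphic functions is holomorphic; the
   candidate partial derivatives of the limit are its own Cauchy integrals. *)
Lemma unif_limit_hol2 (m : C -> C -> C) x y r M : 0 < r ->
  (forall e, 0 < e -> exists f : C -> C -> C,
     pdisc x y (3 * r) (fun z w => hol2 f z w /\ nm (f z w) <= M) /\
     pdisc x y (3 * r) (fun z w => nm (f z w - m z w) <= e)) ->
  hol2 m x y.
Proof.
move=> r0 H.
have xr t : nm (t - t : C) <= 3 * r by rewrite subrr nm0 mulr_ge0 // ltW.
have sub P : pdisc x y (3 * r) P -> pdisc x y (2 * r) P.
  by apply: pdisc_sub; rewrite subrr nm0; lra.
have c1 z : nm (z - x) <= 2 * r -> ccts (m^~ y) z.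
  move=> zx e e0; have [f [fh fm]] := H (e / 3) ltac:(by rewrite divr_gt0).
  have [|fz _] := fh z y _ (xr y); first lra.
  have [d d0 de] := hol2_cts fz (e := e / 3) ltac:(by rewrite divr_gt0).
  exists (Num.min d r); first by rewrite lt_min d0.
  move=> t; rewrite lt_min => /andP[td tr].
  have := de t y td; rewrite subrr nm0 => /(_ d0) A.
  have := fm z y ltac:(lra) (xr y).
  have := fm t y ltac:(have := nm_tri z t x; lra) (xr y).
  rewrite nmBC => B D.
  have := nm_tri (f t y) (m t y) (m z y); have := nm_tri (f z y) (f t y) (m z y); lra.
have c2 z : nm (z - y) <= 2 * r -> ccts (m x) z.
  move=> zx e e0; have [f [fh fm]] := H (e / 3) ltac:(by rewrite divr_gt0).
  have [|fz _] := fh x z (xr x) _; first lra.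
  have [d d0 de] := hol2_cts fz (e := e / 3) ltac:(by rewrite divr_gt0).
  exists (Num.min d r); first by rewrite lt_min d0.
  move=> t; rewrite lt_min => /andP[td tr].
  have := de x t; rewrite subrr nm0 => /(_ d0 td) A.
  have := fm x z (xr x) ltac:(lra).
  have := fm x t (xr x) ltac:(have := nm_tri z t y; lra).
  rewrite nmBC => B D.
  have := nm_tri (f x t) (m x t) (m x z); have := nm_tri (f x z) (f x t) (m x z); lra.
pose a := coefx m x y r; pose b := coefx (fun z w => m w z) y x r.
pose K := 16 * M / r ^+ 2.
have M0 : 0 <= M.
  by have [f [fh _]] := H 1 ltr01; apply: le_trans (nm_ge0 _) (fh x y (xr x) (xr y)).2.
have K0 : 0 <= K by rewrite divr_ge0 ?mulr_ge0 ?exprn_ge0 // ltW.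
have main h k : nm h + nm k <= r / 2 ->
    nm (m (x + h) (y + k) - m x y - (a * h + b * k)) <= K * (nm h + nm k) ^+ 2.
  move=> hk; apply/ler_addgt0Pr => e e0.
  pose e1 := e / (2 + 8 / r * (nm h + nm k)).
  have h0 := nm_ge0 h; have k0 := nm_ge0 k.
  have P0 : 0 <= 8 / r * (nm h + nm k) by rewrite mulr_ge0 ?addr_ge0 // divr_ge0 // ltW.
  have P1 : 0 < 2 + 8 / r * (nm h + nm k) by rewrite ltr_wpDr.
  have e10 : 0 < e1 by rewrite divr_gt0.
  have [f [fh fm]] := H e1 e10.
  have [[a' [b' D]] _] := fh x y (xr x) (xr y).
  have T := taylor2 r0 (sub _ fh) D hk.
  have A := coefx_approx r0 e10 c1 (sub _ fh) (sub _ fm).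
  have B := @coefx_approx (fun z w => m w z) (fun z w => f w z) y x r M e1 r0 e10 c2
    (pdisc_flip (sub _ fh)) (fun z w zy wx => sub _ fm w z wx zy).
  rewrite (d1E D) in A; rewrite -/(d2 f x y) (d2E D) in B.
  have F1 := fm x y (xr x) (xr y).
  have F2 := fm (x + h) (y + k) ltac:(rewrite addrC addKr; lra) ltac:(rewrite addrC addKr; lra).
  have -> : m (x + h) (y + k) - m x y - (a * h + b * k) =
    (f (x + h) (y + k) - f x y - (a' * h + b' * k)) +
    ((f x y - m x y) - (f (x + h) (y + k) - m (x + h) (y + k))) +
    ((a' - a) * h + (b' - b) * k) by ring.
  apply: (le_trans (nmD _ _)).
  have N1 := nmD (f (x + h) (y + k) - f x y - (a' * h + b' * k))
    ((f x y - m x y) - (f (x + h) (y + k) - m (x + h) (y + k))).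
  have N2 := nmB (f x y - m x y) (f (x + h) (y + k) - m (x + h) (y + k)).
  have N3 := nmD ((a' - a) * h) ((b' - b) * k); rewrite !nmM in N3.
  have A' : nm (a' - a) * nm h <= 8 * e1 / r * nm h by rewrite ler_wpM2r.
  have B' : nm (b' - b) * nm k <= 8 * e1 / r * nm k by rewrite ler_wpM2r.
  have E : e = e1 + e1 + (8 * e1 / r * nm h + 8 * e1 / r * nm k).
    have E0 : e1 * (2 + 8 / r * (nm h + nm k)) = e by rewrite divfK ?gt_eqF.
    by rewrite -{1}E0; ring.
  by rewrite E; rewrite /K; lra.
exists a, b => e e0; exists (Num.min (r / 2) (e / (K + 1))).
  by rewrite lt_min !divr_gt0 // ltr_wpDl.
move=> t; rewrite lt_min => /andP[t1 t2]; apply: (le_trans (main _ _ (ltW t1))).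
rewrite -/(nm2 t) expr2 mulrA ler_wpM2r ?nm2_ge0 //.
rewrite ltr_pdivlMr ?ltr_wpDl // in t2.
by have := nm2_ge0 t; lra.
Qed.

(** [d1 f] is the uniform limit of the difference quotients with a real step s: they are bounded by
    [cauchy_lipschitz] and converge by [taylor2]. The radius 5 r leaves room for the polydiscs of
    radius 2 r and for the shift by s. *)
Lemma hol2_d1_bounded (f : C -> C -> C) x y r M : 0 < r ->
  pdisc x y (5 * r) (fun z w => hol2 f z w /\ nm (f z w) <= M) -> hol2 (d1 f) x y.
Proof.
move=> r0 H; have M0 : 0 <= M.
  by apply: le_trans (nm_ge0 _) (H x y _ _).2; rewrite subrr nm0 mulr_ge0 // ltW.
pose K := 16 * M / r.
apply: (@unif_limit_hol2 _ x y (r / 3) K); first by rewrite divr_gt0.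
have -> : 3 * (r / 3) = r by field.
move=> e e0; pose L := 16 * M / r ^+ 2 + 1.
have L0 : 0 < L by rewrite ltr_wpDl // divr_ge0 ?mulr_ge0 ?exprn_ge0 // ltW.
pose s := Num.min (r / 2) (e / L).
have s0 : 0 < s by rewrite lt_min !divr_gt0.
have [sr sL] : s <= r / 2 /\ s * L <= e.
  by rewrite -ler_pdivlMr // !ge_min !lexx orbT.
have ns : nm s%:C = s by rewrite nmR gtr0_norm.
have sC : s%:C != 0 by rewrite -nm_gt0 ns.
have loc z w : nm (z - x) <= r -> nm (w - y) <= r ->
    pdisc z w (2 * r) (fun z w => hol2 f z w /\ nm (f z w) <= M).
  by move=> zx wy; apply: pdisc_sub H; lra.
have tay z w (h : C) : nm (z - x) <= r -> nm (w - y) <= r -> nm h <= r / 2 ->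
   nm (f (z + h) w - f z w - d1 f z w * h) <= 16 * M / r ^+ 2 * nm h ^+ 2.
  move=> zx wy hr.
  have [fz _] := H z w ltac:(lra) ltac:(lra).
  have := taylor2 (h := h) (k := 0) r0 (loc z w zx wy) (dif2_d fz).
  by rewrite nm0 mulr0 !addr0; apply.
exists (fun z w => (f (z + s%:C) w - f z w) / s%:C); split=> z w zx wy.
  split.
    have [[a [b D]] _] := H z w ltac:(lra) ltac:(lra).
    have [|[a' [b' D']] _] := H (z + s%:C) w _ ltac:(lra).
      by have := nmD (z - x) s%:C; rewrite ns addrAC; lra.
    have T : dif2 (fun z w => z + s%:C) z w 1 0.
      by have := dif2_addf (dif2_fst z w) (dif2_cst s%:C z w); rewrite !addr0.
    have D2 := dif2_comp2 T (dif2_snd z w) D'.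
    have D3 := dif2_mulf (dif2_addf D2 (dif2_mulf (dif2_cst (-1) z w) D)) (dif2_cst s%:C^-1 z w).
    eexists; eexists; apply: (dif2_ext ltr01 _ D3) => t u _ _.
    by rewrite mulN1r.
  rewrite nmM nmV ns ler_pdivrMr //.
  have S := slice1 (loc z w zx wy) ltac:(lra).
  have := @cauchy_lipschitz _ (f^~ w) z r M r0 (fun z h => (S z h).1) (fun z h => (S z h).2)
    (z + s%:C).
  by rewrite addrC addKr ns addrC; exact.
have -> : (f (z + s%:C) w - f z w) / s%:C - d1 f z w =
  (f (z + s%:C) w - f z w - d1 f z w * s%:C) / s%:C by field.
rewrite nmM nmV ns ler_pdivrMr //.
apply: (le_trans (tay z w s%:C zx wy _)); rewrite ns //.
rewrite expr2 mulrA ler_wpM2r // ?(ltW s0) //.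
by apply: le_trans sL; rewrite mulrC ler_wpM2l ?(ltW s0) // /L lerDl.
Qed.

Lemma hol2_d1 (f : C -> C -> C) x y r : 0 < r -> pdisc x y r (hol2 f) -> hol2 (d1 f) x y.
Proof.
move=> r0 H; have [||d d0 de] := hol2_cts (H x y _ _) ltr01; rewrite ?subrr ?nm0 ?(ltW r0) //.
pose s := Num.min r (d / 2) / 5.
have s0 : 0 < s by rewrite divr_gt0 // lt_min r0 divr_gt0.
have [sr sd] : 5 * s <= r /\ 5 * s <= d / 2.
  by rewrite /s mulrCA divff // mulr1 !ge_min !lexx orbT.
apply: (@hol2_d1_bounded _ x y s (nm (f x y) + 1)) => // z w zx wy; split.
  by apply: H; lra.
have := nmD (f z w - f x y) (f x y); rewrite subrK.
by have := de z w ltac:(lra) ltac:(lra); lra.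
Qed.

Lemma hol2_d2 (f : C -> C -> C) x y r : 0 < r -> pdisc x y r (hol2 f) -> hol2 (d2 f) x y.
Proof.
move=> r0 H; have [|a [b D]] := @hol2_d1 (fun z w => f w z) y x r r0.
  by move=> z w zy wx; have [a [b D]] := H w z wx zy; exists b, a; exact: dif2_flip.
by exists b, a; exact: dif2_flip.
Qed.

End PartialDerivatives.

(** * Complex exponential, and the logarithm near 1 *)

Section ExpLog.
Variable R : realType.
Local Notation C := R[i].
Local Notation nm := (@nm R).

Lemma is_derive_lin (g : R -> R) x l : is_derive x (1 : R) g l ->
  forall e, 0 < e -> exists2 d, 0 < d &
    forall h, `|h| < d -> `|g (x + h) - g x - l * h| <= e * `|h|.
Proof.
move=> gl e e0; have gd : derivable g x 1 by apply: ex_derive.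
have gv : 'D_1 g x = l by apply: derive_val.
have cv : (fun h => h^-1 *: (g (h *: 1 + x) - g x)) @ 0^' --> l.
  by rewrite -gv; exact: gd.
have /cvgrPdist_le cv' := cv; have := cv' e e0.
rewrite near_withinE => /nbhs_ballP[d d0 de]; exists d => // h hd.
have [->|h0] := eqVneq h 0; first by rewrite addr0 subrr mulr0 subr0 normr0 mulr0.
have := de h _ h0; rewrite /ball /= sub0r normrN => /(_ hd).
move=> A; have {}A : `|h^-1 * (g (x + h) - g x) - l| <= e.
  by rewrite (addrC x) -[X in g (X + x)]mulr1 distrC; exact: A.
have -> : g (x + h) - g x - l * h = (h^-1 * (g (x + h) - g x) - l) * h by field.
by rewrite normrM ler_wpM2r.
Qed.

Lemma cts_eps (g : R -> R) x : {for x, continuous g} ->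
  forall e, 0 < e -> exists2 d, 0 < d & forall y, `|y - x| < d -> `|g y - g x| <= e.
Proof.
move=> /cvgrPdist_le gc e /gc /nbhs_ballP[d d0 de]; exists d => // y yd.
by rewrite distrC; apply: de; rewrite /ball /= distrC.
Qed.

Lemma cexp0 : cexp (0 : C) = 1.
Proof. by rewrite /cexp /= expR0 cos0 sin0; apply: complex_eq => /=; ring. Qed.

Lemma cexpD (z w : C) : cexp (z + w) = cexp z * cexp w.
Proof.
rewrite /cexp cReD cImD expRD cosD sinD; apply: complex_eq;
  by rewrite !(cReM, cImM) /=; ring.
Qed.

Lemma cexpN (z : C) : cexp (- z) * cexp z = 1.
Proof. by rewrite -cexpD addNr cexp0. Qed.

Lemma nm_cexp (z : C) : nm (cexp z) = expR (complex.Re z).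
Proof.
rewrite /cexp nmM nmR ger0_norm ?expR_ge0 // -[RHS]mulr1; congr (_ * _).
apply/eqP; rewrite -(@eqrXn2 _ 2) ?nm_ge0 // nm_sqr /= cos2Dsin2 expr1n.
exact: eqxx.
Qed.

Lemma cexp_neq0 (z : C) : cexp z != 0.
Proof. by rewrite -nm_gt0 nm_cexp expR_gt0. Qed.

Lemma cexpNV (z : C) : cexp (- z) = (cexp z)^-1.
Proof. by apply: (mulIf (cexp_neq0 z)); rewrite cexpN mulVf ?cexp_neq0. Qed.

Lemma cexp_nat (n : nat) (z : C) : cexp (n%:R * z) = cexp z ^+ n.
Proof.
elim: n => [|n IH]; first by rewrite mul0r cexp0 expr0.
by rewrite -natr1 mulrDl mul1r cexpD IH exprSr.
Qed.

(** The two factors of [cexp] are expanded in Re h and in Im h. Neither first order part is complex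
    linear, which is why [lin] allows an arbitrary one; their sum is h. *)
Lemma dif_cexp0 : dif (@cexp R) 0 1.
Proof.
have Lf : lin nm (fun h : C => (expR (complex.Re h))%:C) 1 (fun h => (complex.Re h)%:C).
  move=> e e0; have [d d0 de] := is_derive_lin (is_derive_expR (0 : R)) e0.
  exists d => // h hd; have hr := Re_le_nm h.
  have := de (complex.Re h) (le_lt_trans hr hd); rewrite add0r expR0 mul1r => A.
  rewrite -!rmorphB nmR; apply: (le_trans A); rewrite ler_wpM2l //; exact: ltW.
have Lg : lin nm (fun h : C => cos (complex.Im h) +i* sin (complex.Im h)) 1
    (fun h => 'i * (complex.Im h)%:C).
  move=> e e0; have e2 : 0 < e / 2 by rewrite divr_gt0.
  have [d d0 de] := is_derive_lin (is_derive_cos (0 : R)) e2.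
  have [d' d'0 de'] := is_derive_lin (is_derive_sin (0 : R)) e2.
  exists (Num.min d d'); first by rewrite lt_min d0.
  move=> h; rewrite lt_min => /andP[hd hd']; have hi := Im_le_nm h.
  have := de (complex.Im h) (le_lt_trans hi hd).
  have := de' (complex.Im h) (le_lt_trans hi hd').
  rewrite !add0r cos0 sin0 oppr0 mul0r mul1r !subr0 ?addr0 => A B.
  apply: (le_trans (nm_le_ReIm _)).
  rewrite !(cReD, cReN, cImD, cImN, cReM, cImM) /=.
  rewrite !(mul0r, mul1r, mulr0, subr0, addr0, oppr0, add0r).
  have := @ler_wpM2l _ _ (ltW e2) _ _ hi.
  by lra.
have b1 (h : C) : nm (complex.Re h)%:C <= 1 * nm h by rewrite nmR mul1r Re_le_nm.
have b2 (h : C) : nm ('i * (complex.Im h)%:C) <= 1 * nm h.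
  by rewrite nmM nmi !mul1r nmR Im_le_nm.
have := @lin_comp2 _ _ nm _ _ _ _ _ _ (fun z w => z * w) 1 1 1 (@nm_ge0 R) b1 b2 Lf Lg
  (dif2_mul 1 1).
rewrite /dif cexp0 mulr1 => L.
apply: (@lin_eqL _ _ _ _ _ (fun h => 1 * (complex.Re h)%:C + 1 * ('i * (complex.Im h)%:C))).
  by move=> h; rewrite !mul1r -complexE.
by apply: lin_ext ltr01 _ L => h _ /=; rewrite add0r.
Qed.

Lemma dif_cexp z : dif (@cexp R) z (cexp z).
Proof.
move=> e e0; have z0 : 0 < nm (cexp z) by rewrite nm_gt0 cexp_neq0.
have [d d0 de] := dif_cexp0 (divr_gt0 e0 z0).
exists d => // h hd; have := de h hd; rewrite add0r cexp0 mul1r => A.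
have -> : cexp (z + h) - cexp z - cexp z * h = cexp z * (cexp h - 1 - h).
  by rewrite cexpD; ring.
rewrite nmM; apply: (le_trans (ler_wpM2l (ltW z0) A)).
by rewrite mulrA mulrCA divff ?gt_eqF // mulr1.
Qed.

Lemma hol_cexp f c : hol f c -> hol (fun z => cexp (f z) : C) c.
Proof. by move=> [l D]; eexists; apply: dif_comp D (dif_cexp _). Qed.

Lemma cexp_eq1 (z : C) : `|complex.Im z| < 2 * pi -> cexp z = 1 -> z = 0.
Proof.
move=> zi ez; have : nm (cexp z) = 1 by rewrite ez nm1.
rewrite nm_cexp => /eqP; rewrite -expR0 (inj_eq (@expR_inj R)) => /eqP r0.
have : complex.Re (cexp z) = 1 by rewrite ez.
rewrite /cexp r0 expR0 cReM /= mul1r mul0r subr0 => c1.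
apply: complex_eq => //=; set b := complex.Im z in zi c1 *.
have s0 : sin (b / 2) = 0.
  have := cosD (b / 2) (b / 2); rewrite -splitr c1 => h.
  have := cos2Dsin2 (b / 2); set s := sin _ in h *; set c := cos _ in h * => h'.
  have : s ^+ 2 = 0 by lra.
  by move/eqP; rewrite sqrf_eq0 => /eqP.
case: (ltgtP b 0) => // b0.
  have : 0 < sin (- (b / 2)).
    by apply: sin_gt0_pi; move: zi; rewrite ltr0_norm // => zi; apply/andP; split; lra.
  by rewrite sinN s0 oppr0 ltxx.
have : 0 < sin (b / 2).
  by apply: sin_gt0_pi; move: zi; rewrite gtr0_norm // => zi; apply/andP; split; lra.
by rewrite s0 ltxx.
Qed.

Lemma cexp_clog (z : C) : 0 < complex.Re z -> cexp (clog z) = z.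
Proof.
case: z => a b /= a0; set r := nm (a +i* b).
have ra : a <= r by have := Re_le_nm (a +i* b); apply: le_trans; exact: ler_norm.
have r0 : 0 < r by lra.
have r2 : r ^+ 2 = a ^+ 2 + b ^+ 2 by rewrite nm_sqr.
rewrite /clog /cexp -/(nm (a +i* b)) -/r /= lnK ?posrE //.
(* [t] is the tangent of half the argument; cosine and sine of the argument are (1 - t^2) / (1 +
   t^2) and 2 t / (1 + t^2). *)
set t := b / (r + a); have d0 : 0 < r + a by lra.
have [/lt0r_neq0 cp ct] : 0 < cos (atan t) /\ cos (atan t) ^+ 2 = (1 + t ^+ 2)^-1.
  have q0 : 0 < 1 + t ^+ 2 by rewrite ltr_wpDr ?sqr_ge0.
  rewrite cos_atan invr_gt0 sqrtr_gt0; split=> //.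
  by rewrite exprVn sqr_sqrtr // ltW.
have st : sin (atan t) = t * cos (atan t).
  by rewrite -[X in X * _]atanK /tan divfK.
have t1 : 1 + t ^+ 2 = 2 * r / (r + a).
  rewrite /t expr_div_n; have -> : b ^+ 2 = r ^+ 2 - a ^+ 2 by rewrite r2; ring.
  by field; rewrite gt_eqF.
rewrite (_ : 2 * atan t = atan t + atan t); last by ring.
rewrite cosD sinD st; set c := cos (atan t) in ct *.
have -> : c * c - t * c * (t * c) = (1 - t ^+ 2) * c ^+ 2 by ring.
have -> : t * c * c + c * (t * c) = 2 * t * c ^+ 2 by ring.
rewrite ct t1.
have -> : 1 - t ^+ 2 = 2 * a / (r + a).
  have -> : 1 - t ^+ 2 = 2 - (1 + t ^+ 2) by ring.
  by rewrite t1; field; rewrite gt_eqF.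
by apply: complex_eq; rewrite !(cReM, cImM) /=; rewrite /t; field; rewrite !gt_eqF.
Qed.

Lemma clog1 : clog (1 : C) = 0.
Proof.
by rewrite /clog -/(nm 1) nm1 /= ln1 mul0r atan0 mulr0.
Qed.

Lemma clog_cts1 e : 0 < e -> exists2 d, 0 < d & forall z, nm (z - 1) < d -> nm (clog z) <= e.
Proof.
move=> e0; have e2 : 0 < e / 4 by rewrite divr_gt0.
have [d d0 de] := cts_eps (continuous_ln (ltr01 : 0 < (1 : R))) e2.
have [d' d'0 de'] := cts_eps (@continuous_atan R 0) e2.
exists (Num.min (1 / 2) (Num.min d d')); first by rewrite !lt_min divr_gt0 ?d0.
move=> z; rewrite !lt_min => /andP[z1 /andP[zd zd']].
rewrite /clog -/(nm z); apply: (le_trans (nm_le_ReIm _)) => /=.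
have zr : complex.Re z > 1 / 2.
  have := Re_le_nm (z - 1); rewrite cReD cReN /= => A.
  have := ler_norm (- (complex.Re z - 1)); rewrite normrN; lra.
have nz1 : `|nm z - 1| <= nm (z - 1).
  rewrite ler_norml; have := nm_sub z 1; have := nm_sub 1 z; rewrite nm1 (nmBC 1).
  by move=> A B; apply/andP; split; lra.
have nz : 1 / 2 < nm z.
  by have := Re_le_nm z; have := ler_norm (complex.Re z); lra.
have iz : `|complex.Im z| <= nm (z - 1).
  by have := Im_le_nm (z - 1); rewrite cImD cImN /= oppr0 addr0.
have A := de (nm z) (le_lt_trans nz1 zd); rewrite ln1 subr0 in A.
have tz : `|complex.Im z / (nm z + complex.Re z) - 0| < d'.
  rewrite subr0 normrM normfV (gtr0_norm (_ : 0 < nm z + complex.Re z)); last lra.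
  rewrite ltr_pdivrMr; last lra.
  by have := normr_ge0 (complex.Im z); nra.
have B := de' _ tz; rewrite atan0 subr0 in B.
by rewrite normrM normr_nat; lra.
Qed.

(** Both sides of the last equality are logarithms of z w; they are so small that the imaginary part
    of their difference is below 2 pi, and [cexp_eq1] identifies them. *)
Lemma clog_near1 : exists2 d : R, 0 < d & forall z w, nm (z - 1) < d -> nm (w - 1) < d ->
  [/\ nm (clog z) <= 1, cexp (clog z) = z & clog (z * w) = clog z + clog w].
Proof.
have [d d0 de] := clog_cts1 ltr01.
pose d' := Num.min (1 / 2) (d / 4).
have d'0 : 0 < d' by rewrite lt_min !divr_gt0.
have [dd1 dd2] : d' <= 1 / 2 /\ d' <= d / 4 by rewrite !ge_min !lexx orbT.
exists (d' / 4); first by rewrite divr_gt0.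
move=> z w zd wd.
have rp z' : nm (z' - 1) < 1 -> 0 < complex.Re z'.
  have := Re_le_nm (z' - 1); rewrite cReD cReN /= => A.
  have := ler_norm (- (complex.Re z' - 1)); rewrite normrN; lra.
have zw : nm (z * w - 1) < d'.
  have -> : z * w - 1 = (z - 1) * (w - 1) + ((z - 1) + (w - 1)) by ring.
  apply: (le_lt_trans (nmD _ _)); rewrite nmM.
  have := nmD (z - 1) (w - 1).
  by have := nm_ge0 (z - 1); have := nm_ge0 (w - 1); nra.
have Z := de z ltac:(lra); have W := de w ltac:(lra); have ZW := de (z * w) ltac:(lra).
split=> //; first by apply: cexp_clog; apply: rp; lra.
apply/eqP; rewrite -subr_eq0; apply/eqP; apply: cexp_eq1.
  apply: le_lt_trans (Im_le_nm _) _.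
  have := nmB (clog (z * w)) (clog z + clog w); have := nmD (clog z) (clog w).
  by have := pi_ge2 R; lra.
rewrite cexpD cexpNV cexpD !cexp_clog; try (apply: rp; lra).
by rewrite divff // mulf_neq0 // -nm_gt0; [have := nm_sub 1 z|have := nm_sub 1 w];
   rewrite nm1 nmBC; lra.
Qed.

(** The exponential is expanded at the small point clog (1 + h). The error is at most half of |clog
    (1 + h)|, hence |clog (1 + h)| <= 2 |h|, and the error becomes relative to |h|. *)
Lemma dif_clog1 : dif (@clog R) 1 1.
Proof.
move=> e e0; pose e' := Num.min (1 / 2) (e / 2).
have e'0 : 0 < e' by rewrite lt_min !divr_gt0.
have [E1 E2] : e' <= 1 / 2 /\ e' <= e / 2 by rewrite !ge_min !lexx orbT.
have [d d0 de] := dif_cexp0 e'0.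
have [d1 d10 de1] := clog_cts1 (divr_gt0 d0 (ltr0n _ 2)).
have [d2 d20 de2] := clog_near1.
exists (Num.min d1 d2); first by rewrite lt_min d10.
move=> h; rewrite lt_min => /andP[h1 h2].
have hh : 1 + h - 1 = h by ring.
have A := de1 (1 + h); rewrite hh in A; have {}A := A h1.
have [_ B _] := de2 (1 + h) (1 + h) ltac:(by rewrite hh) ltac:(by rewrite hh).
rewrite clog1 subr0 mul1r.
have := de (clog (1 + h)) ltac:(lra); rewrite add0r B cexp0 mul1r hh nmBC => D.
have := nmD (clog (1 + h) - h) h; rewrite subrK => F.
have x0 := nm_ge0 (clog (1 + h) - h); have y0 := nm_ge0 h; have z0 := nm_ge0 (clog (1 + h)).
by nra.
Qed.

Lemma dif_clog_near1 : exists2 d : R, 0 < d & forall z, nm (z - 1) < d ->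
  dif (@clog R) z z^-1.
Proof.
have [d d0 de] := clog_near1; exists (Num.min d (1 / 2)).
  by rewrite lt_min d0 divr_gt0.
move=> z; rewrite lt_min => /andP[zd z2].
have nz : 1 / 2 < nm z by have := nm_sub 1 z; rewrite nm1 nmBC; lra.
have z0 : z != 0 by rewrite -nm_gt0; lra.
have E : dif (fun w => clog z + clog (w / z)) z z^-1.
  have D1 : dif (fun w => w / z) z z^-1.
    by have := dif_mul (@dif_id _ z) (dif_cst z^-1 z); rewrite mul1r mul0r addr0.
  have D2 : dif (@clog R) (z / z) 1 by rewrite divff //; exact: dif_clog1.
  have := dif_add (dif_cst (clog z) z) (@dif_comp _ (@clog R) (fun w => w / z) z _ _ D1 D2).
  by rewrite mul1r add0r.
apply: (dif_ext (d := d * nm z) _ _ E); first by rewrite mulr_gt0 //; lra.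
move=> w wz; have wz1 : nm (w / z - 1) < d.
  have -> : w / z - 1 = (w - z) / z by field.
  by rewrite nmM nmV ltr_pdivrMr //; lra.
have [_ _ E'] := de z (w / z) zd wz1.
by rewrite -E' mulrCA divff // mulr1.
Qed.

Lemma clog_cexp : exists2 d : R, 0 < d & forall l : C, nm l < d -> clog (cexp l) = l.
Proof.
have [d1 d10 de1] := clog_near1.
have [d2 d20 de2] := hol_cts (ex_intro _ _ dif_cexp0) (e := d1 / 2) ltac:(by rewrite divr_gt0).
exists (Num.min 1 d2); first by rewrite lt_min ltr01.
move=> l; rewrite lt_min => /andP[l1 l2].
have := de2 l; rewrite subr0 cexp0 => /(_ l2) A.
have [B D _] := de1 (cexp l) (cexp l) ltac:(lra) ltac:(lra).
apply/eqP; rewrite -subr_eq0; apply/eqP; apply: cexp_eq1.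
  apply: le_lt_trans (Im_le_nm _) _; have := nmB (clog (cexp l)) l.
  by have := pi_ge2 R; lra.
by rewrite cexpD cexpNV D divff // cexp_neq0.
Qed.

Lemma polar_upper (z : C) : 0 < complex.Im z -> exists2 t : R, 0 < t < pi &
  z = (nm z)%:C * (cos t +i* sin t).
Proof.
move=> zi; have nz : 0 < nm z.
  by have := Im_le_nm z; have := ler_norm (complex.Im z); lra.
pose x := complex.Re z / nm z; pose y := complex.Im z / nm z.
have xy : x ^+ 2 + y ^+ 2 = 1.
  rewrite /x /y !expr_div_n -mulrDl -nm_sqr divff // expf_neq0 // gt_eqF //.
have y0 : 0 < y by rewrite divr_gt0.
have x1 : -1 < x < 1 by apply/andP; split; nra.
have x2 : -1 <= x <= 1 by case/andP: x1 => a b; rewrite !ltW.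
have [/andP[t0 t1] ct] := acos_def x2.
have sx : sin (acos x) = y.
  rewrite sin_acos // -[y]gtr0_norm // -sqrtr_sqr; congr Num.sqrt.
  by rewrite -xy; ring.
exists (acos x).
  rewrite !lt_neqAle t0 t1 !andbT; apply/andP; split; apply: contraTneq y0 => E; rewrite -sx.
    by rewrite -E sin0 ltxx.
  by rewrite E sinpi ltxx.
apply: complex_eq; rewrite ?cReM ?cImM /= ?ct ?sx !mul0r ?subr0 ?addr0 /x /y;
  by rewrite mulrCA divff ?mulr1 ?gt_eqF.
Qed.

End ExpLog.

(** * Flat functions on strips of width larger than 2 pi *)

Section Kernel.
Variable R : realType.
Local Notation C := R[i].
Local Notation nm := (@nm R).

Lemma expR1_ge2 : 2 <= expR (1 : R).
Proof. by have := expR_ge1Dx (1 : R); lra. Qed.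

Lemma cexp_2ipi : cexp (twopii R) = 1.
Proof.
rewrite /cexp /twopii /= expR0; apply: complex_eq; rewrite ?cReM ?cImM /=.
  by rewrite -[2 * pi]add0r mulr_natl cosD2pi cos0; ring.
by rewrite -[2 * pi]add0r mulr_natl sinD2pi sin0; ring.
Qed.

Lemma cexp_period (w : C) : cexp (w + twopii R) = cexp w.
Proof. by rewrite cexpD cexp_2ipi mulr1. Qed.

Lemma cos_le_window (d t : R) : 0 < d -> d <= t <= 2 * pi - d -> cos t <= cos d.
Proof.
move=> d0 /andP[dt td].
pose p := (d + t) / 2; pose q := (t - d) / 2.
have p0 : 0 <= sin p by apply: sin_ge0_pi; rewrite /p; apply/andP; split; lra.
have q0 : 0 <= sin q by apply: sin_ge0_pi; rewrite /q; apply/andP; split; lra.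
have -> : t = p + q by rewrite /p /q; field.
have -> : d = p - q by rewrite /p /q; field.
by rewrite cosD cosB; have := mulr_ge0 p0 q0; lra.
Qed.

(** [cexp u] stays at an angle at least d from the positive axis, so its distance to 1 is at least
    the square root of 1 - k^2; since 1 - k^2 <= 1, that root is at least 1 - k^2 itself. *)
Lemma kernel_lower (d : R) : 0 < d < pi -> exists2 m, 0 < m <= 1 / 2 &
  forall u : C, d <= `|complex.Im u| <= 2 * pi - d -> m <= nm (cexp u - 1).
Proof.
move=> /andP[d0 dp]; pose k := Num.max 0 (cos d).
have cd : cos d < 1.
  rewrite lt_neqAle cos_le1 andbT; apply/eqP => c1.
  have := sin_gt0_pi (x := d); rewrite d0 dp => /(_ isT) s0.
  have := cos2Dsin2 d; rewrite c1 expr1n; have := exprn_gt0 2 s0; lra.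
have [k0 k1] : 0 <= k /\ k < 1 by rewrite /k le_max lexx gt_max ltr01 cd.
have kd : cos d <= k by rewrite /k le_max lexx orbT.
exists ((1 - k ^+ 2) / 2).
  apply/andP; split; first by rewrite divr_gt0 // subr_gt0 expr_lt1.
  by rewrite ler_pM2r ?invr_gt0 // lerBlDr lerDl sqr_ge0.
move=> u du; set r := expR (complex.Re u); have r0 : 0 < r by rewrite expR_gt0.
have ct : cos (complex.Im u) <= k.
  by apply: le_trans kd; rewrite -cos_norm; exact: cos_le_window.
have q : 1 - k ^+ 2 <= nm (cexp u - 1) ^+ 2.
  rewrite nm_sqr /cexp !(cReD, cImD, cReM, cImM, cReN, cImN) /= -/r.
  have := cos2Dsin2 (complex.Im u); set c := cos _ in ct *; set s := sin _ => cs.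
  have : r * c <= r * k by rewrite ler_pM2l.
  have := sqr_ge0 (r - k).
  have -> : (r * c - 0 * s - 1) ^+ 2 + (r * s + 0 * c - 0) ^+ 2 =
    r ^+ 2 * (c ^+ 2 + s ^+ 2) - 2 * (r * c) + 1 by ring.
  by rewrite cs; nra.
have q1 : 0 < 1 - k ^+ 2 by rewrite subr_gt0 expr_lt1.
have q2 : 1 - k ^+ 2 <= 1 by rewrite lerBlDr lerDl sqr_ge0.
have n0 := nm_ge0 (cexp u - 1); rewrite leNgt; apply/negP => n1.
by nra.
Qed.

Lemma kernel_lower_Re (u : C) : 1 <= `|complex.Re u| -> 1 / 2 <= nm (cexp u - 1).
Proof.
have E := expR1_ge2.
rewrite ler_normr => /orP[u1|u1].
  have := nm_sub (cexp u) 1; rewrite nm_cexp nm1.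
  have : expR 1 <= expR (complex.Re u) by rewrite ler_expR.
  lra.
have := nm_sub 1 (cexp u); rewrite nm_cexp nm1 nmBC.
have A : expR (complex.Re u) <= expR (- 1) by rewrite ler_expR; lra.
have B : expR (- 1 : R) <= 1 / 2 by rewrite expRN div1r lef_pV2 ?posrE ?expR_gt0.
lra.
Qed.

(** The inequality t <= e^t at t = c y / (k + 1), raised to the power k + 1. It converts the
    exponential smallness of a jump into a bound of factorial type on moments. *)
Lemma pow_expRN_le (c y : R) k : 0 < c -> 0 <= y ->
  y ^+ k.+1 * expR (- (c * y)) <= (k.+1%:R / c) ^+ k.+1.
Proof.
move=> c0 y0; rewrite expRN ler_pdivrMr ?expR_gt0 //.
have k0 : 0 < k.+1%:R :> R by rewrite ltr0n.
have -> : expR (c * y) = expR (c * y / k.+1%:R) ^+ k.+1.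
  by rewrite -expRM_natl; congr expR; field; rewrite gt_eqF.
rewrite -exprMn; pose t := c * y / k.+1%:R.
have E : y = k.+1%:R / c * t by rewrite /t; field; rewrite !gt_eqF.
have q0 : 0 <= k.+1%:R / c by rewrite divr_ge0 // ltW.
have key : y <= k.+1%:R / c * expR t.
  by rewrite {1}E ler_wpM2l //; have := expR_ge1Dx t; lra.
have n2 : 0 <= k.+1%:R / c * expR t by rewrite mulr_ge0 ?expR_ge0.
exact: (lerXn2r k.+1 y0 n2 key).
Qed.

(** The segment is cut into unit intervals. From one to the next the bound loses a factor e >= 2, so
    the total does not depend on the length n. *)
Lemma cint_decay (n : nat) (a K : R) (h : R -> C) : 0 <= K -> rcts a (a + n%:R) h ->
  (forall x, a <= x <= a + n%:R -> nm (h x) <= K * expR (- x)) ->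
  nm (cint a (a + n%:R) h) <= 2 * K * expR (- a).
Proof.
move=> K0; elim: n a => [|n IH] a.
  rewrite addr0 => hc hK; apply: (le_trans (cint_le (M := K * expR (- a)) (lexx a) hc _)).
    move=> x /andP[ax xa]; have -> : x = a by apply/le_anti/andP.
    by apply: hK; rewrite lexx.
  by rewrite subrr mulr0 !mulr_ge0 ?expR_ge0.
rewrite (_ : a + n.+1%:R = a + 1 + n%:R); last by rewrite -natr1; ring.
have n0 := ler0n R n; have aa1 : a <= a + 1 by rewrite lerDl.
have a1n : a + 1 <= a + 1 + n%:R by rewrite lerDl.
move=> hc hK; rewrite (cint_cat aa1 a1n hc); apply: (le_trans (nmD _ _)).
have B : nm (cint (a + 1) (a + 1 + n%:R) h) <= 2 * K * expR (- (a + 1)).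
  apply: IH; first exact: (rcts_sub aa1 (lexx _) hc).
  by move=> x /andP[ax xa]; apply: hK; rewrite xa (le_trans aa1).
have A : nm (cint a (a + 1) h) <= K * expR (- a).
  have := @cint_le _ a (a + 1) h (K * expR (- a)) aa1 (rcts_sub (lexx _) a1n hc).
  rewrite (_ : a + 1 - a = 1) ?mulr1; last by ring.
  apply=> x /andP[ax xa]; apply: (le_trans (hK x _)); first by rewrite ax (le_trans xa).
  by rewrite ler_wpM2l // ler_expR lerN2.
have E : expR (- (a + 1)) <= expR (- a) / 2.
  rewrite opprD expRD ler_wpM2l ?expR_ge0 // expRN lef_pV2 ?posrE ?expR_gt0 //.
  exact: expR1_ge2.
have : 2 * K * expR (- (a + 1)) <= 2 * K * (expR (- a) / 2).
  by rewrite ler_wpM2l // mulr_ge0.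
lra.
Qed.

End Kernel.

(** * From an exponentially small jump to vanishing *)

Section Strip.
Variable R : realType.
Local Notation C := R[i].
Local Notation nm := (@nm R).

Lemma nm_four_sides (a b d e : C) X Y Z : nm (a - d) <= X -> nm b <= Y -> nm e <= Z ->
  nm (a + 'i * b - d - 'i * e) <= X + Y + Z.
Proof.
move=> h1 h2 h3; have -> : a + 'i * b - d - 'i * e = (a - d) + ('i * b - 'i * e) by ring.
apply: (le_trans (nmD _ _)); have := nmB ('i * b) ('i * e); rewrite !nmM nmi !mul1r.
by move: h1 h2 h3; lra.
Qed.

Lemma hol_inv (g : C -> C) c : hol g c -> g c != 0 -> hol (fun z => (g z)^-1) c.
Proof. by move=> [l D] g0; eexists; exact: dif_comp D (dif_inv g0). Qed.

(** The kernel 1 / (e^(w - c) - 1) has the same simple pole at c as 1 / (w - c), and in addition it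
    is periodic with period 2 i pi. *)
Lemma kernel_residue (g : C -> C) c : ccts g c -> forall e, 0 < e -> exists2 d, 0 < d &
  forall w, 0 < nm (w - c) < d -> nm ((w - c) * (g w / (cexp (w - c) - 1)) - g c) <= e.
Proof.
move=> gc e e0; pose G := nm (g c) + 1; have G0 : 0 < G by rewrite ltr_wpDl ?nm_ge0.
pose e1 := Num.min (1 / 2) (e / (4 * G)).
have e10 : 0 < e1 by rewrite lt_min !divr_gt0 ?mulr_gt0.
have [E1 E2] : e1 <= 1 / 2 /\ e1 <= e / (4 * G) by rewrite !ge_min !lexx orbT.
have E3 : e1 * G <= e / 4.
  apply: (le_trans (ler_wpM2r (ltW G0) E2)); rewrite le_eqVlt; apply/orP; left.
  by apply/eqP; field; rewrite gt_eqF.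
have [d d0 de] := dif_cexp0 e10.
have [d' d'0 de'] := gc (Num.min 1 (e / 2)) ltac:(by rewrite lt_min ltr01 divr_gt0).
exists (Num.min d d'); first by rewrite lt_min d0.
move=> w; rewrite lt_min => /andP[w0 /andP[wd /de' gw]].
have [g1 g2] : nm (g w - g c) <= 1 /\ nm (g w - g c) <= e / 2.
  by move: gw; rewrite le_min => /andP[].
have := de (w - c) wd; rewrite add0r cexp0 mul1r; set u := w - c in w0 wd *.
set v := cexp u - 1 => uv.
have vu : nm u / 2 <= nm v by have := nm_sub u v; rewrite nmBC; have := nm_ge0 u; nra.
have v0 : 0 < nm v by lra.
have vn : v != 0 by rewrite -nm_gt0.
have -> : u * (g w / v) - g c = (u - v) / v * g w + (g w - g c) by field.
apply: (le_trans (nmD _ _)); rewrite !nmM nmV (nmBC u).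
have q : nm (v - u) / nm v <= 2 * e1 by rewrite ler_pdivrMr //; nra.
have gG : nm (g w) <= G by have := nmD (g w - g c) (g c); rewrite subrK /G; lra.
have : nm (v - u) / nm v * nm (g w) <= 2 * e1 * G.
  by apply: ler_pM; rewrite ?nm_ge0 ?divr_ge0 ?nm_ge0.
lra.
Qed.

Variables (f : C -> C) (t0 al be M0 C1 c1 : R).
Hypotheses (t00 : 0 <= t0) (M00 : 0 <= M0) (C10 : 0 <= C1) (c10 : 0 < c1).

(** With y = e^(-w) this is a punctured sector near y = 0, possibly of opening above 2 pi. The
    hypothesis [flat] is flatness at y = 0, and [jump] compares two determinations at the same y. *)
Definition strip w := [/\ t0 < complex.Re w, al < complex.Im w & complex.Im w < be].

Hypotheses (df : forall w, strip w -> hol f w)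
  (bf : forall w, strip w -> nm (f w) <= M0)
  (flat : forall N : nat, exists T K, forall w, strip w -> T < complex.Re w ->
     nm (f w) <= K * expR (- (N%:R * complex.Re w)))
  (jump : forall w, strip w -> strip (w + twopii R) ->
     nm (f (w + twopii R) - f w) <= C1 * expR (- (c1 * expR (complex.Re w)))).

Section Moment.
Variables (th dl : R) (c : C) (N : nat).
Hypotheses (alth : al < th) (thbe : th + 2 * pi < be) (dl0 : 0 < dl < pi)
  (cRe : t0 + 2 <= complex.Re c) (cIm : th + dl <= complex.Im c <= th + 2 * pi - dl).

Let phi w := f w * cexp (N%:R * w) / (cexp (w - c) - 1).
Let t1 := t0 + 1.

Let in_strip w : t1 <= complex.Re w -> th <= complex.Im w <= th + 2 * pi -> strip w.
Proof. by move: alth thbe => h h' w1 /andP[w2 w3]; rewrite /t1 in w1; split; lra. Qed.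

Let phi_hol z : t1 <= complex.Re z -> th <= complex.Im z <= th + 2 * pi -> z != c -> hol phi z.
Proof.
move=> zr /andP[zi1 zi2] zc; apply: hol_mul.
  apply: hol_mul; first by apply: df; split; move: zr alth thbe; rewrite /t1; lra.
  by apply: hol_cexp; apply: hol_mul (hol_cst _ _) (hol_id _).
apply: hol_inv.
  apply: hol_add (hol_cst _ _); apply: hol_cexp.
  exact: hol_add (hol_id _) (hol_cst _ _).
rewrite subr_eq0; apply: contra_neq zc => E; apply/eqP; rewrite -subr_eq0; apply/eqP.
apply: cexp_eq1 E; rewrite cImD cImN ltr_norml.
by case/andP: cIm dl0 => a b /andP[d e]; apply/andP; split; lra.
Qed.

(** The residue of [phi] at c gives the left side. As N is an integer, e^(N w) and the kernel are
    periodic and the horizontal sides contribute only the jump of [f]; the right side is negligible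
    by flatness, and the left one gives the term in [M0]. *)
Lemma strip_moment m : 0 < m -> (forall u : C, dl <= `|complex.Im u| <= 2 * pi - dl ->
    m <= nm (cexp u - 1)) ->
  nm (f c) * expR (N%:R * complex.Re c) <=
    2 * (C1 / m * (N.+1%:R / c1) ^+ N.+1) + 4 * pi + 4 * pi * (M0 * expR (N%:R * t1)).
Proof.
move=> m0 mk; have /andP[ci1 ci2] := cIm; have /andP[dl00 dlp] := dl0.
have p0 := pi_gt0 R; pose th1 := th + 2 * pi; pose x := complex.Re c.
(* Flatness of order N + 1, one more than the power in the moment, makes the right side small once T
   is large. T - t1 is an integer for the sake of [cint_decay]. *)
have [T' [K' flatN]] := flat N.+1.
have [n nT] : exists n : nat, [/\ `|T'| + 1 <= t1 + n%:R, x + 1 <= t1 + n%:R &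
    `|K'| * expR (- (t1 + n%:R)) <= 1].
  pose y := `|T'| + 1 + `|x| + 1 + `|K'|.
  exists (Num.bound y); have : y <= (Num.bound y)%:R.
    rewrite (le_trans (ler_norm _)) // ltW // (le_lt_trans (_ : _ <= `|y|)) //.
    have := archi_boundP (normr_ge0 y); rewrite /Num.bound normr_id; exact.
  set n := Num.bound y; rewrite /y => yn.
  have := normr_ge0 T'; have := normr_ge0 K'; have := ler_norm x; have := normr_ge0 x.
  move=> h1 h2 h3 h4; have t0' := t00; split; rewrite /t1; try lra.
  rewrite expRN ler_pdivrMr ?expR_gt0 // mul1r.
  by have := expR_ge1Dx (t0 + 1 + n%:R); lra.
case: nT => nT nx nK; pose T := t1 + n%:R; rewrite -/T in nT nx nK.
have xx : t1 <= T by rewrite lerDl ler0n.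
have yy : th <= th1 by rewrite /th1; lra.
have cr : inrect_o t1 T th th1 c.
  by apply/andP; split; apply/andP; split; rewrite ?/t1 ?/th1 -/x; move: cRe nx; rewrite /x; lra.
have Hres := @residue R phi (f c * cexp (N%:R * c)) c t1 T th th1 cr.
have E : rint phi t1 T th th1 = f c * cexp (N%:R * c) * kappa R.
  rewrite Hres ?(winding_square_indep cr) //.
    by move=> z /andP[/andP[z1 z2] z3]; exact: phi_hol.
  apply: (@kernel_residue (fun w => f w * cexp (N%:R * w)) c).
  apply: hol_cts; apply: hol_mul.
    by apply: df; split; move: cRe alth thbe => *; lra.
  by apply: hol_cexp; apply: hol_mul (hol_cst _ _) (hol_id _).
have lhs : nm (f c) * expR (N%:R * complex.Re c) <= nm (rint phi t1 T th th1).
  have -> : expR (N%:R * complex.Re c) = nm (cexp (N%:R * c)).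
    by rewrite cexp_nat nmX nm_cexp expRM_natl.
  by rewrite E (nmM (_ * _)) nmM ler_peMr ?nm_kappa // mulr_ge0 ?nm_ge0.
apply: (le_trans lhs).
have bc z : bdry t1 T th th1 z -> ccts phi z.
  move=> zb; apply: hol_cts; have zc := bdry_neq cr zb.
  by case/andP: zb => /andP[/andP[z1 z2] z3] _; exact: phi_hol.
have [h1 h2 h3 h4] := bdry_rcts xx yy bc.
have cexpN (w : C) : nm (cexp (N%:R * w)) = expR (complex.Re w) ^+ N.
  by rewrite cexp_nat nmX nm_cexp.
have B1 : nm (cint t1 T (fun x => phi (x +i* th)) - cint t1 T (fun x => phi (x +i* th1)))
    <= 2 * (C1 / m * (N.+1%:R / c1) ^+ N.+1).
  rewrite -[X in _ + X]mulN1r -cintZ // -cintD //; last exact: rcts_scale.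
  set K := C1 / m * _.
  have K0 : 0 <= K by rewrite mulr_ge0 ?exprn_ge0 ?divr_ge0 // ltW.
  apply: (le_trans (@cint_decay _ n t1 K _ K0 (rctsD h1 (rcts_scale _ h2)) _)); last first.
    have e1 : expR (- t1) <= 1.
      by rewrite -[X in _ <= X](@expR0 R) ler_expR oppr_le0 /t1; move: t00; lra.
    by rewrite ler_piMr // mulr_ge0.
  move=> s /andP[s1 s2]; set w := s +i* th.
  have wp : s +i* th1 = w + twopii R by apply: complex_eq; rewrite /= ?addr0.
  have sw : strip w by apply: in_strip => //=; rewrite lexx lerDl mulr_ge0 // ltW.
  have sw' : strip (w + twopii R).
    by rewrite -wp; apply: in_strip => //=; rewrite lexx andbT lerDl mulr_ge0 // ltW.
  have -> : phi w + -1 * phi (s +i* th1) =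
      (f w - f (w + twopii R)) * cexp (N%:R * w) / (cexp (w - c) - 1).
    have NE : cexp (N%:R * (w + twopii R)) = cexp (N%:R * w).
      by rewrite !cexp_nat cexp_period.
    by rewrite wp /phi (addrAC w) cexp_period NE; ring.
  have mw : m <= nm (cexp (w - c) - 1).
    by apply: mk; rewrite cImD cImN /= distrC ger0_norm; [apply/andP; split; lra | lra].
  rewrite nmM nmV nmM (nmBC (f w)) cexpN /=.
  set y := expR s; have y0 : 0 < y by rewrite expR_gt0.
  have J := jump sw sw'; rewrite -/y in J.
  have P := pow_expRN_le N c10 (ltW y0).
  rewrite ler_pdivrMr; last by apply: lt_le_trans mw.
  apply: (@le_trans _ _ (C1 * (N.+1%:R / c1) ^+ N.+1 * expR (- s))).
    apply: (le_trans (ler_wpM2r (exprn_ge0 _ (ltW y0)) J)).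
    rewrite -mulrA -mulrA ler_wpM2l //.
    (* One extra power of y = e^s is borrowed, at the price e^(-s) that makes the integral converge
       uniformly in T. *)
    have -> : expR (- (c1 * expR (complex.Re w))) * y ^+ N =
        y ^+ N.+1 * expR (- (c1 * y)) * expR (- s).
      have ys : y * expR (- s) = 1 by rewrite /y -expRD subrr expR0.
      rewrite exprSr [RHS](_ : _ = expR (- (c1 * y)) * y ^+ N * (y * expR (- s))); last by ring.
      by rewrite ys mulr1.
    by rewrite ler_wpM2r ?expR_ge0.
  have Q : 0 <= C1 * (N.+1%:R / c1) ^+ N.+1 * expR (- s).
    by rewrite mulr_ge0 ?expR_ge0 // mulr_ge0 // exprn_ge0 // divr_ge0 // ltW.
  rewrite /K (_ : C1 / m * _ * expR (- s) * _ =
    C1 * (N.+1%:R / c1) ^+ N.+1 * expR (- s) * (nm (cexp (w - c) - 1) / m)).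
    by rewrite ler_peMr // ler_pdivlMr // mul1r.
  by ring.
have B2 : nm (cint th th1 (fun y => phi (T +i* y))) <= 4 * pi.
  have -> : 4 * pi = 2 * (th1 - th) by rewrite /th1; ring.
  apply: cint_le => // y /andP[y1 y2]; set w := T +i* y.
  have k : 1 / 2 <= nm (cexp (w - c) - 1).
    apply: kernel_lower_Re; rewrite cReD cReN /= -/x ler_normr; apply/orP; left; lra.
  rewrite nmM nmV nmM cexpN ler_pdivrMr; last lra.
  have sw : strip w by apply: in_strip => //=; rewrite y1 y2.
  have := flatN w sw; rewrite /= => /(_ ltac:(have := ler_norm T'; lra)) F.
  have y0 : 0 < expR T by rewrite expR_gt0.
  apply: (@le_trans _ _ 1); last by lra.
  apply: le_trans nK; apply: (le_trans (ler_wpM2r (exprn_ge0 _ (ltW y0)) F)).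
  rewrite mulrAC -mulrA; apply: (le_trans (ler_wpM2r _ (ler_norm K'))).
    by rewrite mulr_ge0 ?expR_ge0 ?exprn_ge0 ?expR_ge0.
  rewrite ler_wpM2l // -expRM_natl -expRD ler_expR -natr1; lra.
have B3 : nm (cint th th1 (fun y => phi (t1 +i* y))) <= 4 * pi * (M0 * expR (N%:R * t1)).
  have -> : 4 * pi * (M0 * expR (N%:R * t1)) = 2 * (M0 * expR (N%:R * t1)) * (th1 - th).
    by rewrite /th1; ring.
  apply: cint_le => // y /andP[y1 y2]; set w := t1 +i* y.
  have k : 1 / 2 <= nm (cexp (w - c) - 1).
    apply: kernel_lower_Re; rewrite cReD cReN /= -/x ler_normr; apply/orP; right.
    by rewrite /t1; move: cRe; rewrite -/x; lra.
  rewrite nmM nmV nmM cexpN ler_pdivrMr; last lra.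
  have sw : strip w by apply: in_strip; rewrite /= ?lexx // y1 y2.
  rewrite -expRM_natl /=.
  apply: (@le_trans _ _ (M0 * expR (N%:R * t1))); first by rewrite ler_wpM2r ?expR_ge0 ?bf.
  have Q : 0 <= M0 * expR (N%:R * t1) by rewrite mulr_ge0 ?expR_ge0.
  by nra.
exact: nm_four_sides B1 B2 B3.
Qed.

End Moment.

(** With x = Re c, the moment of order N is at most A0 (D (N + 1))^(N + 1). If D (N + 1) <= e^(x -
    1), then |f c| <= A0 e^((N + 1) (x - 1) - N x) = A0 e^(x - N - 1). *)
Lemma strip_decay th dl : al < th -> th + 2 * pi < be -> 0 < dl < pi ->
  exists A B X, [/\ 0 <= A, 0 < B & forall c, X <= complex.Re c ->
    th + dl <= complex.Im c <= th + 2 * pi - dl ->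
    nm (f c) <= A * expR (complex.Re c - B * expR (complex.Re c))].
Proof.
move=> alth thbe dl0; have [m /andP[m0 _] mk] := kernel_lower dl0.
(* [D] dominates the two growth rates: 1 / c1 from the jump and e^t1 from the left side of the
   rectangle. *)
pose t1 := t0 + 1; pose D := 1 / c1 + expR t1.
have D1 : 1 <= D.
  have := expR_ge1Dx t1; have : 0 <= 1 / c1 by rewrite divr_ge0 // ltW.
  by move: t00; rewrite /D /t1; lra.
have pi0 := pi_gt0 R.
pose A0 := 2 * (C1 / m) + 4 * pi + 4 * pi * M0.
have Cm0 : 0 <= C1 / m by rewrite divr_ge0 // ltW.
have pM0 : 0 <= 4 * pi * M0 by rewrite mulr_ge0 // ltW // mulr_gt0.
have A00 : 0 <= A0 by rewrite /A0; lra.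
pose E := expR (1 : R); have E2 := expR1_ge2 R; rewrite -/E in E2.
have ED : 0 < E * D by rewrite mulr_gt0; lra.
exists (A0 * E), (E * D)^-1, (t0 + 2 + E * D); split; first by rewrite mulr_ge0 //; lra.
  by rewrite invr_gt0.
(* N + 1 will be the integer part of [y], so N + 1 <= y gives D (N + 1) <= e^(x - 1), and y < N + 2
   bounds e^(x - N - 1) by e^(x + 1 - y). *)
move=> c cX cI; set x := complex.Re c in cX *; pose y := expR x / (E * D).
have x0 : 0 <= x by move: t00 cX; lra.
have y1 : 1 <= y.
  rewrite ler_pdivlMr // mul1r; have := expR_ge1Dx x; move: t00 cX; lra.
have y0 : 0 <= y by lra.
have /andP[ky yk] := Num.Theory.truncn_itv y0.
case: (Num.truncn y) ky yk => [|N] ky yk; first by move: yk; lra.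
have cR : t0 + 2 <= complex.Re c by rewrite -/x; lra.
have := @strip_moment th dl c N alth thbe dl0 cR cI m m0 mk; rewrite -/x => B.
have N1 : 1 <= N.+1%:R :> R by rewrite ler1n.
pose P := (D * N.+1%:R) ^+ N.+1.
have P1 : (N.+1%:R / c1) ^+ N.+1 <= P.
  rewrite lerXn2r ?nnegrE ?divr_ge0 ?mulr_ge0 ?(ltW c10) //; try lra.
  rewrite mulrC -[c1^-1]div1r ler_wpM2r // /D lerDl expR_ge0 //.
have P2 : 1 <= P.
  rewrite exprn_ege1 // -[X in X <= _]mul1r; apply: ler_pM => //; lra.
have P3 : expR (N%:R * t1) <= P.
  rewrite expRM_natl; apply: (@le_trans _ _ (expR t1 ^+ N.+1)).
    rewrite exprSr ler_peMr ?exprn_ge0 ?expR_ge0 //.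
    by have := expR_ge1Dx t1; move: t00; rewrite /t1; lra.
  rewrite lerXn2r ?nnegrE ?expR_ge0 ?mulr_ge0 //; try lra.
  apply: (@le_trans _ _ D); last by rewrite ler_peMr //; lra.
  by rewrite /D lerDr divr_ge0 // ltW.
have P4 : P <= expR (x - 1) ^+ N.+1.
  rewrite lerXn2r ?nnegrE ?expR_ge0 ?mulr_ge0 //; try lra.
  rewrite expRD expRN -/E ler_pdivlMr; last lra.
  by move: ky; rewrite ler_pdivlMr //; lra.
have B' : nm (f c) * expR (N%:R * x) <= A0 * P.
  have i1 : C1 / m * (N.+1%:R / c1) ^+ N.+1 <= C1 / m * P by rewrite ler_wpM2l.
  have p4 : 0 <= 4 * pi :> R by rewrite mulr_ge0 // ltW.
  have i2 : 4 * pi * (M0 * expR (N%:R * t1)) <= 4 * pi * (M0 * P).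
    by rewrite ler_wpM2l // ler_wpM2l.
  have i3 : 4 * pi <= 4 * pi * P by rewrite ler_peMr.
  have -> : A0 * P = 2 * (C1 / m * P) + 4 * pi * P + 4 * pi * (M0 * P) by rewrite /A0; ring.
  by clear -B i1 i2 i3; lra.
have -> : A0 * E * expR (x - (E * D)^-1 * expR x) = A0 * expR (x + 1 - y).
  by rewrite -mulrA -expRD; congr (_ * expR _); rewrite /y; ring.
have e0 : 0 < expR (N%:R * x) by rewrite expR_gt0.
rewrite -(ler_pM2r e0); apply: (le_trans B'); rewrite -mulrA -expRD.
rewrite ler_wpM2l //; apply: (le_trans P4); rewrite -expRM_natl ler_expR.
by move: yk; rewrite -!natr1; nra.
Qed.

(** T and L e^(s T) are each absorbed by half of B e^T. This places the right side of the rectangle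
    in [strip_watson] so far that the decay of f beats the auxiliary factor. *)
Lemma expR_dominates (L B s x0 : R) : 0 <= L -> 0 < B -> s < 1 ->
  exists2 T, x0 <= T & T + L * expR (s * T) <= B * expR T.
Proof.
move=> L0 B0 s1; have s1' : 0 < 1 - s by rewrite subr_gt0.
pose T := `|x0| + 8 / B + 2 * L / B / (1 - s).
have h1 : 0 <= 8 / B by rewrite divr_ge0 // ltW.
have h2 : 0 <= 2 * L / B / (1 - s) by rewrite !divr_ge0 ?mulr_ge0 // ltW.
have h3 := normr_ge0 x0; have T0 : 0 <= T by rewrite /T; lra.
exists T; first by rewrite /T; have := ler_norm x0; lra.
have A1 : T <= B / 2 * expR T.
  have -> : expR T = expR (T / 2) ^+ 2 by rewrite -expRM_natl mulrC divfK.
  have e1 : T / 2 <= expR (T / 2) by have := expR_ge1Dx (T / 2); lra.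
  have e2 : (T / 2) ^+ 2 <= expR (T / 2) ^+ 2.
    by rewrite lerXn2r ?nnegrE ?expR_ge0 ?divr_ge0.
  have BT : 8 <= B * T.
    have -> : 8 = B * (8 / B) by rewrite mulrC divfK ?gt_eqF.
    by rewrite ler_pM2l // /T; lra.
  apply: (@le_trans _ _ (B / 2 * (T / 2) ^+ 2)); last by rewrite ler_pM2l ?divr_gt0.
  have -> : B / 2 * (T / 2) ^+ 2 = B * T / 8 * T by field.
  by rewrite ler_peMl //; lra.
have A2 : L <= B / 2 * expR ((1 - s) * T).
  have e1 := expR_ge1Dx ((1 - s) * T).
  have e2 : 2 * L / B <= (1 - s) * T.
    by rewrite [X in _ <= X]mulrC -ler_pdivrMr // /T; lra.
  have -> : L = B / 2 * (2 * L / B) by field; rewrite gt_eqF.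
  by rewrite ler_pM2l ?divr_gt0 //; lra.
have -> : B * expR T = B / 2 * expR T + B / 2 * expR T by field.
apply: lerD => //.
have -> : expR T = expR ((1 - s) * T) * expR (s * T) by rewrite -expRD; congr expR; ring.
by rewrite mulrA ler_wpM2r ?expR_ge0.
Qed.

(* Watson's lemma: f decays like exp (- B |zeta|), zeta = e^w, on a sector of
   opening > pi, so f (w) exp (L zeta^s) stays bounded as L -> oo for s < 1
   with Re zeta^s = 0 on the sides of the sector. *)
Lemma strip_watson th dl y : al < th -> th + 2 * pi < be -> 0 < dl < pi / 2 ->
  th + dl < y < th + 2 * pi - dl -> exists T, forall x, T < x -> f (x +i* y) = 0.
Proof.
move=> alth thbe /andP[dl0 dlp] /andP[y1 y2]; have pi0 := pi_gt0 R.
have [|A [B [X0 [A0 B0 dec]]]] := strip_decay (dl := dl) alth thbe.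
  by apply/andP; split; lra.
pose c0 := th + pi; pose h := pi - dl; pose s := pi / (2 * h).
have h0 : 0 < h by rewrite /h; lra.
have s0 : 0 < s by rewrite divr_gt0 // mulr_gt0.
have s1 : s < 1 by rewrite ltr_pdivrMr ?mulr_gt0 // /h; lra.
have sh : s * h = pi / 2 by rewrite /s; field; rewrite gt_eqF.
pose X1 := `|X0| + t0 + 2.
have X1' : X0 <= X1 /\ t0 + 2 <= X1.
  by rewrite /X1; have := ler_norm X0; have := normr_ge0 X0; move: t00; lra.
case: X1' => X10 X1t.
have yc : c0 - h < y < c0 + h by rewrite /c0 /h; apply/andP; split; lra.
have rect z : X1 <= complex.Re z -> c0 - h <= complex.Im z -> complex.Im z <= c0 + h ->
    [/\ strip z, X0 <= complex.Re z & th + dl <= complex.Im z <= th + 2 * pi - dl].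
  rewrite /c0 /h => z1 z2 z3; split; [by split; lra | exact: le_trans X10 z1 |].
  by apply/andP; split; lra.
pose G L (w : C) := cexp (L%:C * cexp (s%:C * (w - 'i * c0%:C))).
have nG L w : nm (G L w) =
    expR (L * (expR (s * complex.Re w) * cos (s * (complex.Im w - c0)))).
  rewrite nm_cexp; congr expR; rewrite /cexp !(cReM, cImM, cReD, cImD, cReN, cImN) /=.
  by rewrite !(mul0r, mul1r, subr0, add0r, oppr0, addr0, mulr0).
have cosp t : `|t - c0| <= h -> 0 <= cos (s * (t - c0)) <= 1.
  move=> tc; rewrite cos_le1 andbT; apply: cos_ge0_pihalf.
  rewrite -ler_norml normrM gtr0_norm // -sh; rewrite ler_pM2l //.
pose p := expR (s * X1).
have main L x : 0 <= L -> X1 < x ->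
    nm (f (x +i* y)) * expR (L * (expR (s * x) * cos (s * (y - c0)))) <=
    (M0 + A) * expR (L * p).
  move=> L0 xX; have [T xT TL] := @expR_dominates L B s (x + 1) L0 B0 s1.
  have e1 : 1 <= expR (L * p).
    by rewrite -[X in X <= _](@expR0 R) ler_expR mulr_ge0 ?expR_ge0.
  have XT : X1 <= T by apply: le_trans (ltW xX) (le_trans _ xT); rewrite lerDl.
  have cc : c0 - h <= c0 + h by lra.
  have -> : expR (L * (expR (s * x) * cos (s * (y - c0)))) = nm (G L (x +i* y)) by rewrite nG.
  rewrite -nmM; apply: (@maximum_principle _ (fun w => f w * G L w) _ X1 T (c0 - h) (c0 + h)).
  - by apply/andP; split; rewrite /= ?xX //= (lt_le_trans _ xT) // ltrDl.
  - move=> z /andP[/andP[z1 z2] /andP[z3 z4]]; apply: hol_mul.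
      by apply: df; case: (rect z z1 z3 z4).
    apply: hol_cexp; apply: hol_mul (hol_cst _ _) _; apply: hol_cexp.
    apply: hol_mul (hol_cst _ _) _; exact: hol_add (hol_id _) (hol_cst _ _).
  move=> z /andP[/andP[/andP[z1 z2] /andP[z3 z4]] zb].
  have [sz z5 z6] := rect z z1 z3 z4.
  have fz := bf sz; have dz : nm (f z) <= A * expR (complex.Re z - B * expR (complex.Re z)).
    exact: dec.
  have zc : `|complex.Im z - c0| <= h by rewrite ler_distl z3 z4.
  have /andP[c1' c2'] := cosp _ zc.
  rewrite nmM nG; set q := cos _ in c1' c2' *.
  have Q0 : 0 <= expR (s * complex.Re z) by rewrite expR_ge0.
  have MA : M0 <= (M0 + A) * expR (L * p).
    by apply: (@le_trans _ _ (M0 + A)); [rewrite lerDl | rewrite ler_peMr // addr_ge0].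
  case/or4P: zb => /eqP E.
  - apply: ler_pM; rewrite ?nm_ge0 ?expR_ge0 ?(le_trans fz) ?lerDl //.
    rewrite ler_expR ler_wpM2l // E -/p ler_piMr ?expR_ge0 //.
  - apply: (@le_trans _ _ A); last first.
      by apply: (@le_trans _ _ (M0 + A)); [rewrite lerDr | rewrite ler_peMr // addr_ge0].
    apply: (le_trans (ler_wpM2r (expR_ge0 _) dz)); rewrite -mulrA -expRD ler_piMr //.
    rewrite -[X in _ <= X](@expR0 R) ler_expR E.
    have : L * (expR (s * T) * q) <= L * expR (s * T).
      by rewrite ler_wpM2l // ler_piMr // expR_ge0.
    by lra.
  - have -> : q = 0 by rewrite /q E addrAC subrr add0r mulrN cosN sh cos_pihalf.
    by rewrite !mulr0 expR0 mulr1 (le_trans fz).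
  - have -> : q = 0 by rewrite /q E addrAC subrr add0r sh cos_pihalf.
    by rewrite !mulr0 expR0 mulr1 (le_trans fz).
have cy : 0 < cos (s * (y - c0)).
  apply: cos_gt0_pihalf; rewrite -ltr_norml normrM gtr0_norm // -sh ltr_pM2l //.
  by rewrite ltr_norml /c0 /h; apply/andP; split; lra.
set k := cos _ in cy main.
have p0 : 0 < p by rewrite expR_gt0.
exists (X1 + p / (k * s)) => x xT.
have ks0 : 0 < k * s by rewrite mulr_gt0.
have pk : 0 < p / (k * s) by rewrite divr_gt0.
have X10' : 0 <= X1 by move: t00 X1t; lra.
have qp : p < expR (s * x) * k.
  have := expR_ge1Dx (s * x) => e1; have : p < k * s * x.
    by rewrite mulrC -ltr_pdivrMr //; lra.
  by nra.
apply: nm_le0; rewrite leNgt; apply/negP => f0.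
set q := expR (s * x) * k in qp.
pose n := Num.bound ((M0 + A) / nm (f (x +i* y)) / (q - p)).
have qp0 : 0 < q - p by rewrite subr_gt0.
have := main n%:R x (ler0n _ _) ltac:(lra); rewrite -/q.
have -> : expR (n%:R * q) = expR (n%:R * (q - p)) * expR (n%:R * p).
  by rewrite -expRD; congr expR; ring.
rewrite mulrA ler_pM2r ?expR_gt0 // mulrC -ler_pdivlMr // => B1.
have := archi_boundP (normr_ge0 ((M0 + A) / nm (f (x +i* y)) / (q - p))).
rewrite (_ : Num.bound `|_| = n); last by rewrite /n /Num.bound normr_id.
move=> /(le_lt_trans (ler_norm _)); rewrite ltr_pdivrMr // => B2.
by have := expR_ge1Dx (n%:R * (q - p)); lra.
Qed.

Lemma strip_zero y : al + 2 * pi < be -> al < y < be ->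
  exists T, forall x, T < x -> f (x +i* y) = 0.
Proof.
move=> ab /andP[ay yb]; have pi0 := pi_gt0 R.
pose d := Num.min (Num.min (pi / 4) ((be - al - 2 * pi) / 8))
  (Num.min ((y - al) / 4) ((be - y) / 4)).
have d0 : 0 < d by rewrite !lt_min !divr_gt0 // ?subr_gt0 //; lra.
have [[d1' d2'] [d3 d4]] : (d <= pi / 4 /\ d <= (be - al - 2 * pi) / 8) /\
    (d <= (y - al) / 4 /\ d <= (be - y) / 4).
  by rewrite !ge_min !lexx !orbT.
(* The window of height 2 pi starts just below [y] when it fits into the strip; otherwise the
   topmost admissible window contains [y]. *)
have [h|h] := leP (y - 2 * d) (be - 2 * pi - d).
  by apply: (@strip_watson (y - 2 * d) d); try (apply/andP; split); lra.
by apply: (@strip_watson (be - 2 * pi - d) d); try (apply/andP; split); lra.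
Qed.

End Strip.

(** * Explicit estimates versus [differentiable], neighborhoods and [bigO_y] *)

Section DifferentiableEps.
Context {K : numFieldType} {V W : normedModType K}.

Lemma differentiable_eps (f : V -> W) x (df : {linear V -> W}) : continuous df ->
  (forall e, 0 < e -> \forall h \near (0 : V), `|f (h + x) - f x - df h| <= e * `|h|) ->
  differentiable f x /\ 'd f x = df :> (V -> W).
Proof.
move=> dfc H; have D : f \o shift x = cst (f x) + df +o_ 0 id.
  apply/eqaddoP => e /H; apply: filterS => h.
  by rewrite /= opprD addrA.
have E := diff_unique dfc D; split=> //; apply/diff_locallyP.
by rewrite E.
Qed.

Lemma eps_differentiable (f : V -> W) x : differentiable f x ->
  forall e, 0 < e -> \forall h \near (0 : V), `|f (h + x) - f x - 'd f x h| <= e * `|h|.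
Proof.
move=> /diff_locally/eqaddoP D e /D; apply: filterS => h.
by rewrite /= opprD addrA.
Qed.

End DifferentiableEps.

Section Interface.
Variable R : realType.
Local Notation C := R[i].
Local Notation nm := (@nm R).
Local Notation C2 := (C * C)%type.

Lemma gt0_complexE (e : C) : 0 < e -> e = (complex.Re e)%:C /\ 0 < complex.Re e.
Proof.
rewrite ltcE /= => /andP[/eqP ei er]; split=> //.
by apply: complex_eq => //=; rewrite -ei.
Qed.

Lemma gt0C (d : R) : 0 < d -> 0 < d%:C.
Proof. by rewrite ltcE /= eqxx. Qed.

Lemma near_C2P (x y : C) (P : set C2) : nbhs (x, y) P <->
  exists2 d : R, 0 < d & forall z w, nm (z - x) < d -> nm (w - y) < d -> P (z, w).
Proof.
split=> [/nbhs_ballP[e /gt0_complexE[ee e0] eP]|[d d0 dP]].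
  exists (complex.Re e) => // z w zx wy; apply: eP.
  split; rewrite /ball /= ee (distrC _ (_ : C)) normE ltcR //.
apply/nbhs_ballP; exists d%:C; first exact: gt0C.
move=> [z w] [] /=; rewrite /ball /= => zx wy; apply: dP.
  by rewrite -ltcR -normE distrC.
by rewrite -ltcR -normE distrC.
Qed.

Lemma bigO_yP k (z0 : C) (f : C2 -> C) : bigO_y k z0 f <->
  exists K d, 0 < d /\ forall z y, nm (z - z0) < d -> nm y < d -> y != 0 ->
    nm (f (z, y)) <= K * nm y ^+ k.
Proof.
rewrite /bigO_y /=; split.
  move=> /eqO_exP[K K0]; rewrite /off_curve near_withinE => /near_C2P[d d0 dP].
  have [KE K1] := gt0_complexE K0.
  exists (complex.Re K), d; split=> // z y zd yd y0.
  rewrite -lecR rmorphM rmorphXn /= -KE -!normE -normrX.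
  by apply: dP; rewrite ?subr0.
move=> [K [d [d0 dP]]]; apply/eqO_exP; exists (`|K| + 1)%:C.
  by apply: gt0C; rewrite ltr_wpDl.
rewrite near_withinE; apply/near_C2P; exists d => // z y zd yd y0 /=.
rewrite normrX !normE -rmorphXn -rmorphM lecR; apply: (le_trans (dP z y zd _ y0)).
  by move: yd; rewrite subr0.
rewrite ler_wpM2r ?exprn_ge0 ?nm_ge0 // (le_trans (ler_norm _)) // lerDl //.
Qed.

Lemma nm_pair (z w : C) : `|(z, w)| = (Num.max (nm z) (nm w))%:C.
Proof.
rewrite prod_normE /= !normE; case: (leP (nm z) (nm w)) => h.
  by rewrite max_r ?lecR.
by rewrite max_l ?lecR ?ltW.
Qed.

Definition lin2 (a b : C) (t : C2) : C := a * t.1 + b * t.2.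

Lemma lin2_linear a b : linear (lin2 a b).
Proof. by move=> k t u; rewrite /lin2 /= /GRing.scale /=; ring. Qed.

Lemma lin2_continuous a b : continuous (lin2 a b).
Proof.
move=> [x y]; apply/cvgrPdist_le => e /gt0_complexE[-> e0].
pose K := nm a + nm b + 1.
have K0 : 0 < K by rewrite ltr_wpDl // addr_ge0 ?nm_ge0.
apply/near_C2P; exists (complex.Re e / K); first by rewrite divr_gt0.
move=> z w zx wy; rewrite normE lecR.
have -> : lin2 a b (x, y) - lin2 a b (z, w) = a * (x - z) + b * (y - w).
  by rewrite /lin2 /=; ring.
apply: (le_trans (nmD _ _)); rewrite !nmM (nmBC x) (nmBC y).
rewrite !ltr_pdivlMr // in zx wy.
have a0 := nm_ge0 a; have b0 := nm_ge0 b.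
have z0 := nm_ge0 (z - x); have w0 := nm_ge0 (w - y).
apply: (@le_trans _ _ (Num.max (nm (z - x)) (nm (w - y)) * K)); last first.
  by rewrite maxEle; case: ifP => _; apply: ltW.
have [m1 m2] : nm (z - x) <= Num.max (nm (z - x)) (nm (w - y)) /\
   nm (w - y) <= Num.max (nm (z - x)) (nm (w - y)) by rewrite !le_max !lexx orbT.
by rewrite /K; nra.
Qed.

HB.instance Definition _ a b :=
  GRing.isLinear.Build C C2 C *:%R (lin2 a b) (lin2_linear a b).

Lemma dif2_eps (f : C2 -> C) x y a b : dif2 (fun z w => f (z, w)) x y a b <->
  forall e : C, 0 < e -> \forall h \near (0 : C2),
    `|f (h + (x, y)) - f (x, y) - lin2 a b h| <= e * `|h|.
Proof.
split.
  move=> D e /gt0_complexE[-> e0].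
  have e2 : 0 < complex.Re e / 2 by rewrite divr_gt0.
  have [d d0 de] := D _ e2; apply/near_C2P; exists (d / 2); first by rewrite divr_gt0.
  move=> z w; rewrite !subr0 => zd wd.
  have := de (z, w); rewrite /nm2 /= => /(_ ltac:(lra)) H.
  have E : ((z, w) : C2) + (x, y) = (x + z, y + w) by congr pair; rewrite addrC.
  rewrite E nm_pair -rmorphM normE lecR; apply: (le_trans H).
  have [m1 m2] : nm z <= Num.max (nm z) (nm w) /\ nm w <= Num.max (nm z) (nm w).
    by rewrite !le_max !lexx orbT.
  by nra.
move=> H e e0.
have /near_C2P[d d0 dP] := H e%:C (gt0C e0).
exists d => // -[z w]; rewrite /nm2 /= => zw.
have z0 := nm_ge0 z; have w0 := nm_ge0 w.
have := dP z w; rewrite !subr0 => /(_ ltac:(lra) ltac:(lra)).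
have E : ((z, w) : C2) + (x, y) = (x + z, y + w) by congr pair; rewrite addrC.
rewrite E nm_pair -rmorphM normE lecR => A; apply: (le_trans A).
by rewrite ler_wpM2l ?(ltW e0) // ge_max lerDl lerDr z0 w0.
Qed.

Lemma dif2_differentiable (f : C2 -> C) x y a b : dif2 (fun z w => f (z, w)) x y a b ->
  differentiable f (x, y) /\ 'd f (x, y) = lin2 a b :> (C2 -> C).
Proof.
by move=> /dif2_eps D; apply: (@differentiable_eps _ _ _ f (x, y) (lin2 a b)) => //;
  exact: lin2_continuous.
Qed.

Lemma derive_dif2 (f : C2 -> C) x y a b : dif2 (fun z w => f (z, w)) x y a b ->
  'D_(1, 0) f (x, y) = a /\ 'D_(0, 1) f (x, y) = b.
Proof.
move=> /dif2_differentiable[df E].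
by rewrite !deriveE // E /lin2 /= !(mulr1, mulr0, addr0, add0r).
Qed.

Lemma linear_C2 (L : {linear C2 -> C}) t : L t = lin2 (L (1, 0)) (L (0, 1)) t.
Proof.
case: t => h k; have -> : (h, k) = h *: ((1, 0) : C2) + k *: ((0, 1) : C2).
  by congr pair; rewrite /= /GRing.scale /= !(mulr1, mulr0, addr0, add0r).
rewrite linearD !linearZ /lin2 /= /GRing.scale /=.
by rewrite !(mulr1, mulr0, addr0, add0r) ![_ * L _]mulrC.
Qed.

Lemma differentiable_hol2 (f : C2 -> C) x y :
  differentiable f (x, y) -> hol2 (fun z w => f (z, w)) x y.
Proof.
move=> df; exists ('d f (x, y) (1, 0)), ('d f (x, y) (0, 1)); apply/dif2_eps => e e0.
by have := eps_differentiable df e0; apply: filterS => h; rewrite linear_C2.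
Qed.

Lemma hol2_differentiable_pair (f : C2 -> C2) x y :
  hol2 (fun z w => (f (z, w)).1) x y -> hol2 (fun z w => (f (z, w)).2) x y ->
  differentiable f (x, y).
Proof.
move=> [a [b D]] [a' [b' D']].
have -> : f = (fun p => ((f p).1, (f p).2)) by apply/funext => p; case: (f p).
apply: differentiable_pair.
  by case: (@dif2_differentiable (fun p => (f p).1) x y a b D).
by case: (@dif2_differentiable (fun p => (f p).2) x y a' b' D').
Qed.

Lemma differentiable_fstC (p : C2) : differentiable (fst : C2 -> C) p.
Proof. by case: p => x y; case: (@dif2_differentiable fst x y 1 0 (dif2_fst x y)). Qed.

Lemma differentiable_sndC (p : C2) : differentiable (snd : C2 -> C) p.
Proof. by case: p => x y; case: (@dif2_differentiable snd x y 0 1 (dif2_snd x y)). Qed.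

Lemma differentiable_hol2_pair (f : C2 -> C2) x y : differentiable f (x, y) ->
  hol2 (fun z w => (f (z, w)).1) x y /\ hol2 (fun z w => (f (z, w)).2) x y.
Proof.
move=> df; split.
  apply: (@differentiable_hol2 (fun p => (f p).1)).
  by apply: (@differentiable_comp _ _ _ _ f fst); [exact: df | exact: differentiable_fstC].
apply: (@differentiable_hol2 (fun p => (f p).2)).
by apply: (@differentiable_comp _ _ _ _ f snd); [exact: df | exact: differentiable_sndC].
Qed.

Lemma differentiable_hol (f : C -> C) x : differentiable f x -> hol f x.
Proof.
(* Composition with the first projection reduces one variable to two. *)
move=> df; have D : differentiable (fun p : C2 => f p.1) (x, 0 : C).
  by apply: (@differentiable_comp _ _ _ _ fst f); [exact: differentiable_fstC | exact: df].
have [a [b D']] := differentiable_hol2 D.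
by exists a; exact: (dif2_dif1 D').
Qed.

End Interface.

(** * Sectors and first integrals *)

Section Sectors.
Variable R : realType.
Local Notation C := R[i].
Local Notation nm := (@nm R).

Definition cis (t : R) : C := cos t +i* sin t.

Lemma cisD s t : cis (s + t) = cis s * cis t.
Proof. by apply: complex_eq; rewrite ?cReM ?cImM /= ?cosD ?sinD; ring. Qed.

Lemma nm_cis t : nm (cis t) = 1.
Proof.
apply/eqP; rewrite -(@eqrXn2 _ 2) ?nm_ge0 // nm_sqr /= cos2Dsin2 expr1n.
exact: eqxx.
Qed.

Lemma cis0 : cis 0 = 1.
Proof. by rewrite /cis cos0 sin0. Qed.

Lemma cisDpi t : cis (t + pi) = - cis t.
Proof. by rewrite /cis sinDpi cosDpi. Qed.

(* [1 / y] has argument in ]a, a + pi[, at distance at least about [s] from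
   the end points. *)
Definition sec (a s : R) (y : C) : bool := s < complex.Im (cis (- a) * y^-1) * nm y.

Lemma sec_neq0 a s y : 0 <= s -> sec a s y -> y != 0.
Proof.
by move=> s0; apply: contraTneq => ->; rewrite /sec nm0 mulr0 -leNgt.
Qed.

Lemma sec_mono a s s' y : s' <= s -> sec a s y -> sec a s' y.
Proof. by move=> ss; apply: le_lt_trans. Qed.

Lemma sec_opposite a s y : 0 <= s -> sec a s y -> sec (a + pi) s y = false.
Proof.
rewrite /sec => s0 h; apply/negbTE; rewrite -leNgt.
have -> : cis (- (a + pi)) = - cis (- a).
  by rewrite [in RHS](_ : - a = - (a + pi) + pi) ?cisDpi ?opprK //; ring.
by rewrite mulNr cImN; move: h; lra.
Qed.

(** The margin in [sec] is invariant under scaling of y, so a relative perturbation s / 8 costs at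
    most half of it. Cauchy's estimates in sectors can thus use polydiscs of radius proportional to
    |y|. *)
Lemma sec_box a s y y' : 0 < s <= 1 -> sec a (2 * s) y -> nm (y' - y) <= s / 8 * nm y ->
  sec a s y'.
Proof.
move=> /andP[s0 s1] h yy; have y0 : y != 0 by apply: sec_neq0 h; rewrite mulr_ge0 // ltW.
have ny : 0 < nm y by rewrite nm_gt0.
have ny' : 7 / 8 * nm y <= nm y'.
  by have := nm_sub y y'; rewrite (nmBC y); nra.
have ny0 : 0 < nm y' by nra.
have y'0 : y' != 0 by rewrite -nm_gt0.
pose c := cis (- a); move: h; rewrite /sec -/c => h.
pose d : C := c * y'^-1 * (nm y')%:C - c * y^-1 * (nm y)%:C.
have dE : d = c * (((nm y')%:C - (nm y)%:C) / y' + (nm y)%:C * (y - y') / (y * y')).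
  by rewrite /d; field; rewrite y0 y'0.
have nd : nm d <= s.
  rewrite dE nmM nm_cis mul1r; apply: (le_trans (nmD _ _)).
  rewrite -rmorphB !nmM !nmV !nmR nmM (ger0_norm (nm_ge0 y)).
  have A : `|nm y' - nm y| <= nm (y' - y).
    by rewrite ler_norml; have := nm_sub y' y; have := nm_sub y y'; rewrite (nmBC y);
      move=> *; apply/andP; split; lra.
  rewrite (nmBC y).
  have -> : `|nm y' - nm y| / nm y' + nm y * nm (y' - y) / (nm y * nm y') =
    (`|nm y' - nm y| + nm (y' - y)) / nm y' by field; rewrite !gt_eqF.
  by rewrite ler_pdivrMr //; nra.
have Id : complex.Im d = complex.Im (c * y'^-1) * nm y' - complex.Im (c * y^-1) * nm y.
  by rewrite /d cImD cImN !(cImM _ _%:C) /= !mulr0 !add0r.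
by have := Im_le_nm d; rewrite ler_norml Id => /andP[]; lra.
Qed.

(** Relative to the first side of the sector, 1 / y has an argument t in ]0, pi[ with sin t > s >=
    sin eps; by concavity of the sine, eps < t < pi - eps. *)
Lemma sector_of_sec (I : R * R) (c eps r s : R) (z y : C) :
  I.2 = I.1 + pi -> 0 < eps < pi / 2 -> sin eps <= s ->
  expR (- c) < nm z < expR c -> r < (nm y)^-1 -> sec I.1 s y ->
  sector I c eps r (z, y).
Proof.
move=> I2 /andP[e0 e1] se /andP[z1 z2] yr h.
have pi0 := pi_gt0 R.
have s0 : 0 < s by apply: lt_le_trans se; apply: sin_gt0_pi; apply/andP; split; lra.
have y0 : y != 0 by apply: sec_neq0 h; exact: ltW.
have ny : 0 < nm y by rewrite nm_gt0.
split; rewrite /= ?normE ?ltcR //.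
pose w := cis (- I.1) * y^-1.
have nw : nm w = (nm y)^-1 by rewrite nmM nm_cis mul1r nmV.
have w0 : 0 < complex.Im w.
  by rewrite -(pmulr_lgt0 _ ny); apply: lt_trans h.
have [t /andP[t0 t1] wE] := polar_upper w0.
have st : s < sin t.
  move: h; rewrite /sec -/w {1}wE cImM /= mul0r addr0 nw.
  by rewrite mulrAC mulVf ?mul1r // gt_eqF.
have et : sin eps < sin t by apply: le_lt_trans se st.
have [et1 et2] : eps < t /\ t < pi - eps.
  have P (x : R) : 0 <= x -> x <= eps -> sin x <= sin eps.
    move=> x0 xe; pose p := (eps + x) / 2; pose q := (eps - x) / 2.
    have -> : eps = p + q by rewrite /p /q; field.
    have -> : x = p - q by rewrite /p /q; field.
    have p0 : 0 <= cos p by apply: cos_ge0_pihalf; rewrite /p; apply/andP; split; lra.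
    have q0 : 0 <= sin q by apply: sin_ge0_pi; rewrite /q; apply/andP; split; lra.
    by rewrite sinB sinD; have := mulr_ge0 p0 q0; lra.
  split; rewrite ltNge; apply/negP => ht; move: et; rewrite ltNge => /negP; apply.
    by apply: P => //; exact: ltW.
  have -> : sin t = sin (pi - t) by rewrite sinB sinpi cospi; ring.
  by apply: P; lra.
exists (nm y)^-1, (t + I.1); split=> //; [lra | lra |].
have E : cis I.1 * w = y^-1 by rewrite mulrA -cisD subrr cis0 mul1r.
by rewrite -E {1}wE nw mulrCA -/(cis t) -cisD addrC.
Qed.

Lemma Im_mul_cis (t : R) (x : C) :
  complex.Im (cis t * x) = cos t * complex.Im x + sin t * complex.Re x.
Proof. by rewrite cImM. Qed.

Definition ang (varpi : R) (i : 'Z_4) : R := (opening varpi i).1.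

Lemma opening_pi varpi i : (opening varpi i).2 = ang varpi i + pi.
Proof. by rewrite /ang /opening; case: i => -[|[|[|[|]]]] //= _; ring. Qed.

(** The sectors 0 and 2, the two half planes, miss only directions of 1 / y close to the real axis.
    The sectors 1 and 3 contain these with a margin proportional to sin varpi, so one [s] serves all
    y. *)
Lemma sec_cover varpi : 0 < varpi < pi -> exists2 s, 0 < s <= 1 / 4 &
  forall y, y != 0 -> exists i, sec (ang varpi i) s y.
Proof.
move=> vp; have sv := sin_gt0_pi vp; have sv1 := sin_le1 varpi.
exists (sin varpi / 4); first by apply/andP; split; lra.
move=> y y0; set s := sin varpi / 4; pose u := y^-1 * (nm y)%:C.
have ny : 0 < nm y by rewrite nm_gt0.
have nu : complex.Re u ^+ 2 + complex.Im u ^+ 2 = 1.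
  by rewrite -nm_sqr nmM nmV nmR gtr0_norm // mulVf ?expr1n // gt_eqF.
have S a : sec a s y = (s < cos a * complex.Im u - sin a * complex.Re u).
  rewrite /sec /u Im_mul_cis cosN sinN !(cImM _ _%:C) !(cReM _ _%:C) /=.
  by congr (_ < _); ring.
pose x := complex.Re u; pose e := complex.Im u; rewrite -/x -/e in nu S.
have [h|h] := ltP s e.
  by exists 0; rewrite S /ang /= addNr cos0 sin0 mul1r mul0r subr0.
have [h'|h'] := ltP s (- e).
  by exists 2; rewrite S /ang /= cosN sinN cospi sinpi; move: h'; lra.
have es : e ^+ 2 <= 1 / 16 by rewrite /s in h h'; nra.
have ce : - s <= cos varpi * e <= s.
  have c1 := cos_le1 varpi; have c2 := cos_geN1 varpi.
  by apply/andP; split; nra.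
have [x0|x0] := leP 0 x.
  have x34 : 3 / 4 <= x by nra.
  exists 1; rewrite S /ang /= cosN sinN; have : sin varpi * (3 / 4) <= sin varpi * x.
    by rewrite ler_pM2l.
  by case/andP: ce; rewrite /s; lra.
have x34 : x <= - (3 / 4) by nra.
exists 3; rewrite S /ang /= cosDpi sinDpi cosN sinN.
have : sin varpi * x <= sin varpi * - (3 / 4) by rewrite ler_pM2l.
by case/andP: ce; rewrite /s; lra.
Qed.

End Sectors.

(** * Germs at a point of the curve, sectorial and full *)

Section Germs.
Variable R : realType.
Local Notation C := R[i].
Local Notation nm := (@nm R).
Local Notation C2 := (C * C)%type.

Lemma hol2_add (f g : C -> C -> C) x y : hol2 f x y -> hol2 g x y ->
  hol2 (fun z w => f z w + g z w) x y.
Proof. by move=> [a [b D]] [a' [b' D']]; do 2 eexists; exact: dif2_addf D D'. Qed.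

Lemma hol2_mul (f g : C -> C -> C) x y : hol2 f x y -> hol2 g x y ->
  hol2 (fun z w => f z w * g z w) x y.
Proof. by move=> [a [b D]] [a' [b' D']]; do 2 eexists; exact: dif2_mulf D D'. Qed.

Lemma hol2_comp (g : C -> C) (f : C -> C -> C) x y : hol2 f x y -> hol g (f x y) ->
  hol2 (fun z w => g (f z w)) x y.
Proof. by move=> [a [b D]] [l D']; do 2 eexists; exact: dif2_comp D D'. Qed.

Lemma hol2_cst k (x y : C) : hol2 (fun _ _ => k) x y.
Proof. by do 2 eexists; exact: dif2_cst. Qed.

Lemma hol2_fst (x y : C) : hol2 (fun z _ => z) x y.
Proof. by do 2 eexists; exact: dif2_fst. Qed.

Lemma hol2_snd (x y : C) : hol2 (fun _ w => w) x y.
Proof. by do 2 eexists; exact: dif2_snd. Qed.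

Lemma hol2_opp (f : C -> C -> C) x y : hol2 f x y -> hol2 (fun z w => - f z w) x y.
Proof. by move=> h; apply: (hol2_comp h); eexists; exact: dif_opp. Qed.

Lemma hol2_inv (f : C -> C -> C) x y : hol2 f x y -> f x y != 0 ->
  hol2 (fun z w => (f z w)^-1) x y.
Proof. by move=> h h0; apply: (hol2_comp h); eexists; exact: dif_inv. Qed.

Lemma hol2_expn (f : C -> C -> C) n x y : hol2 f x y -> hol2 (fun z w => f z w ^+ n) x y.
Proof.
move=> h; apply: (@hol2_comp (fun t => t ^+ n) f x y h).
by apply: (@hol_exp _ id); exact: hol_id.
Qed.

Lemma hol2_sum (I : Type) (r : seq I) (f : I -> C -> C -> C) x y :
  (forall i, hol2 (f i) x y) -> hol2 (fun z w => \sum_(i <- r) f i z w) x y.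
Proof.
move=> fh; elim: r => [|i r IH].
  rewrite (_ : (fun z w => _) = fun _ _ => 0); first exact: hol2_cst.
  by apply/funext => z; apply/funext => w; rewrite big_nil.
rewrite (_ : (fun z w => _) = fun z w => f i z w + \sum_(j <- r) f j z w).
  exact: hol2_add.
by apply/funext => z; apply/funext => w; rewrite big_cons.
Qed.

(** Cauchy's estimates on a polydisc of radius s |y| cost one power of |y|. There |y'| <= 2 |y|,
    whence the factor 2^(k + 1). *)
Lemma grad_scaled (f : C -> C -> C) z y K s k : 0 < s <= 1 -> y != 0 ->
  pdisc z y (s * nm y) (fun z y => hol2 f z y /\ nm (f z y) <= K * nm y ^+ k.+1) ->
  nm (d1 f z y) <= 16 * (`|K| * 2 ^+ k.+1) / s * nm y ^+ k /\
  nm (d2 f z y) <= 16 * (`|K| * 2 ^+ k.+1) / s * nm y ^+ k.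
Proof.
move=> /andP[s0 s1] y0 H; have ny : 0 < nm y by rewrite nm_gt0.
have sy : 0 < s * nm y by rewrite mulr_gt0.
pose M := `|K| * (2 * nm y) ^+ k.+1.
have H' : pdisc z y (s * nm y) (fun z y => hol2 f z y /\ nm (f z y) <= M).
  move=> z' y' zz yy; have [h1 h2] := H z' y' zz yy; split=> //.
  apply: (le_trans h2); apply: (@le_trans _ _ (`|K| * nm y' ^+ k.+1)).
    by rewrite ler_wpM2r ?exprn_ge0 ?nm_ge0 // ler_norm.
  rewrite ler_wpM2l // lerXn2r ?nnegrE ?nm_ge0 ?mulr_ge0 ?nm_ge0 //.
  by have := nmD (y' - y) y; rewrite subrK; nra.
have E : 16 * (`|K| * 2 ^+ k.+1) / s * nm y ^+ k = 16 * M / (s * nm y).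
  by rewrite /M exprMn exprS (exprS (nm y)); field; rewrite !gt_eqF.
by rewrite E; split; [exact: d1_le H' | exact: d2_le H'].
Qed.

Variables (varpi : R) (z0 : C).

Definition Reg (i : 'Z_4) (s r : R) (z y : C) : bool :=
  [&& nm (z - z0) < r, nm y < r & sec (ang varpi i) s y].

(** Eventually as (z, y) tends to (z0, 0) inside the sector i with margin s; [near0] is the version
    on full neighborhoods, the curve included. *)
Definition ev i s (Q : C -> C -> Prop) :=
  exists2 r, 0 < r & forall z y, Reg i s r z y -> Q z y.

Definition near0 (Q : C -> C -> Prop) :=
  exists2 r, 0 < r & forall z y, nm (z - z0) < r -> nm y < r -> Q z y.

Lemma Reg_mono i s s' r r' z y : r' <= r -> s <= s' -> Reg i s' r' z y -> Reg i s r z y.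
Proof.
move=> rr ss /and3P[a b c]; apply/and3P; split; [exact: lt_le_trans rr|
  exact: lt_le_trans rr|exact: sec_mono c].
Qed.

Lemma ev_imp i s (P Q : C -> C -> Prop) : (forall z y, P z y -> Q z y) -> ev i s P -> ev i s Q.
Proof. by move=> PQ [r r0 H]; exists r => // z y /H /PQ. Qed.

Lemma ev_mono i s s' P : s <= s' -> ev i s P -> ev i s' P.
Proof. by move=> ss [r r0 H]; exists r => // z y /(Reg_mono (lexx r) ss)/H. Qed.

Lemma ev_and i s P Q : ev i s P -> ev i s Q -> ev i s (fun z y => P z y /\ Q z y).
Proof.
move=> [r r0 H] [r' r'0 H']; exists (Num.min r r'); first by rewrite lt_min r0.
by move=> z y h; split; [apply: H | apply: H']; apply: Reg_mono h; rewrite ?ge_min ?lexx ?orbT.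
Qed.

Lemma near0_and P Q : near0 P -> near0 Q -> near0 (fun z y => P z y /\ Q z y).
Proof.
move=> [r r0 H] [r' r'0 H']; exists (Num.min r r'); first by rewrite lt_min r0.
by move=> z y; rewrite !lt_min => /andP[a b] /andP[c d]; split; [exact: H | exact: H'].
Qed.

Lemma near0_imp (P Q : C -> C -> Prop) : (forall z y, P z y -> Q z y) -> near0 P -> near0 Q.
Proof. by move=> PQ [r r0 H]; exists r => // z y zr yr; apply: PQ; exact: H. Qed.

Lemma near0_ev i s P : near0 P -> ev i s P.
Proof. by move=> [r r0 H]; exists r => // z y /and3P[a b _]; exact: H. Qed.

Lemma near0_ball r : 0 < r -> near0 (fun z y => nm (z - z0) < r /\ nm y < r).
Proof. by move=> r0; exists r. Qed.

Lemma ev_box i s P : 0 < s <= 1 -> ev i s P ->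
  ev i (2 * s) (fun z y => pdisc z y (s / 8 * nm y) P).
Proof.
move=> /andP[s0 s1] [r r0 H]; exists (r / 2); first by rewrite divr_gt0.
move=> z y /and3P[zr yr h] z' y' zz yy; apply: H; have ny := nm_ge0 y; apply/and3P; split.
- by have := nm_tri z z' z0; nra.
- by have := nmD (y' - y) y; rewrite subrK; nra.
- by apply: sec_box h yy; rewrite s0.
Qed.

Lemma near0_box P : near0 P -> near0 (fun z y => pdisc z y (1 / 2 * nm y) P).
Proof.
move=> [r r0 H]; exists (r / 2); first by rewrite divr_gt0.
move=> z y zr yr z' y' zz yy; apply: H; have ny := nm_ge0 y.
  by have := nm_tri z z' z0; lra.
by have := nmD (y' - y) y; rewrite subrK; lra.
Qed.

Lemma ev_sec i s : 0 <= s -> ev i s (fun _ y => y != 0).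
Proof. by move=> s0; exists 1 => // z y /and3P[_ _]; exact: sec_neq0. Qed.

Lemma ev_grad i s f K k : 0 < s <= 1 ->
  ev i s (fun z y => hol2 f z y /\ nm (f z y) <= K * nm y ^+ k.+1) ->
  exists K', ev i (2 * s) (fun z y => nm (d1 f z y) <= K' * nm y ^+ k /\
                                     nm (d2 f z y) <= K' * nm y ^+ k).
Proof.
move=> s01 H; exists (16 * (`|K| * 2 ^+ k.+1) / (s / 8)).
have /andP[s0 s1] := s01; have s2 : 0 <= 2 * s by lra.
apply: ev_imp (ev_and (ev_sec i s2) (ev_box s01 H)) => z y [y0 B].
by apply: grad_scaled B => //; apply/andP; split; lra.
Qed.

Lemma near0_grad f K k :
  near0 (fun z y => hol2 f z y /\ nm (f z y) <= K * nm y ^+ k.+1) ->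
  exists K', near0 (fun z y => y != 0 -> nm (d1 f z y) <= K' * nm y ^+ k /\
                                     nm (d2 f z y) <= K' * nm y ^+ k).
Proof.
move=> H; exists (16 * (`|K| * 2 ^+ k.+1) / (1 / 2)).
apply: near0_imp (near0_box H) => z y B y0.
by apply: grad_scaled B => //; apply/andP; split; lra.
Qed.

Lemma near0_bounded f : near0 (hol2 f) -> exists K, near0 (fun z y => nm (f z y) <= K).
Proof.
move=> [r r0 H].
have h : hol2 f z0 0 by apply: H; rewrite ?subrr ?nm0.
have [d d0 D] := hol2_cts h ltr01; exists (nm (f z0 0) + 1), d => // z y zd yd.
have := D z y zd; rewrite subr0 => /(_ yd).
by have := nmD (f z y - f z0 0) (f z0 0); rewrite subrK; lra.
Qed.

Lemma Z4_ind (P : 'Z_4 -> Prop) : P 0 -> P 1 -> P 2 -> P 3 -> forall i, P i.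
Proof.
move=> p0 p1 p2 p3 [[|[|[|[|]]]] // h].
- by rewrite (_ : Ordinal h = 0) //; apply/val_inj.
- by rewrite (_ : Ordinal h = 1) //; apply/val_inj.
- by rewrite (_ : Ordinal h = 2) //; apply/val_inj.
- by rewrite (_ : Ordinal h = 3) //; apply/val_inj.
Qed.

Lemma Z4_lower (q : 'Z_4 -> R) : (forall i, 0 < q i) -> exists2 r, 0 < r & forall i, r <= q i.
Proof.
move=> q0; exists (Num.min (Num.min (q 0) (q 1)) (Num.min (q 2) (q 3))).
  by rewrite !lt_min !q0.
by elim/Z4_ind; rewrite !ge_min lexx ?orbT.
Qed.

Lemma Z4_upper (K : 'Z_4 -> R) : exists2 M, 0 <= M & forall i, K i <= M.
Proof.
have [n0 [n1 [n2 n3]]] : 0 <= `|K 0| /\ (0 <= `|K 1| /\ (0 <= `|K 2| /\ 0 <= `|K 3|)).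
  by rewrite !normr_ge0.
exists (`|K 0| + `|K 1| + `|K 2| + `|K 3|); first by rewrite !addr_ge0.
by elim/Z4_ind; [have := ler_norm (K 0) | have := ler_norm (K 1) | have := ler_norm (K 2)
  | have := ler_norm (K 3)]; lra.
Qed.

(** Provides the angle eps = atan s with sin eps <= s that [sector_of_sec] requires. *)
Lemma sin_atan_le (s : R) : 0 < s -> [/\ 0 < atan s, atan s < pi / 2 & sin (atan s) <= s].
Proof.
move=> s0; split; [by rewrite -(@atan0 R) lt_atan | exact: atan_ltpi2 |].
have c0 : 0 < cos (atan s).
  by apply: cos_gt0_pihalf; rewrite atan_gtNpi2 atan_ltpi2.
have -> : sin (atan s) = s * cos (atan s) by rewrite -{2}[s]atanK /tan divfK // gt_eqF.
by rewrite ler_piMr ?cos_le1 // ltW.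
Qed.

Hypothesis z00 : z0 != 0.

Lemma annulus : exists2 c, 0 < c & forall z, nm (z - z0) < nm z0 / 2 ->
  expR (- c) < nm z < expR c.
Proof.
have n0 : 0 < nm z0 by rewrite nm_gt0.
have i0 : 0 < (nm z0)^-1 by rewrite invr_gt0.
exists (2 * nm z0 + 2 / nm z0); first by lra.
move=> z zz; set c := _ + _; have ec := expR_ge1Dx c.
have h1 := nm_sub z0 z; have h2 := nmD (z - z0) z0; rewrite subrK in h2.
rewrite nmBC in h1; apply/andP; split; last by rewrite /c in ec *; lra.
apply: (@lt_trans _ _ (nm z0 / 2)); last by lra.
rewrite expRN -[nm z0 / 2]invrK ltf_pV2 ?posrE ?expR_gt0 ?invr_gt0 ?divr_gt0 //.
by rewrite invf_div; rewrite /c in ec *; lra.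
Qed.

Section Data.
Variables (tau : C) (F : C2 -> C2) (a b : nat -> C -> C) (phi : 'Z_4 -> C2 -> C2).
Hypothesis Fc : has_cocycle tau varpi F a b phi.

(** Holomorphy, asymptotic expansion and gluing of the normalizations, localized at [z0] and with
    sectors measured by the margin s instead of an angle. *)
Definition sector_data (Psi : 'Z_4 -> C2 -> C2) :=
  [/\ forall i s, 0 < s -> ev i s (fun z y =>
        hol2 (fun z y => (Psi i (z, y)).1) z y /\ hol2 (fun z y => (Psi i (z, y)).2) z y),
      forall i s N, 0 < s -> exists M, ev i s (fun z y =>
        nm ((Psi i (z, y)).1 - (trunc a b N (z, y)).1) <= M * nm y ^+ N.+1 /\
        nm ((Psi i (z, y)).2 - (trunc a b N (z, y)).2) <= M * nm y ^+ N.+1) &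
      forall i s, 0 < s -> exists2 r, 0 < r & forall z y,
        Reg i s r z y -> Reg (i + 1) s r z y ->
        corner_chart i (PiXY tau (Psi i (z, y))) =
        phi i (corner_chart i (PiXY tau (Psi (i + 1) (z, y))))].

Lemma sector_dataP : exists Psi, sector_data Psi.
Proof.
have [D [Psi [SN ov]]] := Fc; exists Psi.
have [c c0 cP] := annulus.
have n0 : 0 < nm z0 / 2 by rewrite divr_gt0 // nm_gt0.
have inS i s r : 0 < s -> 0 < r -> exists2 r', 0 < r' & forall z y, Reg i s r' z y ->
    sector (opening varpi i) c (atan s) r (z, y).
  move=> s0 r0; exists (Num.min (nm z0 / 2) r^-1); first by rewrite lt_min n0 invr_gt0.
  move=> z y /and3P[]; rewrite !lt_min => /andP[zz _] /andP[_ yr] h.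
  have [e0 e1 e2] := sin_atan_le s0.
  apply: (@sector_of_sec _ _ c (atan s) r s z y (opening_pi varpi i)) => //.
  - by rewrite e0.
  - exact: cP.
  - have ny : 0 < nm y by rewrite nm_gt0; apply: sec_neq0 h; exact: ltW.
    by rewrite -[r]invrK ltf_pV2 ?posrE ?invr_gt0.
split.
- move=> i s s0; have [e0 _ _] := sin_atan_le s0.
  have [DA _ [_ hD _ _] /(_ c (atan s) c0 e0)[r [r0 rD _ _]]] := SN i.
  have [r' r'0 H] := inS i s r s0 r0; exists r' => // z y /H/rD/hD.
  exact: differentiable_hol2_pair.
- move=> i s N s0; have [e0 _ _] := sin_atan_le s0.
  have [DA _ _ /(_ c (atan s) c0 e0)[r [r0 _ _ /(_ N)[M MP]]]] := SN i.
  have [r' r'0 H] := inS i s r s0 r0; exists M, r' => // z y /H/MP.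
  case: (Psi i (z, y)) => p q; case: (trunc a b N (z, y)) => p' q' /=.
  rewrite (_ : (p, q) - (p', q') = (p - p', q - q')) // nm_pair normE -rmorphXn -rmorphM lecR.
  by rewrite ge_max => /andP[u v]; split; [exact: u | exact: v].
move=> i s s0; have [e0 _ _] := sin_atan_le s0.
have [r r0 rP] := ov i c (atan s) c0 e0.
have [r1 r10 H1] := inS i s r s0 r0; have [r2 r20 H2] := inS (i + 1) s r s0 r0.
exists (Num.min r1 r2); first by rewrite lt_min r10.
move=> z y h1 h2; apply: rP; [apply: H1 | apply: H2].
  by apply: Reg_mono h1; rewrite ?ge_min lexx.
by apply: Reg_mono h2; rewrite ?ge_min lexx ?orbT.
Qed.

Hypothesis ab : formal_coefs a b.

(** The powers of y are factored out so that the truncations can be divided by y near the curve.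
    That B z 0 does not depend on N makes the first integrals of all truncations agree on y = 0. *)
Lemma trunc_data N : exists A B : C -> C -> C,
  [/\ near0 (fun z y => hol2 A z y /\ hol2 B z y),
      forall z y, (trunc a b N (z, y)).1 = z + y * A z y,
      forall z y, (trunc a b N (z, y)).2 = y + y ^+ 2 * B z y &
      (2 <= N)%N -> forall z, B z 0 = b 2 z].
Proof.
have [ah bh] := ab.
(* The tests on n put 0 in place of the coefficients [a 0], [b 0] and [b 1], about which nothing is
   assumed, since [hol2_sum] asks for holomorphy at every index. *)
exists (fun z y => \sum_(1 <= n < N.+1) (if (1 <= n)%N then a n z else 0) * y ^+ (n - 1)).
exists (fun z y => \sum_(2 <= n < N.+1) (if (2 <= n)%N then b n z else 0) * y ^+ (n - 2)).
split.
- exists (nm z0); first by rewrite nm_gt0.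
  move=> z y zz _; have zn : z != 0.
    by apply: contraTneq zz => ->; rewrite sub0r nmN ltxx.
  split; apply: hol2_sum => n; apply: hol2_mul; try (by apply: hol2_expn; exact: hol2_snd).
    case n1: (1 <= n)%N; last exact: hol2_cst.
    by apply: (hol2_comp (hol2_fst z y)); apply: differentiable_hol; exact: ah.
  case n1: (2 <= n)%N; last exact: hol2_cst.
  by apply: (hol2_comp (hol2_fst z y)); apply: differentiable_hol; exact: bh.
- move=> z y /=; congr (_ + _); rewrite big_distrr /= !big_nat; apply: eq_bigr => n /andP[n1 _].
  by rewrite n1 mulrCA -exprS subn1 prednK.
- move=> z y /=; congr (_ + _); rewrite big_distrr /= !big_nat; apply: eq_bigr => n /andP[n1 _].
  by rewrite n1 mulrCA -exprD addnC subnK.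
move=> N2 z; rewrite big_ltn // subnn expr0 mulr1 big_nat big1 ?addr0 // => n /andP[n2 _].
by rewrite expr0n subn_eq0 [(n <= 2)%N]leqNgt n2 mulr0.
Qed.

End Data.
End Germs.

(** * First integrals of the truncated foliations *)

Section FirstIntegrals.
Variable R : realType.
Local Notation C := R[i].
Local Notation nm := (@nm R).
Local Notation C2 := (C * C)%type.

Lemma clog_lip : exists2 d : R, 0 < d & forall z w, nm (z - 1) < d -> nm (w - 1) < d ->
  nm (clog z - clog w) <= 4 * nm (z - w).
Proof.
have [d d0 dP] := clog_near1 R.
have [d' d'0 dP'] := @dif_clog1 R 1 ltr01.
pose e := Num.min (Num.min d d') 1 / 8.
have e0 : 0 < e by rewrite divr_gt0 // !lt_min d0 d'0 ltr01.
have [e1 [e2 e3]] : 8 * e <= d /\ 8 * e <= d' /\ 8 * e <= 1.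
  by rewrite /e mulrCA divff // mulr1 !ge_min !lexx !orbT.
exists e => // z w zd wd.
have nw : 1 / 2 < nm w by have := nm_sub 1 w; rewrite nm1 nmBC; lra.
have w0 : w != 0 by rewrite -nm_gt0; lra.
pose h := (z - w) / w.
have zw : z = w * (1 + h) by rewrite /h mulrDr mulr1 mulrC divfK // addrC subrK.
have nzw : nm (z - w) <= 2 * e by have := nm_tri 1 z w; rewrite (nmBC 1 w); lra.
have nh : nm h <= 2 * nm (z - w).
  by rewrite /h nmM nmV ler_pdivrMr; [have := nm_ge0 (z - w); nra | lra].
have h1 : 1 + h - 1 = h by ring.
have [||_ _] := dP w (1 + h); rewrite ?h1; [lra | lra |].
rewrite -zw => ->; rewrite addrAC subrr add0r.
have := dP' h ltac:(lra); rewrite clog1 subr0 !mul1r => A.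
by have := nmD (clog (1 + h) - h) h; rewrite subrK; lra.
Qed.

Variables (tau z0 : C).
Hypotheses (z00 : z0 != 0) (tau0 : tau != 0).

Definition kap (u : C) : C := u / (twopii R * tau).

(* A first integral of the foliation [u : v] of the pencil near z = z0. *)
Definition Hf (u v p q : C) : C := v / q + kap u * clog (p / z0).

Lemma twopii_neq0 : twopii R != 0.
Proof.
by rewrite /twopii eq_complex /= negb_and mulf_neq0 ?orbT // gt_eqF // pi_gt0.
Qed.

Lemma dif2_Hf : exists2 d : R, 0 < d & forall u v (P Q : C -> C -> C) x y p1 p2 q1 q2,
  nm (P x y / z0 - 1) < d -> Q x y != 0 -> dif2 P x y p1 p2 -> dif2 Q x y q1 q2 ->
  dif2 (fun z w => Hf u v (P z w) (Q z w)) x y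
    (kap u / P x y * p1 - v / Q x y ^+ 2 * q1) (kap u / P x y * p2 - v / Q x y ^+ 2 * q2).
Proof.
have [d d0 dP] := dif_clog_near1 R; exists (Num.min d 1); first by rewrite lt_min d0 ltr01.
move=> u v P Q x y p1 p2 q1 q2; rewrite lt_min => /andP[/dP dl h1] Q0 DP DQ.
have P0 : P x y != 0.
  by apply: contraTneq h1 => ->; rewrite mul0r sub0r nmN nm1 ltxx.
have D1 := dif2_mulf (dif2_cst v x y) (dif2_comp DQ (dif_inv Q0)).
have D2 := dif2_mulf (dif2_cst (kap u) x y)
  (@dif2_comp _ (@clog R) _ _ _ _ _ _ (dif2_mulf DP (dif2_cst z0^-1 x y)) dl).
have := dif2_addf D1 D2; congr (dif2 _ _ _ _ _); field; rewrite ?P0 ?Q0 ?z00 //.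
Qed.

Lemma near0_cts (f : C -> C -> C) e : hol2 f z0 0 -> 0 < e ->
  near0 z0 (fun z y => nm (f z y - f z0 0) <= e).
Proof.
move=> /hol2_cts h e0; have [d d0 dP] := h e e0; exists d => // z y zd yd.
by apply: dP => //; rewrite subr0.
Qed.

Lemma near0_at (P : C -> C -> Prop) : near0 z0 P -> P z0 0.
Proof. by move=> [r r0]; apply; rewrite ?subrr ?nm0. Qed.

Variables (a b : nat -> C -> C).
Hypothesis ab : formal_coefs a b.

Local Notation T1 N := (fun z y : C => (trunc a b N (z, y)).1).
Local Notation T2 N := (fun z y : C => (trunc a b N (z, y)).2).

Lemma trunc_near N d : 0 < d -> near0 z0 (fun z y =>
  [/\ hol2 (T1 N) z y, hol2 (T2 N) z y, nm (T1 N z y / z0 - 1) < d &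
      nm y / 2 <= nm (T2 N z y)]).
Proof.
move=> d0; have [A [B [AB TA TB _]]] := trunc_data z00 ab N.
have hT1 z y : hol2 A z y -> hol2 (T1 N) z y.
  move=> hA; have -> : T1 N = fun z y => z + y * A z y.
    by apply/funext => t; apply/funext => w; rewrite TA.
  by apply: hol2_add (hol2_fst _ _) (hol2_mul (hol2_snd _ _) hA).
have hT2 z y : hol2 B z y -> hol2 (T2 N) z y.
  move=> hB; have -> : T2 N = fun z y => y + y ^+ 2 * B z y.
    by apply/funext => t; apply/funext => w; rewrite TB.
  by apply: hol2_add (hol2_snd _ _) (hol2_mul (hol2_expn 2 (hol2_snd _ _)) hB).
have hq : hol2 (fun z y => T1 N z y / z0) z0 0.
  by apply: hol2_mul (hol2_cst _ _ _); apply: hT1; have [] := near0_at AB.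
have nB : near0 z0 (hol2 B) by apply: near0_imp AB => z y [].
have [K HK] := near0_bounded nB.
have K1 : 0 < 2 * (`|K| + 1) by rewrite mulr_gt0 // ltr_wpDl.
have d2 : 0 < d / 2 by rewrite divr_gt0.
have hK : 0 < (2 * (`|K| + 1))^-1 by rewrite invr_gt0.
apply: near0_imp (near0_and AB (near0_and HK (near0_and (near0_cts hq d2)
  (near0_ball z0 hK)))) => z y [[hA hB] [BK [c [_ yr]]]].
split; [exact: hT1 | exact: hT2 | |].
  by move: c; rewrite !TA mul0r addr0 divff //; lra.
rewrite TB; have := nm_sub y (- (y ^+ 2 * B z y)); rewrite opprK nmN nmM nmX.
have yK : nm y * nm (B z y) <= 1 / 2.
  apply: (@le_trans _ _ (nm y * (`|K| + 1))).
    by rewrite ler_wpM2l ?nm_ge0 // (le_trans BK) // (le_trans (ler_norm K)) // lerDl.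
  rewrite -ler_pdivlMr; last by rewrite ltr_wpDl.
  by apply: (le_trans (ltW yr)); rewrite invfM mul1r.
by have := nm_ge0 y; nra.
Qed.

(** [G] is what remains of the first integral of the N-truncation once v / y is removed: v / (y +
    y^2 B) = v / y - v B / (1 + y B). The pulled back form is d (v / y + G). *)
Lemma GN_data u v N : (2 <= N)%N -> exists G : C -> C -> C,
  [/\ near0 z0 (hol2 G),
      near0 z0 (fun z y => y != 0 -> Hf u v (T1 N z y) (T2 N z y) = v / y + G z y),
      forall z, G z 0 = - v * b 2 z + kap u * clog (z / z0) &
      near0 z0 (fun z y => y != 0 -> pullback (trunc a b N) (pencil tau u v) (z, y) =
        (d1 G z y, d2 G z y - v / y ^+ 2))].
Proof.
move=> N2; have [A [B [AB TA TB B0]]] := trunc_data z00 ab N.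
have [d d0 dP] := dif2_Hf; have [d' d'0 dP'] := dif_clog_near1 R.
have dd : 0 < Num.min 1 (Num.min d d') by rewrite !lt_min ltr01 d0.
pose G z y := - v * B z y / (1 + y * B z y) + kap u * clog (T1 N z y / z0).
have TN := trunc_near N dd.
have hG : near0 z0 (fun z y => hol2 G z y /\ (y != 0 -> 1 + y * B z y != 0)).
  have ho : hol2 (fun z y => 1 + y * B z y) z0 0.
    apply: hol2_add (hol2_cst _ _ _) (hol2_mul (hol2_snd _ _) _).
    by have [] := near0_at AB.
  apply: near0_imp (near0_and (near0_and AB TN)
    (near0_cts ho (e := 1 / 2) ltac:(by rewrite divr_gt0))).
  move=> z y [[[hA hB] [h1 h2 h3 h4]] c].
  have nz : 1 + y * B z y != 0.
    rewrite -nm_gt0; move: c; rewrite mul0r addr0 nmBC => c.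
    by have := nm_sub 1 (1 + y * B z y); rewrite nm1; lra.
  split=> //; apply: hol2_add.
    apply: hol2_mul; first by apply: hol2_mul (hol2_cst _ _ _) hB.
    by apply: hol2_inv => //; apply: hol2_add (hol2_cst _ _ _) (hol2_mul (hol2_snd _ _) hB).
  apply: hol2_mul (hol2_cst _ _ _) _.
  apply: (@hol2_comp _ (@clog R) (fun z y => T1 N z y / z0)).
    by apply: hol2_mul h1 (hol2_cst _ _ _).
  by eexists; apply: dP'; apply: lt_le_trans h3 _; rewrite !ge_min lexx !orbT.
have hE : near0 z0 (fun z y => y != 0 -> Hf u v (T1 N z y) (T2 N z y) = v / y + G z y).
  apply: near0_imp hG => z y [_ nz] y0; rewrite /Hf /G addrA; congr (_ + _).
  have -> : T2 N z y = y * (1 + y * B z y) by rewrite TB; ring.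
  by have nz' := nz y0; field; rewrite y0 nz'.
exists G; split.
- by apply: near0_imp hG => z y [].
- exact: hE.
- by move=> z; rewrite /G TA B0 // !mul0r !addr0 divr1.
have [r r0 Hr] := near0_and hE (near0_and TN hG).
exists (r / 2); first by rewrite divr_gt0.
move=> z y zr yr y0.
have [E [[h1 h2 h3 h4] [hGz _]]] := Hr z y ltac:(lra) ltac:(lra).
have ny : 0 < nm y by rewrite nm_gt0.
have T20 : T2 N z y != 0 by rewrite -nm_gt0; lra.
have [A1 B1] : 'D_(1, 0) (fst \o trunc a b N) (z, y) = d1 (T1 N) z y /\
    'D_(0, 1) (fst \o trunc a b N) (z, y) = d2 (T1 N) z y.
  exact: derive_dif2 (dif2_d h1).
have [A2 B2] : 'D_(1, 0) (snd \o trunc a b N) (z, y) = d1 (T2 N) z y /\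
    'D_(0, 1) (snd \o trunc a b N) (z, y) = d2 (T2 N) z y.
  exact: derive_dif2 (dif2_d h2).
have D1 := dP u v (T1 N) (T2 N) z y _ _ _ _ (lt_le_trans h3 _) T20 (dif2_d h1) (dif2_d h2).
have {}D1 := D1 ltac:(by rewrite !ge_min lexx !orbT).
have D2 := dif2_addf (dif2_mulf (dif2_cst v z y) (dif2_comp (dif2_snd z y) (dif_inv y0)))
  (dif2_d hGz).
have rd : 0 < Num.min (r / 2) (nm y) by rewrite lt_min divr_gt0.
have H z' y' : nm (z' - z) < Num.min (r / 2) (nm y) -> nm (y' - y) < Num.min (r / 2) (nm y) ->
    v / y' + G z' y' = Hf u v (T1 N z' y') (T2 N z' y').
  rewrite !lt_min => /andP[z1 _] /andP[y1 y2]; symmetry; apply: (Hr z' y' _ _).1.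
  - by have := nm_tri z z' z0; lra.
  - by have := nmD (y' - y) y; rewrite subrK; lra.
  by apply: contraTneq y2 => ->; rewrite sub0r nmN ltxx.
have D3 := @dif2_ext _ (fun z y => v / y + G z y)
  (fun z w => Hf u v (T1 N z w) (T2 N z w)) z y _ _ _ rd H D2.
have [e1 e2] := dif2_unique D1 D3.
have T10 : T1 N z y != 0.
  apply: contraTneq h3 => ->; rewrite mul0r sub0r nmN nm1 -leNgt.
  by rewrite ge_min lexx.
have -> : d1 G z y = kap u / T1 N z y * d1 (T1 N) z y - v / T2 N z y ^+ 2 * d1 (T2 N) z y.
  by rewrite e1; ring.
have -> : d2 G z y - v / y ^+ 2 =
    kap u / T1 N z y * d2 (T1 N) z y - v / T2 N z y ^+ 2 * d2 (T2 N) z y.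
  by rewrite e2; ring.
rewrite /pullback A1 A2 B1 B2; move: T10 T20; rewrite /pencil /omega0 /omegaoo /kap.
set t1 := (trunc a b N (z, y)).1; set t2 := (trunc a b N (z, y)).2 => T10 T20.
have tt := twopii_neq0; rewrite /= /GRing.scale /=.
by congr pair; field; rewrite T10 T20 tt tau0.
Qed.

End FirstIntegrals.

(** * Estimates on the sectorial normalizations and their first integrals *)

Section Normalizations.
Variable R : realType.
Local Notation C := R[i].
Local Notation nm := (@nm R).
Local Notation C2 := (C * C)%type.

Variables (varpi : R) (tau z0 : C) (a b : nat -> C -> C) (phi : 'Z_4 -> C2 -> C2)
  (Psi : 'Z_4 -> C2 -> C2).
Hypotheses (z00 : z0 != 0) (tau0 : tau != 0) (ab : formal_coefs a b)
  (SD : sector_data varpi z0 tau a b phi Psi).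

Definition P1 i (z y : C) := (Psi i (z, y)).1.
Definition P2 i (z y : C) := (Psi i (z, y)).2.
Definition H u v i (z y : C) : C := Hf tau z0 u v (P1 i z y) (P2 i z y).

Local Notation ev := (ev varpi z0).
Local Notation T1 N := (fun z y : C => (trunc a b N (z, y)).1).
Local Notation T2 N := (fun z y : C => (trunc a b N (z, y)).2).

Lemma psi_near i s d : 0 < s -> 0 < d -> ev i s (fun z y =>
  [/\ hol2 (P1 i) z y, hol2 (P2 i) z y, nm (P1 i z y / z0 - 1) < d,
      nm y / 4 <= nm (P2 i z y) & y != 0]).
Proof.
move=> s0 d0; have [S1 S2 _] := SD.
have n0 : 0 < nm z0 by rewrite nm_gt0.
have [M HM] := S2 i s 1%N s0; have d2 : 0 < d / 2 by rewrite divr_gt0.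
pose L := `|M| + 1; have L0 : 0 < L by rewrite ltr_wpDl.
have ML : M <= L by rewrite (le_trans (ler_norm M)) // lerDl.
pose r := Num.min 1 (Num.min (1 / (4 * L)) (d * nm z0 / (4 * L))).
have r0 : 0 < r by rewrite !lt_min ltr01 !divr_gt0 ?mulr_gt0.
apply: ev_imp (ev_and (ev_and (S1 i s s0) HM) (ev_and (near0_ev varpi i s
  (near0_and (trunc_near z00 ab 1 d2) (near0_ball z0 r0))) (ev_sec varpi z0 i (ltW s0)))).
move=> z y [[[h1 h2] [m1 m2]] [[[_ _ t1 t2] [_ yr]] y0]].
move: yr; rewrite !lt_min => /andP[y1 /andP[yL yd]].
have ny := nm_ge0 y; cbv beta in t1, t2, m1, m2.
have LyN : L * nm y <= 1 / 4.
  rewrite mulrC -ler_pdivlMr //; apply: (le_trans (ltW yL)).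
  by rewrite le_eqVlt; apply/orP; left; apply/eqP; field; rewrite gt_eqF.
have Lyd : L * nm y <= d * nm z0 / 4.
  rewrite mulrC -ler_pdivlMr //; apply: (le_trans (ltW yd)).
  by rewrite le_eqVlt; apply/orP; left; apply/eqP; field; rewrite gt_eqF.
have My : M * nm y ^+ 2 <= L * nm y * nm y.
  by rewrite expr2 -mulrA ler_wpM2r ?mulr_ge0.
split=> //.
- rewrite /P1; have -> : (Psi i (z, y)).1 / z0 - 1 =
      ((Psi i (z, y)).1 - (trunc a b 1 (z, y)).1) / z0 +
      ((trunc a b 1 (z, y)).1 / z0 - 1) by rewrite mulrBl addrA subrK.
  apply: (le_lt_trans (nmD _ _)); rewrite nmM nmV.
  have : nm ((Psi i (z, y)).1 - (trunc a b 1 (z, y)).1) / nm z0 <= d / 4.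
    rewrite ler_pdivrMr //; apply: (le_trans m1); apply: (le_trans My).
    apply: (@le_trans _ _ (L * nm y)); last by lra.
    by rewrite ler_piMr ?mulr_ge0 // ltW.
  by move: t1 => {m2 t2}; lra.
- rewrite /P2; have := nm_sub ((trunc a b 1 (z, y)).2) (Psi i (z, y)).2; rewrite nmBC.
  by move: t2 m2 My; nra.
Qed.

(** The inverse 1 / q costs two powers of y, because |1 / q - 1 / t'| is |q - t'| over a product of
    size |y|^2. Hence the truncation of order n + 2, with error y^(n + 3), leaves y^(n + 1). *)
Lemma H_est u v i s n (G : C -> C -> C) : 0 < s ->
  near0 z0 (hol2 G) ->
  near0 z0 (fun z y => y != 0 -> Hf tau z0 u v (T1 n.+2 z y) (T2 n.+2 z y) = v / y + G z y) ->
  exists K, ev i s (fun z y => hol2 (H u v i) z y /\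
    nm (H u v i z y - (v / y + G z y)) <= K * nm y ^+ n.+1).
Proof.
move=> s0 hG GE; have [S1 S2 _] := SD.
have [d d0 dP] := clog_lip R; have [d' d'0 dP'] := dif2_Hf tau z00.
have dd : 0 < Num.min d d' by rewrite lt_min d0.
have [M HM] := S2 i s n.+2 s0.
have n0 : 0 < nm z0 by rewrite nm_gt0.
exists (nm v * 8 * `|M| + nm (kap tau u) * (4 / nm z0) * `|M|).
apply: ev_imp (ev_and (ev_and (psi_near i s0 dd) HM) (near0_ev varpi i s
  (near0_and (near0_and GE (trunc_near z00 ab n.+2 d0)) (near0_ball z0 ltr01)))).
move=> z y [[[h1 h2]]]; rewrite lt_min => /andP[pd pd'] p2 y0 [m1 m2].
move=> [[/(_ y0) E [_ _ t1 t2]] [_ y1]].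
have ny : 0 < nm y by rewrite nm_gt0.
have p20 : 0 < nm (P2 i z y) by lra.
have p2n : P2 i z y != 0 by rewrite -nm_gt0.
have t20 : 0 < nm (T2 n.+2 z y) by lra.
have t2n : T2 n.+2 z y != 0 by rewrite -nm_gt0.
split.
  by do 2 eexists; apply: (dP' _ _ _ _ _ _ _ _ _ _ pd' p2n (dif2_d h1) (dif2_d h2)).
rewrite -E /H /Hf.
set p := P1 i z y in m1 pd *; set q := P2 i z y in m2 p2 p20 p2n *.
move: m1 m2 t1 t2 t20 t2n; set t := (trunc a b _ _).1; set t' := (trunc a b _ _).2.
move=> m1 m2 t1 t2 t20 t2n.
have -> : v / q + kap tau u * clog (p / z0) - (v / t' + kap tau u * clog (t / z0)) =
   - v * ((q - t') / (q * t')) + kap tau u * (clog (p / z0) - clog (t / z0)).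
  by field; rewrite p2n t2n.
have yk : 0 <= nm y ^+ n.+1 by rewrite exprn_ge0 // ltW.
have y3 : M * nm y ^+ n.+3 <= `|M| * nm y ^+ n.+3.
  by rewrite ler_wpM2r ?ler_norm // exprn_ge0 // ltW.
have yE : nm y ^+ n.+3 = nm y ^+ 2 * nm y ^+ n.+1 by rewrite -exprD.
have B1 : nm ((q - t') / (q * t')) <= 8 * `|M| * nm y ^+ n.+1.
  rewrite nmM nmV nmM ler_pdivrMr; last exact: mulr_gt0.
  apply: (le_trans m2); apply: (le_trans y3).
  have qt : nm y / 4 * (nm y / 2) <= nm q * nm t'.
    by apply: ler_pM => //; lra.
  apply: (@le_trans _ _ (8 * `|M| * nm y ^+ n.+1 * (nm y / 4 * (nm y / 2)))).
    by rewrite le_eqVlt; apply/orP; left; apply/eqP; rewrite yE; field.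
  by rewrite ler_wpM2l // mulr_ge0 // mulr_ge0.
have B2 : nm (clog (p / z0) - clog (t / z0)) <= 4 / nm z0 * `|M| * nm y ^+ n.+1.
  apply: (le_trans (dP _ _ pd t1)); rewrite -mulrBl nmM nmV.
  have : nm (p - t) <= `|M| * nm y ^+ n.+1.
    apply: (le_trans m1); apply: (le_trans y3); rewrite ler_wpM2l // yE ler_piMl //.
    by rewrite expr_le1 // ltW.
  move=> h; have -> : 4 / nm z0 * `|M| * nm y ^+ n.+1 = 4 * (`|M| * nm y ^+ n.+1 / nm z0).
    by ring.
  by rewrite ler_wpM2l // ler_wpM2r // invr_ge0 ltW.
apply: (le_trans (nmD _ _)); rewrite (nmM (- v)) (nmM (kap tau u)) nmN.
have -> : (nm v * 8 * `|M| + nm (kap tau u) * (4 / nm z0) * `|M|) * nm y ^+ n.+1 =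
  nm v * (8 * `|M| * nm y ^+ n.+1) + nm (kap tau u) * (4 / nm z0 * `|M| * nm y ^+ n.+1).
  by ring.
by apply: lerD; apply: ler_wpM2l => //; exact: nm_ge0.
Qed.

Lemma H01 i z y : H 0 1 i z y = (P2 i z y)^-1.
Proof. by rewrite /H /Hf /kap !mul0r addr0 mul1r. Qed.

(** The case [u : v] = [0 : 1] of [H_est]: by [H01], [H] is then the coordinate xi of Psi_i. *)
Lemma xi_bound i s : 0 < s -> exists K, ev i s (fun z y => nm ((P2 i z y)^-1 - y^-1) <= K).
Proof.
move=> s0; have [//|G [hG GE _ _]] := @GN_data _ tau z0 z00 tau0 a b ab 0 1 2.
have [K HK] := H_est i s0 hG GE; have [K' HK'] := near0_bounded hG.
exists (`|K| + K').
apply: ev_imp (ev_and HK (near0_ev varpi i s (near0_and HK' (near0_ball z0 ltr01)))).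
move=> z y [[_]]; rewrite H01 expr1 mul1r => B1 [B2 [_ y1]].
have -> : (P2 i z y)^-1 - y^-1 = ((P2 i z y)^-1 - (y^-1 + G z y)) + G z y by ring.
apply: (le_trans (nmD _ _)).
have : K * nm y <= `|K| * 1.
  by have := nm_ge0 y; have := ler_norm K; have := normr_ge0 K; nra.
lra.
Qed.

(** Both coordinates xi have the expansion 1 / y + G z y up to O(y). This removes the integer
    ambiguity of xi when only e^(2 i pi xi) is known. *)
Lemma xi_close i j s d : 0 < s -> 0 < d -> exists2 r, 0 < r & forall z y,
  Reg varpi z0 i s r z y -> Reg varpi z0 j s r z y ->
  nm ((P2 i z y)^-1 - (P2 j z y)^-1) < d.
Proof.
move=> s0 d0; have [//|G [hG GE _ _]] := @GN_data _ tau z0 z00 tau0 a b ab 0 1 2.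
have [K [r r0 HK]] := H_est i s0 hG GE; have [K' [r' r'0 HK']] := H_est j s0 hG GE.
pose L := `|K| + `|K'| + 1; have L0 : 0 < L by rewrite ltr_wpDl // addr_ge0.
exists (Num.min (Num.min r r') (d / L)); first by rewrite !lt_min r0 r'0 divr_gt0.
move=> z y h1 h2; have /and3P[_ yL _] := h1; rewrite !lt_min in yL.
have /andP[_ {}yL] := yL.
have [|_ A] := HK z y; first by apply: Reg_mono h1 => //; rewrite !ge_min lexx.
have [|_ B] := HK' z y; first by apply: Reg_mono h2 => //; rewrite !ge_min lexx orbT.
move: A B; rewrite !H01 !expr1 mul1r (nmBC (P2 j z y)^-1) => A B.
apply: (le_lt_trans (nm_tri (y^-1 + G z y) _ _)).
rewrite ltr_pdivlMr // in yL; have ny := nm_ge0 y.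
have := ler_norm K; have := ler_norm K'; rewrite /L in yL; nra.
Qed.

Definition XX i z y : C := cexp (twopii R * (P2 i z y)^-1).
Definition YY i z y : C := P1 i z y * cexp (twopii R * tau * (P2 i z y)^-1).

Lemma PiE i z y : PiXY tau (Psi i (z, y)) = (XX i z y, YY i z y).
Proof. by []. Qed.

End Normalizations.

(** * Comparison of normalizations on overlaps *)

Section Overlaps.
Variable R : realType.
Local Notation C := R[i].
Local Notation nm := (@nm R).
Local Notation C2 := (C * C)%type.

Lemma expRN_small (K c d : R) : 0 < c -> 0 < d -> exists2 r, 0 < r &
  forall y : C, y != 0 -> nm y < r -> K * expR (- (c / nm y)) < d.
Proof.
move=> c0 d0; pose L := `|K| + 1; have L0 : 0 < L by rewrite ltr_wpDl.
exists (d * c / L); first by rewrite divr_gt0 // mulr_gt0.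
move=> y y0 yr; have ny : 0 < nm y by rewrite nm_gt0.
have t0 : 0 < c / nm y by rewrite divr_gt0.
have e1 : expR (- (c / nm y)) <= nm y / c.
  rewrite expRN -[nm y / c]invf_div lef_pV2 ?posrE ?expR_gt0 //.
  by have := expR_ge1Dx (c / nm y); lra.
apply: (@le_lt_trans _ _ (L * expR (- (c / nm y)))).
  by rewrite ler_wpM2r ?expR_ge0 // (le_trans (ler_norm K)) // lerDl.
apply: (@le_lt_trans _ _ (L * (nm y / c))); first by rewrite ler_wpM2l // ltW.
by rewrite mulrA ltr_pdivrMr // mulrC -ltr_pdivlMr.
Qed.

Lemma nm_cexp_twopii (w : C) : nm (cexp (twopii R * w)) = expR (- (2 * pi * complex.Im w)).
Proof. by rewrite nm_cexp cReM /= mul0r sub0r. Qed.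

(** On the sector, e^(-i a) / y has imaginary part at least s / |y|. Replacing 1 / y by a coordinate
    [x] at bounded distance costs only a constant factor. *)
Lemma cexp_sec (p : R) a s K (x y : C) : 0 < p -> 0 <= s -> sec a s y -> nm (x - y^-1) <= K ->
  nm (cexp (twopii R * (p%:C * cis (- a) * x))) <=
    expR (2 * pi * p * K) * expR (- (2 * pi * p * s / nm y)).
Proof.
move=> p0 s0 h xy; have y0 := sec_neq0 s0 h; have ny : 0 < nm y by rewrite nm_gt0.
rewrite nm_cexp_twopii -expRD ler_expR.
have A : s / nm y <= complex.Im (cis (- a) * y^-1).
  by rewrite ler_pdivrMr // ltW.
have B : - K <= complex.Im (cis (- a) * (x - y^-1)).
  have := Im_le_nm (cis (- a) * (x - y^-1)); rewrite nmM nm_cis mul1r ler_norml.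
  by case/andP => h1 _; lra.
have -> : p%:C * cis (- a) * x = p%:C * (cis (- a) * y^-1 + cis (- a) * (x - y^-1)) by ring.
rewrite (cImM _%:C) /= mul0r addr0 cImD.
have q0 : 0 < 2 * pi * p by rewrite !mulr_gt0 // pi_gt0.
set q := 2 * pi * p in q0 *; set I1 := complex.Im _ in A *; set I2 := complex.Im _ in B *.
have -> : 2 * pi * (p * (I1 + I2)) = q * (I1 + I2) by rewrite /q; ring.
have -> : q * s / nm y = q * (s / nm y) by ring.
by nra.
Qed.

Lemma Im0_small (z w : C) : nm (z - w) <= 1 -> cexp z = cexp w -> z = w.
Proof.
move=> zw E; apply/eqP; rewrite -subr_eq0; apply/eqP; apply: cexp_eq1.
  by apply: le_lt_trans (Im_le_nm _) _; have := pi_ge2 R; lra.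
by rewrite cexpD cexpNV E divff // cexp_neq0.
Qed.

Lemma corner_chart_inj i (p q : C2) : corner_chart i p = corner_chart i q -> p = q.
Proof.
case: p q => [p1 p2] [q1 q2]; rewrite /corner_chart.
elim/Z4_ind: i => /=; first by case=> -> ->.
- by case=> A ->; rewrite (invr_inj A).
- by case=> A B; rewrite (invr_inj A) (invr_inj B).
by case=> -> B; rewrite (invr_inj B).
Qed.

Variables (varpi : R) (tau z0 : C) (a b : nat -> C -> C) (phi : 'Z_4 -> C2 -> C2)
  (Psi : 'Z_4 -> C2 -> C2).
Hypotheses (z00 : z0 != 0) (tau0 : tau != 0) (ab : formal_coefs a b)
  (SD : sector_data varpi z0 tau a b phi Psi)
  (tauE : tau = (nm tau)%:C * cis varpi).

Local Notation XX := (XX Psi).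
Local Notation YY := (YY tau Psi).
Local Notation P1 := (P1 Psi).
Local Notation P2 := (P2 Psi).
Local Notation Reg := (Reg varpi z0).

(* The coordinate of P^1 x P^1 that is small on the sector i. *)
Definition cc (i k : 'Z_4) (z y : C) : C := match nat_of_ord i with
  | 1 => YY k z y | 2 => (XX k z y)^-1 | 3 => (YY k z y)^-1 | _ => XX k z y end.

Lemma corner_cc i k z y : corner_chart i (XX k z y, YY k z y) =
  if odd i then (cc (i + 1) k z y, cc i k z y) else (cc i k z y, cc (i + 1) k z y).
Proof. by elim/Z4_ind: i. Qed.

(** For i = 0, 1, 2, 3 the number e^(-i a), with a the first side of the sector, is 1, tau / |tau|,
    -1 and - tau / |tau|. So [cexp_sec] applies to X, Y, 1 / X and 1 / Y, the component along z
    being bounded above and below. *)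
Lemma cc_small i k s : 0 < s -> exists K c, 0 < c /\ exists2 r, 0 < r & forall z y,
  Reg i s r z y -> Reg k s r z y -> nm (cc i k z y) <= K * expR (- (c / nm y)).
Proof.
move=> s0; have [K [r1 r10 H1]] := xi_bound z00 tau0 ab SD k s0.
have [r2 r20 H2] := psi_near z00 ab SD k s0 (d := 1 / 2) ltac:(by rewrite divr_gt0).
have nt : 0 < nm tau by rewrite nm_gt0.
have n0 : 0 < nm z0 by rewrite nm_gt0.
have pi0 := pi_gt0 R.
have r0 : 0 < Num.min r1 r2 by rewrite lt_min r10.
have get z y : Reg k s (Num.min r1 r2) z y -> [/\ nm ((P2 k z y)^-1 - y^-1) <= K,
    nm (P1 k z y) <= 2 * nm z0 & nm (P1 k z y)^-1 <= 2 / nm z0].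
  move=> h; have [|_ _ h1 _ _] := H2 z y; first by apply: Reg_mono h; rewrite ?ge_min ?lexx ?orbT.
  have E : P1 k z y = P1 k z y / z0 * z0 by rewrite divfK.
  have h2 := nmD (P1 k z y / z0 - 1) 1; rewrite subrK nm1 in h2.
  have h3 := nm_sub 1 (P1 k z y / z0); rewrite nm1 nmBC in h3.
  have e1 : nm (P1 k z y) = nm (P1 k z y / z0) * nm z0 by rewrite {1}E nmM.
  split; first by apply: H1; apply: Reg_mono h; rewrite ?ge_min ?lexx.
    by rewrite e1 ler_pM2r //; lra.
  have nP : nm z0 / 2 <= nm (P1 k z y).
    by rewrite e1 [nm z0 / 2]mulrC ler_pM2r //; lra.
  have nz2 : 0 < nm z0 / 2 by rewrite divr_gt0.
  by rewrite nmV -[2 / nm z0]invf_div lef_pV2 ?posrE // (lt_le_trans nz2).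
have cos2 : cis (- (- pi)) = -1 :> C by rewrite opprK -[pi]add0r cisDpi cis0.
elim/Z4_ind: i.
- exists (expR (2 * pi * 1 * K)), (2 * pi * 1 * s); split; first by rewrite !mulr_gt0.
  exists (Num.min r1 r2) => // z y /and3P[_ _ h] /get[xK _ _].
  have := cexp_sec ltr01 (ltW s0) h xK; rewrite /ang /= addNr oppr0 cis0 !mul1r.
  by rewrite /cc /=.
- exists (2 * nm z0 * expR (2 * pi * nm tau * K)), (2 * pi * nm tau * s).
  split; first by rewrite !mulr_gt0.
  exists (Num.min r1 r2) => // z y /and3P[_ _ h] /get[xK pK _].
  have := cexp_sec nt (ltW s0) h xK; rewrite /ang /= opprK -tauE mulrA => B.
  by rewrite /cc /= /YY nmM -[X in _ <= X]mulrA; apply: ler_pM; rewrite ?nm_ge0.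
- exists (expR (2 * pi * 1 * K)), (2 * pi * 1 * s); split; first by rewrite !mulr_gt0.
  exists (Num.min r1 r2) => // z y /and3P[_ _ h] /get[xK _ _].
  have := cexp_sec ltr01 (ltW s0) h xK; rewrite /ang /= cos2 mul1r mulN1r mulrN cexpNV.
  by rewrite /cc /=.
exists (2 / nm z0 * expR (2 * pi * nm tau * K)), (2 * pi * nm tau * s).
split; first by rewrite !mulr_gt0.
exists (Num.min r1 r2) => // z y /and3P[_ _ h] /get[xK _ pK].
have := cexp_sec nt (ltW s0) h xK; rewrite /ang /=.
have -> : cis (- (- varpi + pi)) = - cis varpi :> C.
  by rewrite [in RHS](_ : varpi = - (- varpi + pi) + pi) ?cisDpi ?opprK //; ring.
rewrite mulrN -tauE mulNr mulrN cexpNV mulrA => B.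
by rewrite /cc /= /YY invfM nmM -[X in _ <= X]mulrA; apply: ler_pM; rewrite ?nm_ge0.
Qed.

Lemma chart_small i k s d : 0 < s -> 0 < d -> (k = i \/ k = i + 1) -> exists2 r, 0 < r &
  forall z y, Reg i s r z y -> Reg (i + 1) s r z y ->
  nm (corner_chart i (XX k z y, YY k z y)).1 < d /\
  nm (corner_chart i (XX k z y, YY k z y)).2 < d.
Proof.
move=> s0 d0 ki; have [K [c [c0 [r r0 H]]]] := cc_small i k s0.
have [K' [c' [c'0 [r' r'0 H']]]] := cc_small (i + 1) k s0.
have [q q0 Q] := expRN_small K c0 d0; have [q' q'0 Q'] := expRN_small K' c'0 d0.
exists (Num.min (Num.min r r') (Num.min q q')); first by rewrite !lt_min r0 r'0 q0.
move=> z y h h'; have y0 : y != 0 by case/and3P: h => _ _; apply: sec_neq0; exact: ltW.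
have yq : nm y < q /\ nm y < q'.
  by case/and3P: h => _; rewrite !lt_min => /andP[_ /andP[]].
have hk : Reg k s (Num.min (Num.min r r') (Num.min q q')) z y by case: ki => ->.
have A : nm (cc i k z y) < d.
  apply: le_lt_trans (Q y y0 yq.1); apply: H.
    by apply: Reg_mono h; rewrite // !ge_min lexx.
  by apply: Reg_mono hk; rewrite // !ge_min lexx.
have B : nm (cc (i + 1) k z y) < d.
  apply: le_lt_trans (Q' y y0 yq.2); apply: H'.
    by apply: Reg_mono h'; rewrite // !ge_min lexx ?orbT.
  by apply: Reg_mono hk; rewrite // !ge_min lexx ?orbT.
by rewrite corner_cc; case: odd.
Qed.

(** A trivial cocycle says that Psi_i and Psi_(i+1) have the same image under [PiXY]. This fixes xi
    only modulo integers; [xi_close] excludes a nonzero one, and then equality of Y gives equality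
    of z. *)
Lemma overlap_id i s : 0 < s -> (\forall p \near (0 : C2), phi i p = p) ->
  exists2 r, 0 < r & forall z y, Reg i s r z y -> Reg (i + 1) s r z y ->
    Psi i (z, y) = Psi (i + 1) (z, y).
Proof.
move=> s0 /near_C2P[d d0 phiP]; have [_ _ /(_ i s s0)[r1 r10 S3]] := SD.
have [r2 r20 small] := chart_small s0 d0 (or_intror (erefl (i + 1))).
have pi0 := pi_gt0 R.
have e0 : 0 < (2 * pi)^-1 :> R by rewrite invr_gt0 mulr_gt0.
have [r3 r30 close] := xi_close z00 tau0 ab SD i (i + 1) s0 e0.
have [r4 r40 N1] := psi_near z00 ab SD i s0 ltr01.
have [r5 r50 N2] := psi_near z00 ab SD (i + 1) s0 ltr01.
pose r := Num.min (Num.min r1 r2) (Num.min r3 (Num.min r4 r5)).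
exists r; first by rewrite !lt_min r10 r20 r30 r40.
move=> z y h h'.
have [[q1 q2] [q3 [q4 q5]]] : (r <= r1 /\ r <= r2) /\ (r <= r3 /\ (r <= r4 /\ r <= r5)).
  by rewrite !ge_min !lexx !orbT.
have M j (rj : R) : r <= rj -> Reg j s r z y -> Reg j s rj z y.
  by move=> rr; apply: Reg_mono.
have E := S3 z y (M _ _ q1 h) (M _ _ q1 h').
have [A B] := small z y (M _ _ q2 h) (M _ _ q2 h').
have EE : corner_chart i (XX i z y, YY i z y) = corner_chart i (XX (i + 1) z y, YY (i + 1) z y).
  rewrite -!PiE E PiE; move: A B; case: (corner_chart i _) => p q /= A B.
  by apply: phiP; rewrite subr0.
have EX : XX i z y = XX (i + 1) z y := congr1 fst (corner_chart_inj EE).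
have EY : YY i z y = YY (i + 1) z y := congr1 snd (corner_chart_inj EE).
have xi : (P2 i z y)^-1 = (P2 (i + 1) z y)^-1.
  apply: (mulfI (twopii_neq0 R)); apply: Im0_small; last exact: EX.
  rewrite -mulrBr nmM (_ : nm (twopii R) = 2 * pi); last first.
    have -> : twopii R = 'i * (2 * pi)%:C by apply: complex_eq => /=; ring.
    by rewrite nmM nmi mul1r nmR gtr0_norm // mulr_gt0.
  rewrite mulrC -ler_pdivlMr ?mulr_gt0 // div1r.
  by apply: ltW; apply: close; exact: M.
have [_ _ _ _ _] := N1 z y (M _ _ q4 h).
have eP2 := invr_inj xi.
have eP1 : P1 i z y = P1 (i + 1) z y.
  by move: EY; rewrite /YY xi => /mulIf; apply; exact: cexp_neq0.
by move: eP1 eP2; rewrite /P1 /P2; case: (Psi i _) => p q; case: (Psi (i + 1) _) => p' q' /= -> ->.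
Qed.

End Overlaps.

(** * Jump of the first integral at the nontrivial corner *)

Section Jump.
Variable R : realType.
Local Notation C := R[i].
Local Notation nm := (@nm R).
Local Notation C2 := (C * C)%type.

Variables (varpi : R) (tau z0 : C) (a b : nat -> C -> C) (phi : 'Z_4 -> C2 -> C2)
  (Psi : 'Z_4 -> C2 -> C2) (u0 v0 : C).
Hypotheses (z00 : z0 != 0) (tau0 : tau != 0) (ab : formal_coefs a b)
  (SD : sector_data varpi z0 tau a b phi Psi)
  (tauE : tau = (nm tau)%:C * cis varpi)
  (phi41 : \forall p \near (0 : C2),
     phi 4 (phi14 (tau * (v0 - u0)) u0 p) = p /\
     phi14 (tau * (v0 - u0)) u0 (phi 4 p) = p).

Local Notation XX := (XX Psi).
Local Notation YY := (YY tau Psi).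
Local Notation P1 := (P1 Psi).
Local Notation P2 := (P2 Psi).
Local Notation Reg := (Reg varpi z0).

(* The exponents of phi_(1,4) are multiples of this logarithm, evaluated at Psi_0. *)
Definition ell (z y : C) : C := clog (1 + XX 0 z y * YY 0 z y * cexp (YY 0 z y)).

Lemma hol2_XX k z y : hol2 (P2 k) z y -> P2 k z y != 0 -> hol2 (XX k) z y.
Proof.
move=> h h0; apply: (@hol2_comp _ (@cexp R) (fun z y => twopii R * (P2 k z y)^-1)).
  by apply: hol2_mul (hol2_cst _ _ _) (hol2_inv h h0).
by eexists; exact: dif_cexp.
Qed.

Lemma hol2_YY k z y : hol2 (P1 k) z y -> hol2 (P2 k) z y -> P2 k z y != 0 -> hol2 (YY k) z y.
Proof.
move=> h1 h h0; apply: hol2_mul h1 _.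
apply: (@hol2_comp _ (@cexp R) (fun z y => twopii R * tau * (P2 k z y)^-1)).
  by apply: hol2_mul (hol2_cst _ _ _) (hol2_inv h h0).
by eexists; exact: dif_cexp.
Qed.

Lemma clog_small : exists2 d : R, 0 < d & forall h : C, nm h < d ->
  nm (clog (1 + h)) <= 2 * nm h /\ hol (@clog R) (1 + h).
Proof.
have [d d0 dP] := @dif_clog1 R 1 ltr01; have [d' d'0 dP'] := dif_clog_near1 R.
exists (Num.min d d'); first by rewrite lt_min d0.
move=> h; rewrite lt_min => /andP[h1 h2]; split; last first.
  by eexists; apply: dP'; rewrite addrC addrA addNr add0r.
have := dP h h1; rewrite clog1 subr0 !mul1r => A.
by have := nmD (clog (1 + h) - h) h; rewrite subrK; lra.
Qed.

Lemma nm_mul_cexp_le (X Y : C) : nm Y < 1 / 8 -> nm (X * Y * cexp Y) <= nm X.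
Proof.
move=> Y2; rewrite (nmM (X * Y)) (nmM X) nm_cexp -mulrA ler_piMr ?nm_ge0 //.
have e1 : expR (complex.Re Y) <= 8 / 7.
  have R1 : complex.Re Y <= 1 / 8 by have := Re_le_nm Y; have := ler_norm (complex.Re Y); lra.
  have e2 : 7 / 8 <= expR (- (complex.Re Y)) by have := expR_ge1Dx (- complex.Re Y); lra.
  by rewrite -[complex.Re Y]opprK expRN -[8 / 7]invf_div lef_pV2 ?posrE ?expR_gt0 // divr_gt0.
apply: (@le_trans _ _ (1 / 8 * (8 / 7))); last by lra.
by apply: ler_pM; rewrite ?nm_ge0 ?expR_ge0 // ltW.
Qed.

Lemma ell_bound s : 0 < s -> exists K c, 0 < c /\ exists2 r, 0 < r & forall z y,
  Reg 0 s r z y -> Reg 1 s r z y -> hol2 ell z y /\ nm (ell z y) <= K * expR (- (c / nm y)).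
Proof.
move=> s0; have [K [c [c0 [r1 r10 B]]]] := cc_small z00 tau0 ab SD tauE 0 0 s0.
have [d d0 dP] := clog_small.
have dd : 0 < Num.min d (1 / 8) by rewrite lt_min d0 divr_gt0.
have [r2 r20 S] := chart_small z00 tau0 ab SD tauE s0 dd (or_introl (erefl (0 : 'Z_4))).
have [r3 r30 N] := psi_near z00 ab SD 0 s0 ltr01.
pose r := Num.min r1 (Num.min r2 r3).
exists (2 * K), c; split=> //; exists r; first by rewrite !lt_min r10 r20.
have [q1 [q2 q3]] : r <= r1 /\ (r <= r2 /\ r <= r3) by rewrite !ge_min !lexx !orbT.
move=> z y h h'; have M j (rj : R) : r <= rj -> Reg j s r z y -> Reg j s rj z y.
  by move=> rr; apply: Reg_mono.
have [] := S z y (M _ _ q2 h); first by rewrite add0r; exact: M.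
rewrite /= !lt_min => /andP[X1 X2] /andP[Y1 Y2].
have Xb := B z y (M _ _ q1 h) (M _ _ q1 h); rewrite /cc /= in Xb.
have [h1 h2 _ p2 y0] := N z y (M _ _ q3 h).
have P20 : P2 0 z y != 0.
  by rewrite -nm_gt0; apply: lt_le_trans p2; rewrite divr_gt0 // nm_gt0.
pose k := XX 0 z y * YY 0 z y * cexp (YY 0 z y).
have nk : nm k <= nm (XX 0 z y) by apply: nm_mul_cexp_le; exact: Y2.
have [k1 k2] := dP k (le_lt_trans nk X1).
split.
  apply: (@hol2_comp _ (@clog R) (fun z y => 1 + XX 0 z y * YY 0 z y * cexp (YY 0 z y))) => //.
  have hX := hol2_XX h2 P20; have hY := hol2_YY h1 h2 P20.
  apply: hol2_add (hol2_cst _ _ _) _; apply: hol2_mul; first exact: hol2_mul.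
  by apply: (@hol2_comp _ (@cexp R) _ _ _ hY); eexists; exact: dif_cexp.
by apply: (le_trans k1); rewrite -mulrA ler_wpM2l // (le_trans nk).
Qed.

Lemma Z4_4 : (4 : 'Z_4) = 0. Proof. exact: val_inj. Qed.

Lemma nm_twopii : nm (twopii R) = 2 * pi.
Proof.
have -> : twopii R = 'i * (2 * pi)%:C by apply: complex_eq => /=; ring.
by rewrite nmM nmi mul1r nmR gtr0_norm // mulr_gt0 // pi_gt0.
Qed.

(** The images of Psi_1 and Psi_0 under [PiXY] differ by [phi14]. The X component gives the change
    of 2 i pi xi. In Y, the factor e^(2 i pi tau xi) changes by e^(- tau u0 ell), so z picks up the
    exponent tau (v0 - u0) + tau u0 = tau v0. Small differences fix all branches. *)
Lemma overlap_jump s : 0 < s -> exists2 r, 0 < r & forall z y,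
  Reg 0 s r z y -> Reg 1 s r z y ->
  [/\ twopii R * (P2 1 z y)^-1 = twopii R * (P2 0 z y)^-1 - u0 * ell z y &
      clog (P1 1 z y / z0) = clog (P1 0 z y / z0) + tau * v0 * ell z y].
Proof.
move=> s0; have [_ _ /(_ 0 s s0)[r1 r10 S3]] := SD.
move: phi41; rewrite Z4_4 => /near_C2P[d d0 phiP].
have [r2 r20 small] := chart_small z00 tau0 ab SD tauE s0 d0 (or_intror (erefl (0 + 1 : 'Z_4))).
have pi0 := pi_gt0 R.
(* With this bound 2 pi |xi_1 - xi_0| <= 1 / 2; together with |u0 ell| <= 1 / 2 it keeps the two
   exponents within the distance 1 of [Im0_small]. *)
have e0 : 0 < (4 * pi)^-1 :> R by rewrite invr_gt0 mulr_gt0.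
have [r3 r30 close] := xi_close z00 tau0 ab SD 1 0 s0 e0.
have [dl dl0 dlP] := clog_near1 R; have [dc dc0 dcP] := clog_cexp R.
have [de de0 deP] := hol_cts (ex_intro _ _ (@dif_cexp0 R)) (e := dl / 2) ltac:(by rewrite divr_gt0).
have [r4 r40 N] := psi_near z00 ab SD 0 s0 dl0.
have [K [c [c0 [r5 r50 B]]]] := ell_bound s0.
pose A := nm u0 + nm (tau * v0) + 1.
have A0 : 0 < A by rewrite ltr_wpDl // addr_ge0 ?nm_ge0.
have uA : nm u0 <= A by rewrite /A -addrA lerDl addr_ge0 ?nm_ge0.
have tA : nm (tau * v0) <= A by rewrite /A -addrA addrCA lerDl addr_ge0 ?nm_ge0.
pose eps := Num.min (1 / 2) (Num.min dc de) / A.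
have eps0 : 0 < eps by rewrite divr_gt0 // !lt_min dc0 de0 divr_gt0.
have [r6 r60 Q] := expRN_small K c0 eps0.
pose r := Num.min (Num.min r1 r2) (Num.min (Num.min r3 r4) (Num.min r5 r6)).
exists r; first by rewrite !lt_min r10 r20 r30 r40 r50.
have [[q1 q2] [[q3 q4] [q5 q6]]] :
  (r <= r1 /\ r <= r2) /\ ((r <= r3 /\ r <= r4) /\ (r <= r5 /\ r <= r6)).
  by rewrite !ge_min !lexx ?orbT ?andbT /=.
move=> z y h h'; have M j (rj : R) : r <= rj -> Reg j s r z y -> Reg j s rj z y.
  by move=> rr; apply: Reg_mono.
have y0 : y != 0 by case/and3P: h => _ _; apply: sec_neq0; exact: ltW.
have yr : nm y < r6 by case/and3P: h => _ yr _; exact: lt_le_trans yr q6.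
have [_ lb] := B z y (M _ _ q5 h) (M _ _ q5 h').
have {}lb : nm (ell z y) < eps by apply: le_lt_trans lb (Q y y0 yr).
have lbA : A * nm (ell z y) < Num.min (1 / 2) (Num.min dc de).
  by rewrite mulrC -ltr_pdivlMr.
move: lbA; rewrite !lt_min => /andP[l1 /andP[l2 l3]].
have nl := nm_ge0 (ell z y); have nu := nm_ge0 u0; have nt := nm_ge0 (tau * v0).
have lu : nm (u0 * ell z y) <= 1 / 2.
  by rewrite nmM; apply: le_trans (ltW l1); rewrite ler_wpM2r.
have lt' : nm (tau * v0 * ell z y) <= A * nm (ell z y).
  by rewrite nmM ler_wpM2r.
have h01 : Reg (0 + 1) s r z y by rewrite add0r.
have E := S3 z y (M _ _ q1 h) (M _ _ q1 h01).
have [S1 S2] := small z y (M _ _ q2 h) (M _ _ q2 h01).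
rewrite !PiE /= add0r in E S1 S2.
have := phiP (XX 1 z y) (YY 1 z y); rewrite !subr0 => /(_ S1 S2)[_].
rewrite -E => EE.
have EX : XX 0 z y * cexp (- u0 * ell z y) = XX 1 z y := congr1 fst EE.
have EY : YY 0 z y * cexp (tau * (v0 - u0) * ell z y) = YY 1 z y := congr1 snd EE.
have xi : twopii R * (P2 1 z y)^-1 = twopii R * (P2 0 z y)^-1 - u0 * ell z y.
  apply: Im0_small; last by rewrite cexpD -mulNr EX.
  have -> : twopii R * (P2 1 z y)^-1 - (twopii R * (P2 0 z y)^-1 - u0 * ell z y) =
    twopii R * ((P2 1 z y)^-1 - (P2 0 z y)^-1) + u0 * ell z y by ring.
  apply: (le_trans (nmD _ _)); rewrite nmM nm_twopii.
  have := close z y (M _ _ q3 h') (M _ _ q3 h) => cl.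
  have : 2 * pi * nm ((P2 1 z y)^-1 - (P2 0 z y)^-1) <= 2 * pi * (4 * pi)^-1.
    by rewrite ler_wpM2l ?mulr_ge0 // ltW.
  have pn : pi != 0 :> R by rewrite gt_eqF.
  have -> : 2 * pi * (4 * pi)^-1 = 1 / 2 :> R.
    by move: (pi : R) pn => p pn; field.
  by move=> hx; rewrite [leRHS]splitr lerD.
split=> //.
have PE : P1 1 z y = P1 0 z y * cexp (tau * v0 * ell z y).
  move: EY; rewrite /YY.
  have -> : twopii R * tau * (P2 1 z y)^-1 =
      twopii R * tau * (P2 0 z y)^-1 + - (tau * u0 * ell z y).
    by rewrite mulrAC xi; ring.
  rewrite cexpD cexpNV => EY'.
  have c1 := cexp_neq0 (twopii R * tau * (P2 0 z y)^-1).
  have c2 := cexp_neq0 (tau * u0 * ell z y).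
  have -> : tau * v0 * ell z y = tau * (v0 - u0) * ell z y + tau * u0 * ell z y by ring.
  rewrite cexpD; apply: (mulIf c1).
  transitivity (P1 0 z y * cexp (twopii R * tau * (P2 0 z y)^-1) *
    cexp (tau * (v0 - u0) * ell z y) * cexp (tau * u0 * ell z y)); last by ring.
  by rewrite EY'; field.
have [_ _ pd _ _] := N z y (M _ _ q4 h).
have me : nm (cexp (tau * v0 * ell z y) - 1) < dl.
  have := deP (tau * v0 * ell z y); rewrite subr0 cexp0 => /(_ (le_lt_trans lt' l3)) h1.
  by apply: (le_lt_trans h1); rewrite ltr_pdivrMr // ltr_pMr // ltr1n.
have [_ _ CE] := dlP _ _ pd me.
by rewrite PE mulrAC CE dcP // (le_lt_trans lt').
Qed.

Lemma H_jump u v s : 0 < s -> exists2 r, 0 < r & forall z y,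
  Reg 0 s r z y -> Reg 1 s r z y ->
  H tau z0 Psi u v 1 z y = H tau z0 Psi u v 0 z y + (u * v0 - v * u0) / twopii R * ell z y.
Proof.
move=> s0; have [r r0 J] := overlap_jump s0; exists r => // z y h h'.
have [E1 E2] := J z y h h'; have tt := twopii_neq0 R.
have x1 : (P2 1 z y)^-1 = (P2 0 z y)^-1 - u0 * ell z y / twopii R.
  by apply: (mulfI tt); rewrite E1 mulrBr [twopii R * (_ / _)]mulrC divfK.
rewrite /H /Hf E2 x1 /kap.
move: (P2 0 z y)^-1 (clog _) (ell z y) (twopii R) tt => x l e t tt; field.
by rewrite tt tau0.
Qed.

End Jump.

(** * Convergence of F_t0 *)

Section Convergence.
Variable R : realType.
Local Notation C := R[i].
Local Notation nm := (@nm R).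
Local Notation C2 := (C * C)%type.

Lemma near0_d (z0 : C) f : near0 z0 (hol2 f) ->
  near0 z0 (fun z y => hol2 (d1 f) z y /\ hol2 (d2 f) z y).
Proof.
move=> [r r0 H]; have r2 : 0 < r / 2 by rewrite divr_gt0.
exists (r / 2) => // z y zr yr.
have P : pdisc z y (r / 2) (hol2 f).
  move=> z' y' zz yy; apply: H; first by have := nm_tri z z' z0; lra.
  by have := nmD (y' - y) y; rewrite subrK; lra.
by split; [exact: hol2_d1 P | exact: hol2_d2 P].
Qed.

(** Quadratic smallness in y forces differentiability at (z, 0) with zero differential. It serves to
    cross the curve without a removable singularity theorem. *)
Lemma hol2_quadratic (f : C -> C -> C) z K r : 0 < r ->
  (forall z' y, nm (z' - z) < r -> nm y < r -> nm (f z' y) <= K * nm y ^+ 2) -> hol2 f z 0.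
Proof.
move=> r0 H; exists 0, 0 => e e0; pose L := `|K| + 1.
have L0 : 0 < L by rewrite ltr_wpDl.
have KL : K <= L by rewrite (le_trans (ler_norm K)) // lerDl.
exists (Num.min r (e / L)); first by rewrite lt_min r0 divr_gt0.
move=> [h k]; rewrite /nm2 /= lt_min => /andP[hr he]; rewrite !mul0r addr0 subr0 add0r.
have nh := nm_ge0 h; have nk := nm_ge0 k.
have f0 : f z 0 = 0.
  apply: nm_le0; have := H z 0; rewrite subrr nm0 expr0n mulr0.
  by apply.
rewrite f0 subr0; have := H (z + h) k; rewrite addrC addKr => H'.
apply: (le_trans (H' _ _)); [by lra|by lra|].
have kL : L * nm k <= e.
  by rewrite mulrC -ler_pdivlMr //; move: he; lra.
have : K * nm k ^+ 2 <= L * nm k * nm k by rewrite expr2 -mulrA ler_wpM2r ?mulr_ge0.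
have : L * nm k * nm k <= e * nm k by rewrite ler_wpM2r.
have : e * nm k <= e * (nm h + nm k) by apply: ler_wpM2l; [exact: ltW | lra].
by lra.
Qed.

Lemma d_sub (f g : C -> C -> C) x y : hol2 f x y -> hol2 g x y ->
  [/\ hol2 (fun z w => f z w - g z w) x y,
      d1 (fun z w => f z w - g z w) x y = d1 f x y - d1 g x y &
      d2 (fun z w => f z w - g z w) x y = d2 f x y - d2 g x y].
Proof.
move=> hf hg; have := dif2_addf (dif2_d hf) (dif2_comp (dif2_d hg) (dif_opp _)).
by rewrite !mulN1r => D; split; [do 2 eexists; exact: D | exact: d1E D | exact: d2E D].
Qed.

Variables (varpi : R) (tau z0 : C) (a b : nat -> C -> C) (phi : 'Z_4 -> C2 -> C2)
  (Psi : 'Z_4 -> C2 -> C2) (u0 v0 : C).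
Hypotheses (vp : 0 < varpi < pi) (z00 : z0 != 0) (tau0 : tau != 0) (ab : formal_coefs a b)
  (SD : sector_data varpi z0 tau a b phi Psi)
  (tauE : tau = (nm tau)%:C * cis varpi)
  (phi12 : \forall p \near (0 : C2), phi 1 p = p)
  (phi23 : \forall p \near (0 : C2), phi 2 p = p)
  (phi34 : \forall p \near (0 : C2), phi 3 p = p)
  (phi41 : \forall p \near (0 : C2),
     phi 4 (phi14 (tau * (v0 - u0)) u0 p) = p /\
     phi14 (tau * (v0 - u0)) u0 (phi 4 p) = p).

Local Notation Reg := (Reg varpi z0).
Local Notation H := (H tau z0 Psi).

Lemma H_overlap_id i u v s : 0 < s -> i != 0 -> exists2 r, 0 < r & forall z y,
  Reg i s r z y -> Reg (i + 1) s r z y -> H u v i z y = H u v (i + 1) z y.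
Proof.
move=> s0 i0; have P : \forall p \near (0 : C2), phi i p = p.
  by elim/Z4_ind: i i0.
have [r r0 E] := overlap_id z00 tau0 ab SD tauE s0 P; exists r => // z y h h'.
by rewrite /H /P1 /P2 E.
Qed.

(** At t0 the coefficient of the jump vanishes. Since opposite sectors are disjoint, agreement of
    consecutive ones gives agreement of all. *)
Lemma H_overlap s : 0 < s -> exists2 r, 0 < r & forall i j z y,
  Reg i s r z y -> Reg j s r z y -> H u0 v0 i z y = H u0 v0 j z y.
Proof.
move=> s0; have [ra ra0 Ja] := H_jump z00 tau0 ab SD tauE phi41 u0 v0 s0.
have [rb rb0 Jb] := @H_overlap_id 1 u0 v0 s s0 isT.
have [rc rc0 Jc] := @H_overlap_id 2 u0 v0 s s0 isT.
have [rd rd0 Jd] := @H_overlap_id 3 u0 v0 s s0 isT.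
have e12 : 1 + 1 = 2 :> 'Z_4 by exact: val_inj.
have e23 : 2 + 1 = 3 :> 'Z_4 by exact: val_inj.
have e30 : 3 + 1 = 0 :> 'Z_4 by exact: val_inj.
rewrite e12 in Jb; rewrite e23 in Jc; rewrite e30 in Jd.
exists (Num.min (Num.min ra rb) (Num.min rc rd)); first by rewrite !lt_min ra0 rb0 rc0.
move=> i j z y; set r := Num.min _ _.
have [[qa qb] [qc qd]] : (r <= ra /\ r <= rb) /\ (r <= rc /\ r <= rd).
  by rewrite !ge_min !lexx ?orbT.
have M k (r' : R) : r <= r' -> Reg k s r z y -> Reg k s r' z y.
  by move=> rr; apply: Reg_mono.
have E01 : Reg 0 s r z y -> Reg 1 s r z y -> H u0 v0 0 z y = H u0 v0 1 z y.
  move=> h h'; rewrite (Ja z y (M _ _ qa h) (M _ _ qa h')).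
  by rewrite (mulrC v0) subrr !mul0r addr0.
have E12 : Reg 1 s r z y -> Reg 2 s r z y -> H u0 v0 1 z y = H u0 v0 2 z y.
  by move=> h h'; apply: Jb; apply: M.
have E23 : Reg 2 s r z y -> Reg 3 s r z y -> H u0 v0 2 z y = H u0 v0 3 z y.
  by move=> h h'; apply: Jc; apply: M.
have E30 : Reg 3 s r z y -> Reg 0 s r z y -> H u0 v0 3 z y = H u0 v0 0 z y.
  by move=> h h'; apply: Jd; apply: M.
have N13 : Reg 1 s r z y -> Reg 3 s r z y -> False.
  move=> /and3P[_ _ h] /and3P[_ _]; have := sec_opposite (ltW s0) h.
  by rewrite /ang /opening /= => ->.
have N20 : Reg 2 s r z y -> Reg 0 s r z y -> False.
  move=> /and3P[_ _ h] /and3P[_ _]; have := sec_opposite (ltW s0) h.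
  by rewrite /ang /opening /= => ->.
elim/Z4_ind: i; elim/Z4_ind: j => // h h'.
- by case: (N20 h' h).
- by rewrite E30.
- by rewrite E01.
- by case: (N13 h h').
- by case: (N20 h h').
- by rewrite E12.
- by case: (N13 h' h).
by rewrite E23.
Qed.

Lemma glued_integral : exists h : C -> C -> C,
  near0 z0 (fun z y => y != 0 -> hol2 h z y) /\
  forall n (G : C -> C -> C), near0 z0 (hol2 G) ->
    near0 z0 (fun z y => y != 0 -> Hf tau z0 u0 v0 (trunc a b n.+2 (z, y)).1
       (trunc a b n.+2 (z, y)).2 = v0 / y + G z y) ->
    exists K, near0 z0 (fun z y => y != 0 -> nm (h z y - (v0 / y + G z y)) <= K * nm y ^+ n.+1).
Proof.
(* The cover has margin [s] and the overlaps margin [s / 2]: a small neighborhood of (z, y) stays in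
   the chosen sector, where [h] coincides with the single function [H u0 v0 i]. *)
have [s /andP[s0 s1] cover] := sec_cover vp; have s2 : 0 < s / 2 by rewrite divr_gt0.
have [r r0 E] := H_overlap s2.
pose idx y := odflt 0 [pick i : 'Z_4 | sec (ang varpi i) s y].
have idxP y : y != 0 -> sec (ang varpi (idx y)) s y.
  move=> y0; rewrite /idx; case: pickP => //= N; have [j] := cover y y0.
  by rewrite N.
pose h z y := H u0 v0 (idx y) z y; exists h.
have hE i z y : Reg i (s / 2) r z y -> h z y = H u0 v0 i z y.
  move=> hi; apply: E => //; have /and3P[zr yr yi] := hi; apply/and3P; split=> //.
  by apply: sec_mono (idxP _ (sec_neq0 (ltW s2) yi)); lra.
have est n (G : C -> C -> C) : near0 z0 (hol2 G) ->
    near0 z0 (fun z y => y != 0 -> Hf tau z0 u0 v0 (trunc a b n.+2 (z, y)).1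
       (trunc a b n.+2 (z, y)).2 = v0 / y + G z y) ->
    exists K, near0 z0 (fun z y => y != 0 -> hol2 (H u0 v0 (idx y)) z y /\
      nm (h z y - (v0 / y + G z y)) <= K * nm y ^+ n.+1).
  move=> hG GE; have KP0 i := H_est z00 ab SD i s0 hG GE.
  have [K KP] := choice KP0.
  have qP0 i : exists q, 0 < q /\ forall z y, Reg i s q z y ->
      hol2 (H u0 v0 i) z y /\ nm (H u0 v0 i z y - (v0 / y + G z y)) <= K i * nm y ^+ n.+1.
    by have [q q0 Q] := KP i; exists q.
  have [q qP] := choice qP0.
  have [M _ KM] := Z4_upper K; have [q' q'0 qq] := Z4_lower (fun i => (qP i).1).
  exists M, q' => // z y zr yr y0.
  have [|h1 h2] := (qP (idx y)).2 z y.
    apply/and3P; split; last exact: idxP.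
      exact: lt_le_trans zr (qq _).
    exact: lt_le_trans yr (qq _).
  by split=> //; apply: (le_trans h2); rewrite ler_wpM2r ?exprn_ge0 ?nm_ge0.
split; last first.
  move=> n G hG GE; have [K KP] := est n G hG GE; exists K; apply: near0_imp KP => z y H' y0.
  by have [] := H' y0.
have [//|G [hG GE _ _]] := @GN_data _ tau z0 z00 tau0 a b ab u0 v0 2.
have [K KP] := est 0%N G hG GE.
have r2 : 0 < r / 2 by rewrite divr_gt0.
apply: near0_imp (near0_and KP (near0_ball z0 r2)) => z y P y0.
have [[al [be D]] _] := P.1 y0.
have ny : 0 < nm y by rewrite nm_gt0.
exists al, be; apply: (dif2_ext (d := Num.min (r / 2) (s / 16 * nm y))) D.
  by rewrite lt_min r2 mulr_gt0 // divr_gt0.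
move=> z' y'; rewrite !lt_min => /andP[zz _] /andP[yr yy].
have [_ [zr' yr']] := P.
symmetry; apply: hE; apply/and3P; split.
- by have := nm_tri z z' z0; lra.
- by have := nmD (y' - y) y; rewrite subrK; lra.
apply: (@sec_box _ _ (s / 2) y).
- by apply/andP; split; lra.
- by rewrite mulrC divfK ?pnatr_eq0 //; exact: idxP.
by apply: (le_trans (ltW yy)); rewrite ler_wpM2r ?nm_ge0 //; lra.
Qed.

Lemma regular_part : exists G : C -> C -> C,
  [/\ near0 z0 (hol2 G), forall z, G z 0 = - v0 * b 2 z + kap tau u0 * clog (z / z0) &
    forall n (G' : C -> C -> C), near0 z0 (hol2 G') -> (forall z, G' z 0 = G z 0) ->
    near0 z0 (fun z y => y != 0 -> Hf tau z0 u0 v0 (trunc a b n.+2 (z, y)).1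
       (trunc a b n.+2 (z, y)).2 = v0 / y + G' z y) ->
    exists K, near0 z0 (fun z y => nm (G z y - G' z y) <= K * nm y ^+ n.+1)].
Proof.
have [h [hh est]] := glued_integral.
(* On the curve the value is the one that [GN_data] gives for every truncation of order at least
   2. *)
pose G z y := if y == 0 then - v0 * b 2 z + kap tau u0 * clog (z / z0) else h z y - v0 / y.
have GG n (G' : C -> C -> C) : near0 z0 (hol2 G') -> (forall z, G' z 0 = G z 0) ->
    near0 z0 (fun z y => y != 0 -> Hf tau z0 u0 v0 (trunc a b n.+2 (z, y)).1
       (trunc a b n.+2 (z, y)).2 = v0 / y + G' z y) ->
    exists K, near0 z0 (fun z y => nm (G z y - G' z y) <= K * nm y ^+ n.+1).
  move=> hG' G0 /(est n G' hG')[K KP]; exists K; apply: near0_imp KP => z y.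
  have [-> _|y0 /(_ isT)] := eqVneq y 0.
    by rewrite G0 subrr !nm0 expr0n mulr0.
  by rewrite /G (negPf y0) opprD addrA.
(* Order 3 is the first truncation with an error O(y^2), which [hol2_quadratic] needs at the points
   of the curve. *)
have [//|G3 [hG3 GE3 G30 _]] := @GN_data _ tau z0 z00 tau0 a b ab u0 v0 3.
have G30' z : G3 z 0 = G z 0 by rewrite G30 /G eqxx.
have [K [r r0 KP]] := GG 1%N G3 hG3 G30' GE3.
exists G; split=> //; last by move=> z; rewrite /G eqxx.
have r2 : 0 < r / 2 by rewrite divr_gt0.
apply: near0_imp (near0_and (near0_and hG3 hh) (near0_ball z0 r2)) => z y [[h3 hy] [zr yr]].
have [y0|y0] := eqVneq y 0.
  rewrite y0 in h3 *; have D : hol2 (fun z y => G z y - G3 z y) z 0.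
    apply: (@hol2_quadratic _ z K (r / 2)) => // z' y' zz yy; apply: KP; last by lra.
    by have := nm_tri z z' z0; lra.
  have [al [be E]] := hol2_add D h3; exists al, be.
  by apply: (dif2_ext (d := 1)) E => // z' y' _ _; rewrite subrK.
have [al [be E]] := hol2_add (hy y0) (hol2_opp (hol2_mul (hol2_cst v0 z y)
  (hol2_inv (hol2_snd z y) y0))).
exists al, be; apply: (dif2_ext (d := nm y)) E; first by rewrite nm_gt0.
move=> z' y' _ yy; rewrite /G (_ : y' == 0 = false) //; apply: contraTF yy => /eqP ->.
by rewrite sub0r nmN ltxx.
Qed.

Lemma nm_dif_le (x y K : R) : 0 <= y -> x <= K * y -> x <= `|K| * y.
Proof. by move=> y0 /le_trans; apply; rewrite ler_wpM2r // ler_norm. Qed.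

Lemma pencil_foliation : (u0, v0) != (0, 0) -> exists eta : C2 -> C2,
    [/\ \forall p \near (z0, 0 : C), differentiable eta p,
        eta (z0, 0) != 0 &
        formally_zero z0 (fun N p =>
          wedge (eta p) (pullback (trunc a b N) (pencil tau u0 v0) p))].
Proof.
move=> uv; have [G [hG G0 est]] := regular_part.
(* The form is y^e dH. If v0 is nonzero, e = 2 clears the pole - v0 / y^2 and leaves - v0 on the
   curve; if v0 = 0 there is no pole, and the derivative of u0 / (2 i pi tau) log z is already
   nonzero. *)
pose e := if v0 == 0 then 0%N else 2%N.
have ve (y : C) : y != 0 -> y ^+ e * (v0 / y ^+ 2) = v0.
  move=> y0; rewrite /e; have [->|_] := eqVneq v0 0; first by rewrite mul0r mulr0.
  by rewrite mulrC divfK // expf_neq0.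
pose eta (p : C2) : C2 := (p.2 ^+ e * d1 G p.1 p.2, p.2 ^+ e * d2 G p.1 p.2 - v0).
exists eta; split.
- have [r r0 dG] := near0_d hG; apply/near_C2P; exists r => // z y zr yr.
  rewrite subr0 in yr; have [h1 h2] := dG z y zr yr; apply: hol2_differentiable_pair => /=.
    by apply: hol2_mul (hol2_expn e (hol2_snd z y)) h1.
  apply: hol2_add (hol2_cst (- v0) z y).
  by apply: hol2_mul (hol2_expn e (hol2_snd z y)) h2.
- apply/negP => /eqP E; have := congr1 fst E; have := congr1 snd E; rewrite /= /e.
  have [v00 _|vn] := eqVneq v0 0; last first.
    by rewrite expr0n mul0r sub0r => /eqP; rewrite oppr_eq0 (negPf vn).
  have un : u0 != 0 by apply: contraNneq uv => ->; rewrite v00.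
  rewrite expr0 mul1r => d0; have hG0 := near0_at hG.
  have := dif2_dif1 (dif2_d hG0); rewrite d0 => D.
  have [d d0' dl] := dif_clog_near1 R.
  have z1 : z0 / z0 = 1 by rewrite divff.
  have dl1 := dl (z0 / z0); rewrite z1 subrr nm0 in dl1.
  have D1 : dif (fun z : C => z / z0) z0 z0^-1.
    by have := dif_mul (@dif_id _ z0) (dif_cst z0^-1 z0); rewrite mul1r mul0r addr0.
  have {}dl1 : dif (@clog R) (z0 / z0) 1^-1 by rewrite z1; exact: dl1.
  have D2 := dif_mul (dif_cst (kap tau u0) z0) (dif_comp D1 dl1).
  have D3 : dif (fun z => G z 0) z0 (0 * clog (z0 / z0) + 1^-1 * z0^-1 * kap tau u0).
    apply: (dif_ext ltr01) D2 => z _.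
    by rewrite G0 v00 oppr0 mul0r add0r.
  have /eqP := dif_unique D D3.
  rewrite mul0r add0r invr1 mul1r eq_sym /kap !mulf_eq0 invr_eq0 (negPf z00) (negPf un).
  by rewrite invr_eq0 mulf_eq0 (negPf (twopii_neq0 R)) (negPf tau0).
move=> k; exists (k + 2)%N => //= N kN.
have [n Nn] : exists n, N = n.+2 /\ (k <= n)%N.
  exists (N - 2)%N; have N2 : (2 <= N)%N by apply: leq_trans kN; rewrite leq_addl.
  by split; [rewrite -addn2 subnK | rewrite leq_subRL // addnC].
case: Nn => -> {N kN} kn.
have [//|G' [hG' GE' G0' PB]] := @GN_data _ tau z0 z00 tau0 a b ab u0 v0 n.+2.
have [|K KP] := est n G' hG' _ GE'; first by move=> z; rewrite G0 G0'.
have DG : near0 z0 (fun z y => [/\ hol2 (fun z y => G z y - G' z y) z y,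
    d1 (fun z y => G z y - G' z y) z y = d1 G z y - d1 G' z y &
    d2 (fun z y => G z y - G' z y) z y = d2 G z y - d2 G' z y]).
  by apply: near0_imp (near0_and hG hG') => z y [h h']; exact: d_sub.
have [K' KP'] : exists K', near0 z0 (fun z y => y != 0 ->
    nm (d1 (fun z y => G z y - G' z y) z y) <= K' * nm y ^+ n /\
    nm (d2 (fun z y => G z y - G' z y) z y) <= K' * nm y ^+ n).
  apply: near0_grad; apply: near0_imp (near0_and DG KP) => z y [[h _ _] h'].
  by split; [exact: h | exact: h'].
have [L1 LP1] := near0_bounded (near0_imp (fun z y h => proj1 h) (near0_d hG')).
have [L2 LP2] := near0_bounded (near0_imp (fun z y h => proj2 h) (near0_d hG')).
have [r r0 Q] := near0_and (near0_and PB (near0_and KP' DG)) (near0_and LP1 (near0_and LP2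
  (near0_ball z0 ltr01))).
apply/bigO_yP; exists (`|K'| * (L2 + L1 + nm v0)), r; split=> // z y zr yr y0.
have [[/(_ y0) -> [/(_ y0)[b1 b2] [_ E1 E2]]] [l1 [l2 [_ y1]]]] := Q z y zr yr.
rewrite E1 in b1; rewrite E2 in b2.
have ny := nm_ge0 y; have yn k' : 0 <= nm y ^+ k' by rewrite exprn_ge0.
have ynk : nm y ^+ n <= nm y ^+ k by rewrite ler_wiXn2l // ltW.
have {}b1 := le_trans (nm_dif_le (yn n) b1) (ler_wpM2l (normr_ge0 K') ynk).
have {}b2 := le_trans (nm_dif_le (yn n) b2) (ler_wpM2l (normr_ge0 K') ynk).
(* As [eta] is y^e (d (v0 / y) + dG) and the pullback is d (v0 / y) + dG', antisymmetry leaves only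
   terms that contain a derivative of G - G'. *)
have ->: wedge (eta (z, y)) (d1 G' z y, d2 G' z y - v0 / y ^+ 2) =
   y ^+ e * ((d1 G z y - d1 G' z y) * d2 G' z y - (d2 G z y - d2 G' z y) * d1 G' z y)
   - v0 * (d1 G z y - d1 G' z y).
  rewrite /wedge /= -{2 3}(ve y y0); ring.
have ye : nm (y ^+ e) <= 1.
  rewrite /e; case: eqP => _; first by rewrite expr0 nm1.
  by rewrite nmX expr_le1 // ltW.
set A := d1 G z y - _ in b1 *; set B := d2 G z y - _ in b2 *.
apply: (le_trans (nmB _ _)); rewrite (nmM (y ^+ e)) (nmM v0).
have nk := yn k; set t := `|K'| * nm y ^+ k in b1 b2.
have A1 : nm (A * d2 G' z y) <= t * L2 by rewrite nmM ler_pM ?nm_ge0.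
have A2 : nm (B * d1 G' z y) <= t * L1 by rewrite nmM ler_pM ?nm_ge0.
have A3 : nm v0 * nm A <= nm v0 * t by rewrite ler_wpM2l ?nm_ge0.
have A4 := nmB (A * d2 G' z y) (B * d1 G' z y).
have A5 : nm (y ^+ e) * nm (A * d2 G' z y - B * d1 G' z y) <=
  nm (A * d2 G' z y - B * d1 G' z y) by rewrite ler_piMl ?nm_ge0.
have -> : `|K'| * (L2 + L1 + nm v0) * nm y ^+ k = t * L2 + t * L1 + nm v0 * t.
  by rewrite /t; ring.
by lra.
Qed.

End Convergence.
(** * Divergence of the other foliations *)

Section FlatWedge.
Variable R : realType.
Local Notation C := R[i].
Local Notation nm := (@nm R).
Local Notation C2 := (C * C)%type.

Lemma d_ext (f g : C -> C -> C) x y r : 0 < r -> hol2 f x y ->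
  pdisc x y r (fun z w => f z w = g z w) ->
  [/\ hol2 g x y, d1 g x y = d1 f x y & d2 g x y = d2 f x y].
Proof.
move=> r0 /dif2_d D E; have D' : dif2 g x y (d1 f x y) (d2 f x y).
  by apply: dif2_ext D => [|z w zx wy]; [exact: r0 | apply: E; exact: ltW].
by split; [do 2 eexists; exact: D' | exact: d1E D' | exact: d2E D'].
Qed.

(** Half of the exponent pays for the factor 1 / |y| that Cauchy's estimates introduce. *)
Lemma expRN_div_le (c t : R) : 0 < c -> 0 < t ->
  expR (- (c / t)) / t <= 2 / c * expR (- (c / 2 / t)).
Proof.
move=> c0 t0; have -> : - (c / t) = - (c / 2 / t) + - (c / 2 / t) by field; rewrite gt_eqF.
rewrite expRD mulrAC ler_wpM2r ?expR_ge0 //.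
set x := c / 2 / t; have x0 : 0 < x by rewrite !divr_gt0.
have -> : t^-1 = 2 / c * x by rewrite /x; field; rewrite !gt_eqF.
have xe : expR (- x) * x <= 1.
  by rewrite expRN mulrC ler_pdivrMr ?expR_gt0 // mul1r; have := expR_ge1Dx x; lra.
by rewrite mulrCA ler_piMr // divr_ge0 // ltW.
Qed.

Variables (varpi : R) (tau z0 : C) (a b : nat -> C -> C) (phi : 'Z_4 -> C2 -> C2)
  (Psi : 'Z_4 -> C2 -> C2) (u0 v0 : C).
Hypotheses (z00 : z0 != 0) (tau0 : tau != 0) (ab : formal_coefs a b)
  (SD : sector_data varpi z0 tau a b phi Psi)
  (tauE : tau = (nm tau)%:C * cis varpi)
  (phi12 : \forall p \near (0 : C2), phi 1 p = p)
  (phi23 : \forall p \near (0 : C2), phi 2 p = p)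
  (phi34 : \forall p \near (0 : C2), phi 3 p = p)
  (phi41 : \forall p \near (0 : C2),
     phi 4 (phi14 (tau * (v0 - u0)) u0 p) = p /\
     phi14 (tau * (v0 - u0)) u0 (phi 4 p) = p).

Local Notation Reg := (Reg varpi z0).
Local Notation ev := (ev varpi z0).
Local Notation ell := (ell tau Psi).

Lemma reg2_box i j s r (Q : C -> C -> Prop) : 0 < s <= 1 ->
  (forall z y, Reg i s r z y -> Reg j s r z y -> Q z y) ->
  forall z y, Reg i (2 * s) (r / 2) z y -> Reg j (2 * s) (r / 2) z y ->
    pdisc z y (s / 8 * nm y) Q.
Proof.
move=> /andP[s0 s1] H z y /and3P[zr yr h] /and3P[_ _ h'] z' y' zz yy.
have ny := nm_ge0 y; have s01 : 0 < s <= 1 by rewrite s0.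
have z'r : nm (z' - z0) < r by have := nm_tri z z' z0; nra.
have y'r : nm y' < r by have := nmD (y' - y) y; rewrite subrK; nra.
by apply: H; apply/and3P; split=> //; [exact: sec_box h yy | exact: sec_box h' yy].
Qed.

Variables (u v : C) (eta : C2 -> C2).
Local Notation e1 := (fun z y : C => (eta (z, y)).1).
Local Notation e2 := (fun z y : C => (eta (z, y)).2).
Local Notation H := (H tau z0 Psi u v).
Hypotheses (eta_hol : near0 z0 (fun z y => hol2 e1 z y /\ hol2 e2 z y))
  (eta_formal : formally_zero z0 (fun N p =>
     wedge (eta p) (pullback (trunc a b N) (pencil tau u v) p))).

Definition wedge_d (f : C -> C -> C) z y := e1 z y * d2 f z y - e2 z y * d1 f z y.

Lemma eta_bounded : exists2 L, 0 < L & near0 z0 (fun z y => nm (e1 z y) <= L /\ nm (e2 z y) <= L).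
Proof.
have [L1 LP1] := near0_bounded (near0_imp (fun z y h => proj1 h) eta_hol).
have [L2 LP2] := near0_bounded (near0_imp (fun z y h => proj2 h) eta_hol).
exists (`|L1| + `|L2| + 1); first by rewrite ltr_wpDl // addr_ge0.
apply: near0_imp (near0_and LP1 LP2) => z y [h1 h2].
have := ler_norm L1; have := ler_norm L2; have := normr_ge0 L1; have := normr_ge0 L2.
by split; lra.
Qed.

Lemma H_hol i s : 0 < s -> ev i s (hol2 (H i)).
Proof.
move=> s0; have [//|G [hG GE _ _]] := @GN_data _ tau z0 z00 tau0 a b ab u v 2.
by have [K KP] := H_est z00 ab SD i s0 hG GE; apply: ev_imp KP => z y [].
Qed.

Lemma wedge_d_hol i s : 0 < s <= 1 -> ev i (2 * s) (hol2 (wedge_d (H i))).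
Proof.
move=> s01; have /andP[s0 s1] := s01; have s2 : 0 <= 2 * s by lra.
apply: ev_imp (ev_and (ev_and (near0_ev varpi i (2 * s) eta_hol) (ev_sec varpi z0 i s2))
  (ev_box s01 (H_hol i s0))) => z y [[[h1 h2] y0] P].
have r0 : 0 < s / 8 * nm y by rewrite mulr_gt0 ?nm_gt0 // divr_gt0.
exact: hol2_add (hol2_mul h1 (hol2_d2 r0 P)) (hol2_opp (hol2_mul h2 (hol2_d1 r0 P))).
Qed.

(** Formal vanishing makes eta /\ d (v / y + G) flat to order k for a high truncation, and Cauchy's
    estimates applied to [H_est] bound the derivatives of H_i - (v / y + G) to the same order. *)
Lemma wedge_d_flat i s k : 0 < s <= 1 ->
  exists K, ev i (2 * s) (fun z y => nm (wedge_d (H i) z y) <= K * nm y ^+ k).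
Proof.
move=> s01; have /andP[s0 s1] := s01; have s2 : 0 <= 2 * s by lra.
have [N0 _ NP] := eta_formal k; pose n := maxn N0 k.
have : bigO_y k z0 (fun p => wedge (eta p) (pullback (trunc a b n.+2) (pencil tau u v) p)).
  by apply: NP => /=; rewrite (leq_trans (leq_maxl N0 k)) // -addn2 leq_addr.
move=> /bigO_yP[K1 [q [q0 Q]]].
have [//|G [hG GE _ PB]] := @GN_data _ tau z0 z00 tau0 a b ab u v n.+2.
have [K2 KP2] := H_est z00 ab SD i s0 hG GE.
have kn : (k <= n)%N by exact: leq_maxr.
pose D z y := H i z y - (v / y + G z y).
have KD : ev i s (fun z y => hol2 D z y /\ nm (D z y) <= K2 * nm y ^+ n.+1).
  apply: ev_imp (ev_and (ev_and KP2 (ev_sec varpi z0 i (ltW s0))) (near0_ev varpi i s hG)).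
  move=> z y [[[h1 h2] y0] h3]; split=> //; apply: hol2_add h1 (hol2_opp _).
  exact: hol2_add (hol2_mul (hol2_cst _ _ _) (hol2_inv (hol2_snd _ _) y0)) h3.
have [K3 KP3] := ev_grad s01 KD.
have [L L0 LP] := eta_bounded.
exists (K1 + 2 * (L * `|K3|)).
have ss : s <= 2 * s by lra.
apply: ev_imp (ev_and (ev_and (ev_and KP3 (ev_mono ss KP2)) (ev_sec varpi z0 i s2))
  (near0_ev varpi i (2 * s) (near0_and (near0_and hG PB) (near0_and LP
   (near0_and (near0_ball z0 q0) (near0_ball z0 ltr01)))))).
move=> z y [[[[g1 g2] [hH _]] y0] [[h3 /(_ y0) pb] [[l1 l2] [[zq yq] [_ y1]]]]].
have Q' := Q z y zq yq y0; rewrite pb in Q'.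
have Dy : dif2 (fun _ w : C => v / w) z y 0 (- (v / y ^+ 2)).
  have := dif2_mulf (dif2_cst v z y) (dif2_comp (dif2_snd z y) (dif_inv y0)).
  by congr (dif2 _ _ _ _ _); field.
have DD := dif2_addf (dif2_d hH) (dif2_comp (dif2_addf Dy (dif2_d h3)) (dif_opp _)).
rewrite (d1E DD) in g1; rewrite (d2E DD) in g2.
have -> : wedge_d (H i) z y = wedge (eta (z, y)) (d1 G z y, d2 G z y - v / y ^+ 2) +
   (e1 z y * (d2 (H i) z y + -1 * (- (v / y ^+ 2) + d2 G z y)) -
    e2 z y * (d1 (H i) z y + -1 * (0 + d1 G z y))) by rewrite /wedge_d /wedge /=; ring.
apply: (le_trans (nmD _ _)); rewrite mulrDl; apply: lerD => //.
apply: (le_trans (nmB _ _)).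
rewrite (nmM (e1 z y)) (nmM (e2 z y)).
have ny := nm_ge0 y; have yn m : 0 <= nm y ^+ m by rewrite exprn_ge0.
have ynk : nm y ^+ n <= nm y ^+ k by rewrite ler_wiXn2l // ltW.
have {}g1 := le_trans (nm_dif_le (yn n) g1) (ler_wpM2l (normr_ge0 K3) ynk).
have {}g2 := le_trans (nm_dif_le (yn n) g2) (ler_wpM2l (normr_ge0 K3) ynk).
have -> : 2 * (L * `|K3|) * nm y ^+ k = L * (`|K3| * nm y ^+ k) + L * (`|K3| * nm y ^+ k) by ring.
by apply: lerD; apply: ler_pM => //; exact: nm_ge0.
Qed.

Lemma wedge_d_overlap i s : 0 < s <= 1 -> i != 0 -> exists2 r, 0 < r & forall z y,
  Reg i (2 * s) r z y -> Reg (i + 1) (2 * s) r z y -> wedge_d (H i) z y = wedge_d (H (i + 1)) z y.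
Proof.
move=> s01 i0; have /andP[s0 s1] := s01; have s2 : 0 <= 2 * s by lra.
have [r r0 E] := H_overlap_id z00 tau0 ab SD tauE phi12 phi23 phi34 u v s0 i0.
have [r' r'0 hH] := H_hol i s0; have ss : s <= 2 * s by lra.
exists (Num.min (r / 2) r'); first by rewrite lt_min divr_gt0.
have [q1 q2] : Num.min (r / 2) r' <= r / 2 /\ Num.min (r / 2) r' <= r'.
  by rewrite !ge_min !lexx ?orbT.
move=> z y h h'; have y0 : y != 0 by have /and3P[_ _] := h; exact: sec_neq0.
have r1 : 0 < s / 8 * nm y by rewrite mulr_gt0 ?nm_gt0 // divr_gt0.
have P := reg2_box s01 E (Reg_mono q1 (lexx _) h) (Reg_mono q1 (lexx _) h').
by have [_ E1 E2] := d_ext r1 (hH z y (Reg_mono q2 ss h)) P; rewrite /wedge_d E1 E2.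
Qed.

(** The rate of decay of [ell] is halved twice: once because |y'| may reach 2 |y| in the polydisc of
    Cauchy's estimates, once in [expRN_div_le]. *)
Lemma wedge_d_jump s : 0 < s <= 1 -> exists K c, 0 < c /\ exists2 r, 0 < r & forall z y,
  Reg 0 (2 * s) r z y -> Reg 1 (2 * s) r z y ->
  [/\ hol2 ell z y,
      wedge_d (H 1) z y = wedge_d (H 0) z y + (u * v0 - v * u0) / twopii R * wedge_d ell z y &
      nm (wedge_d ell z y) <= K * expR (- (c / nm y))].
Proof.
move=> s01; have /andP[s0 s1] := s01; have s2 : 0 <= 2 * s by lra.
have [r r0 E] := H_jump z00 tau0 ab SD tauE phi41 u v s0.
have [r' r'0 hH] := H_hol 0 s0; have ss : s <= 2 * s by lra.
have [K [c [c0 [q q0 Q]]]] := ell_bound z00 tau0 ab SD tauE s0.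
have [L L0 [t t0 LP]] := eta_bounded.
exists (2 * L * (16 * `|K| / (s / 8) * (2 / (c / 2)))), (c / 4); split.
  by rewrite divr_gt0.
pose rr := Num.min (Num.min (r / 2) r') (Num.min (q / 2) t).
exists rr; first by rewrite !lt_min r'0 t0 !divr_gt0.
have [[q1 q2] [q3 q4]] : (rr <= r / 2 /\ rr <= r') /\ (rr <= q / 2 /\ rr <= t).
  by rewrite !ge_min !lexx ?orbT.
move=> z y h h'; have /and3P[zr yr hs] := h; have y0 : y != 0 by exact: sec_neq0 hs.
have ny : 0 < nm y by rewrite nm_gt0.
have r1 : 0 < s / 8 * nm y by rewrite mulr_gt0 // divr_gt0.
have P := reg2_box s01 E (Reg_mono q1 (lexx _) h) (Reg_mono q1 (lexx _) h').
have P' := reg2_box s01 Q (Reg_mono q3 (lexx _) h) (Reg_mono q3 (lexx _) h').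
have PE : pdisc z y (s / 8 * nm y) (fun z w =>
    hol2 ell z w /\ nm (ell z w) <= `|K| * expR (- (c / 2 / nm y))).
  move=> z' y' zz yy; have [h1 h2] := P' z' y' zz yy; split=> //; apply: (le_trans h2).
  apply: (le_trans (nm_dif_le (expR_ge0 _) (lexx _))); rewrite ler_wpM2l // ler_expR lerN2.
  have y'1 : nm y' <= 2 * nm y by have := nmD (y' - y) y; rewrite subrK; nra.
  have y'0 : 0 < nm y' by have := nm_sub y y'; rewrite (nmBC y); nra.
  by rewrite ler_pdivrMr // mulrAC ler_pdivlMr //; nra.
have hl : hol2 ell z y by apply: (proj1 (PE z y _ _)); rewrite subrr nm0 ltW.
have hJ : hol2 (H 0) z y by apply: hH; exact: Reg_mono q2 ss h.
set k := (u * v0 - v * u0) / twopii R.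
have DD := dif2_addf (dif2_d hJ) (dif2_comp (dif2_mulf (dif2_cst k z y) (dif2_d hl)) (dif_id _)).
have P2 : pdisc z y (s / 8 * nm y) (fun z w => H 0 z w + id (k * ell z w) = H 1 z w).
  by move=> z' y' zz yy; rewrite P.
have [|_ E1 E2] := d_ext r1 _ P2; first by do 2 eexists; exact: DD.
split=> //; first by rewrite /wedge_d E1 E2 (d1E DD) (d2E DD); ring.
have [l1 l2] := LP z y (lt_le_trans zr q4) (lt_le_trans yr q4).
have B1 := d1_le r1 PE; have B2 := d2_le r1 PE.
have nb : 16 * (`|K| * expR (- (c / 2 / nm y))) / (s / 8 * nm y) <=
   16 * `|K| / (s / 8) * (2 / (c / 2)) * expR (- (c / 4 / nm y)).
  have -> : 16 * (`|K| * expR (- (c / 2 / nm y))) / (s / 8 * nm y) =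
    16 * `|K| / (s / 8) * (expR (- (c / 2 / nm y)) / nm y) by field; rewrite !gt_eqF.
  rewrite -(mulrA (16 * `|K| / (s / 8))) ler_wpM2l //.
    by rewrite !mulr_ge0 // invr_ge0 ltW // divr_gt0.
  have c2 : 0 < c / 2 by rewrite divr_gt0.
  have := expRN_div_le c2 ny; have -> : c / 2 / 2 = c / 4 by field.
  by [].
apply: (le_trans (nmB _ _)); rewrite (nmM (e1 z y)) (nmM (e2 z y)).
set B := 16 * `|K| / (s / 8) * (2 / (c / 2)) in nb *.
have -> : 2 * L * B * expR (- (c / 4 / nm y)) =
  L * (B * expR (- (c / 4 / nm y))) + L * (B * expR (- (c / 4 / nm y))) by ring.
by apply: lerD; apply: ler_pM; rewrite ?nm_ge0 //; [exact: le_trans B2 nb | exact: le_trans B1 nb].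
Qed.

End FlatWedge.

(** * Gluing four sectorial functions on a strip *)

Section FourSectors.
Variable R : realType.
Local Notation C := R[i].
Local Notation nm := (@nm R).

Lemma sin_lt_sin (e t : R) : 0 < e -> e < t < pi - e -> sin e < sin t.
Proof.
move=> e0 /andP[et te]; rewrite -subr_gt0.
have -> : sin t - sin e = 2 * cos ((t + e) / 2) * sin ((t - e) / 2).
  have E p q : sin (p + q) - sin (p + - q) = 2 * cos p * sin q :> R.
    by rewrite !sinD cosN sinN; ring.
  by rewrite -E; congr (sin _ - sin _); field.
rewrite !mulr_gt0 //; first by apply: cos_gt0_pihalf; apply/andP; split; lra.
by apply: sin_gt0_pi; apply/andP; split; lra.
Qed.

Variable varpi : R.
Hypothesis vp : 0 < varpi < pi.

(* The determinations of the arguments of the sectors for which the sectors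
   0, 3, 2, 1 follow each other in increasing order. *)
Definition lift_ang (i : 'Z_4) : R := match nat_of_ord i with
  | 1 => - varpi | 2 => - pi | 3 => - pi - varpi | _ => - (2 * pi) end.

Lemma cis_lift_ang i : cis (- lift_ang i) = cis (- ang varpi i).
Proof.
have P t : cis (t + pi + pi) = cis t :> C by rewrite !cisDpi opprK.
elim/Z4_ind: i; rewrite /lift_ang /ang /opening /=.
- by rewrite -[RHS]P; congr cis; ring.
- by [].
- by [].
by rewrite -[RHS]P; congr cis; ring.
Qed.

(** With y = e^(-w) the argument of 1 / y is Im w, and [lift_ang] selects its determination. *)
Lemma sec_cexpN i s (w : C) :
  sec (ang varpi i) s (cexp (- w)) = (s < sin (complex.Im w - lift_ang i)).
Proof.
rewrite /sec -cis_lift_ang nm_cexp -cexpNV opprK Im_mul_cis cReN.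
have [-> ->] : complex.Re (cexp w) = expR (complex.Re w) * cos (complex.Im w) /\
    complex.Im (cexp w) = expR (complex.Re w) * sin (complex.Im w).
  by rewrite /cexp cReM cImM /= !mul0r subr0 addr0.
congr (s < _); rewrite sinD cosN sinN.
have E : expR (complex.Re w) * expR (- complex.Re w) = 1 by rewrite -expRD subrr expR0.
rewrite -[RHS]mul1r -E; ring.
Qed.

Variable f : 'Z_4 -> C -> C.
Hypotheses
  (f_hol : forall i s, 0 < s <= 1 -> exists2 r, 0 < r & forall y, nm y < r ->
     sec (ang varpi i) s y -> hol (f i) y)
  (f_flat : forall i s (k : nat), 0 < s <= 1 -> exists K, exists2 r, 0 < r & forall y,
     nm y < r -> sec (ang varpi i) s y -> nm (f i y) <= K * nm y ^+ k)
  (f_overlap : forall i s, 0 < s <= 1 -> i != 0 -> exists2 r, 0 < r & forall y, nm y < r ->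
     sec (ang varpi i) s y -> sec (ang varpi (i + 1)) s y -> f i y = f (i + 1) y)
  (f_jump : forall s, 0 < s <= 1 -> exists K c, 0 < c /\ exists2 r, 0 < r & forall y, nm y < r ->
     sec (ang varpi 0) s y -> sec (ang varpi 1) s y ->
     nm (f 1 y - f 0 y) <= K * expR (- (c / nm y))).

(** In w = - log y the sectors 0, 3, 2, 1 are strips of height pi stacked from - 2 pi up to pi -
    varpi. Consecutive ones agree, and the disagreement of 0 and 1 appears only as a jump under w ->
    w + 2 i pi, so [strip_zero] applies to the glued function. *)
Lemma four_sectors_zero : exists theta s, 0 < s <= 1 /\ exists T, forall x, T < x ->
  let y := cexp (- (x +i* theta)) in
  [/\ sec (ang varpi 0) s y, sec (ang varpi 1) s y, f 0 y = 0 & f 1 y = 0].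
Proof.
have vp' := vp; have /andP[vp0 vp1] := vp'; have pi0 := pi_gt0 R.
(* Trimming each strip by [e] at both ends gives the margin sin e, while consecutive strips still
   overlap and the total height 3 pi - varpi - 2 e stays above 2 pi. *)
pose e := Num.min varpi (pi - varpi) / 8.
have e0 : 0 < e by rewrite divr_gt0 // lt_min vp0; lra.
have [ev1 ev2] : 8 * e <= varpi /\ 8 * e <= pi - varpi.
  by rewrite /e mulrC divfK // !ge_min !lexx ?orbT.
pose s := sin e; have s01 : 0 < s <= 1.
  by rewrite sin_le1 andbT; apply: sin_gt0_pi; apply/andP; split; lra.
pose F i (w : C) := f i (cexp (- w)).
pose V i (w : C) := lift_ang i + e < complex.Im w < lift_ang i + pi - e.
have VS i w : V i w -> sec (ang varpi i) s (cexp (- w)).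
  move=> /andP[w1 w2]; rewrite sec_cexpN; apply: sin_lt_sin => //.
  by apply/andP; split; lra.
have hol0 i : exists q, 0 < q /\ forall y, nm y < q -> sec (ang varpi i) s y -> hol (f i) y.
  by have [q q0 Q] := f_hol i s01; exists q.
have [q1 Q1] := choice hol0.
have ov0 i : exists q, 0 < q /\ forall y, nm y < q -> i != 0 ->
    sec (ang varpi i) s y -> sec (ang varpi (i + 1)) s y -> f i y = f (i + 1) y.
  have [->|i0] := eqVneq i 0; first by exists 1.
  by have [q q0 Q] := f_overlap s01 i0; exists q; split=> // y yq _; exact: Q.
have [q2 Q2] := choice ov0.
have bd0 i : exists qK : R * R, 0 < qK.1 /\ forall y, nm y < qK.1 -> sec (ang varpi i) s y ->
    nm (f i y) <= qK.2.
  have [K [q q0 Q]] := f_flat i 0%N s01; exists (q, K); split=> // y yq /(Q y yq).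
  by rewrite expr0 mulr1.
have [q3 Q3] := choice bd0.
have [K [c [c0 [q4 q40 J]]]] := f_jump s01.
have [r1 r10 R1] := Z4_lower (fun i => (Q1 i).1).
have [r2 r20 R2] := Z4_lower (fun i => (Q2 i).1).
have [r3 r30 R3] := Z4_lower (fun i => (Q3 i).1).
have [M M0 MP] := Z4_upper (fun i => (q3 i).2).
pose r := Num.min (Num.min r1 r2) (Num.min r3 q4).
have r0 : 0 < r by rewrite !lt_min r10 r20 r30.
have [[l1 l2] [l3 l4]] : (r <= r1 /\ r <= r2) /\ (r <= r3 /\ r <= q4).
  by rewrite !ge_min !lexx ?orbT.
have nmE (w : C) : nm (cexp (- w)) = expR (- complex.Re w) by rewrite nm_cexp cReN.
have small (r' : R) : 0 < r' -> exists T, forall w : C, T < complex.Re w -> nm (cexp (- w)) < r'.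
  move=> r'0; exists (- ln r') => w Tw; rewrite nmE -[ltRHS]lnK ?posrE // ltr_expR; lra.
have [T TP] := small r r0; pose t0 := Num.max 0 T.
have t00 : 0 <= t0 by rewrite le_max lexx.
have Tt : T <= t0 by rewrite le_max lexx orbT.
have yr (w : C) : t0 < complex.Re w -> nm (cexp (- w)) < r.
  by move=> tw; apply: TP; exact: le_lt_trans tw.
have A (i : 'Z_4) : (i + 1 == 1) = (i == 0) by elim/Z4_ind: i.
have FE i w : i != 0 -> t0 < complex.Re w -> V i w -> V (i + 1) w -> F i w = F (i + 1) w.
  move=> i0 tw h h'; apply: (Q2 i).2 => //; last 2 first; try exact: VS.
  exact: lt_le_trans (yr w tw) (le_trans l2 (R2 i)).
have e12 : 1 + 1 = 2 :> 'Z_4 by exact: val_inj.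
have e23 : 2 + 1 = 3 :> 'Z_4 by exact: val_inj.
have e30 : 3 + 1 = 0 :> 'Z_4 by exact: val_inj.
(* After lifting, the strips 0 and 1 no longer meet, so no jump occurs inside the glued domain. *)
have VV i j w : t0 < complex.Re w -> V i w -> V j w -> F i w = F j w.
  move=> tw; have := @FE 1 w isT tw; have := @FE 2 w isT tw; have := @FE 3 w isT tw.
  rewrite e12 e23 e30.
  have N13 : V 1 w -> V 3 w -> False.
    by rewrite /V /lift_ang /= => /andP[H1 H2] /andP[H3 H4]; clear -H1 H2 H3 H4 vp0 vp1 e0 pi0; lra.
  have N20 : V 2 w -> V 0 w -> False.
    by rewrite /V /lift_ang /= => /andP[H1 H2] /andP[H3 H4]; clear -H1 H2 H3 H4 vp0 vp1 e0 pi0; lra.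
  have N10 : V 1 w -> V 0 w -> False.
    by rewrite /V /lift_ang /= => /andP[H1 H2] /andP[H3 H4]; clear -H1 H2 H3 H4 vp0 vp1 e0 pi0; lra.
  move=> E30 E23 E12 h h'; elim/Z4_ind: i h; elim/Z4_ind: j h' => // h' h.
  - by case: (N10 h' h).
  - by case: (N20 h' h).
  - by rewrite E30.
  - by case: (N10 h h').
  - exact: E12.
  - by case: (N13 h h').
  - by case: (N20 h h').
  - by rewrite E12.
  - exact: E23.
  - exact: E30.
  - by case: (N13 h' h).
  by rewrite E23.
pose al := - (2 * pi) + e; pose be := pi - varpi - e.
(* The thresholds are the midpoints of the overlaps of consecutive strips. *)
pose idx (w : C) : 'Z_4 := if - (varpi / 2) < complex.Im w then 1 else
  if - (pi + varpi) / 2 < complex.Im w then 2 else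
  if - pi - varpi / 2 < complex.Im w then 3 else 0.
pose g w := F (idx w) w.
have Vidx w : strip t0 al be w -> V (idx w) w.
  rewrite /strip /al /be /idx => -[_ w1 w2].
  case: ltP => h1; last case: ltP => h2; last case: ltP => h3;
    rewrite /V /lift_ang /=; apply/andP.
  - by clear -vp0 vp1 e0 ev1 ev2 pi0 w1 w2 h1; split; lra.
  - by clear -vp0 vp1 e0 ev1 ev2 pi0 w1 w2 h1 h2; split; lra.
  - by clear -vp0 vp1 e0 ev1 ev2 pi0 w1 w2 h2 h3; split; lra.
  by clear -vp0 vp1 e0 ev1 ev2 pi0 w1 w2 h3; split; lra.
have gE i w : strip t0 al be w -> V i w -> g w = F i w.
  by move=> sw h; apply: VV (Vidx w sw) h; case: sw.
have Im2 (w : C) : complex.Im (w + twopii R) = complex.Im w + 2 * pi by rewrite cImD.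
have g_jump w : strip t0 al be w -> strip t0 al be (w + twopii R) ->
    [/\ V 0 w, V 1 (w + twopii R), g w = f 0 (cexp (- w)) &
        g (w + twopii R) = f 1 (cexp (- w))].
  move=> sw sw'; have [_ w1 _] := sw; have [_ _] := sw'; rewrite Im2 /al /be in w1 * => w2.
  have V0 : V 0 w.
    by rewrite /V /lift_ang /=; apply/andP; clear -vp0 e0 pi0 w1 w2; split; lra.
  have V1 : V 1 (w + twopii R).
    by rewrite /V Im2 /lift_ang /=; apply/andP; clear -vp0 vp1 e0 ev1 ev2 pi0 w1 w2; split; lra.
  split=> //; first exact: gE.
  rewrite (gE 1) // /F -(cexp_period (- (w + twopii R))); congr (f 1 (cexp _)); ring.
have zero th : al < th < be -> exists T', forall x, T' < x -> g (x +i* th) = 0.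
  move=> hth; apply: (@strip_zero R g t0 al be M `|K| c) => //.
  - move=> w sw; have Vw := Vidx w sw; have [w0 w1 w2] := sw; set i := idx w in Vw *.
    have hi : hol (F i) w.
      have [||l D] := (Q1 i).2 (cexp (- w)); [|exact: VS|].
        exact: lt_le_trans (yr w w0) (le_trans l1 (R1 i)).
      by eexists; apply: dif_comp (dif_comp (dif_opp w) (dif_cexp _)) D.
    have [l D] := hi; exists l; move: (Vw) => /andP[v1 v2].
    pose d := Num.min (Num.min (complex.Re w - t0) (complex.Im w - al))
      (Num.min (be - complex.Im w)
        (Num.min (complex.Im w - (lift_ang i + e)) (lift_ang i + pi - e - complex.Im w))).
    apply: (dif_ext (d := d)) D; first by rewrite !lt_min !subr_gt0 w0 w1 w2 v1 v2.
    move=> w'; rewrite !lt_min => /andP[/andP[k1 k2] /andP[k3 /andP[k4 k5]]].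
    have := le_trans (ler_norm _) (Re_le_nm (w' - w)).
    have := le_trans (ler_norm _) (Im_le_nm (w' - w)).
    have := le_trans (ler_norm _) (Re_le_nm (w - w')).
    have := le_trans (ler_norm _) (Im_le_nm (w - w')).
    rewrite !cReD !cImD !cReN !cImN (nmBC w w') => a1 a2 a3 a4.
    symmetry; apply: gE; first by clear -k1 k2 k3 a1 a2 a3 a4; split; lra.
    by rewrite /V; apply/andP; clear -k4 k5 a1 a2 a3 a4; split; lra.
  - move=> w sw; have [w0 _ _] := sw; have Vw := Vidx w sw.
    apply: le_trans (MP (idx w)); apply: (Q3 (idx w)).2; last exact: VS.
    exact: lt_le_trans (yr w w0) (le_trans l3 (R3 _)).
  - move=> N; have fl0 i : exists qK : R * R, 0 < qK.1 /\ forall y, nm y < qK.1 ->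
        sec (ang varpi i) s y -> nm (f i y) <= qK.2 * nm y ^+ N.
      by have [K' [q q0 Q]] := f_flat i N s01; exists (q, K').
    have [q5 Q5] := choice fl0; have [r5 r50 R5] := Z4_lower (fun i => (Q5 i).1).
    have [K5 _ KP5] := Z4_upper (fun i => (q5 i).2).
    have [T5 TP5] := small r5 r50; exists T5, K5 => w sw Tw.
    have h := (Q5 (idx w)).2 _ (lt_le_trans (TP5 w Tw) (R5 _)) (VS _ _ (Vidx w sw)).
    apply: (le_trans h); rewrite nmE -expRM_natl mulrN.
    by rewrite ler_wpM2r ?expR_ge0.
  - move=> w sw sw'; have [V0 V1 -> ->] := g_jump w sw sw'; have [w0 _ _] := sw.
    have := J (cexp (- w)) (lt_le_trans (yr w w0) l4) (VS _ _ V0).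
    have -> : c / nm (cexp (- w)) = c * expR (complex.Re w) by rewrite nmE expRN invrK.
    move=> h; apply: (le_trans (h _)); last by rewrite ler_wpM2r ?expR_ge0 // ler_norm.
    rewrite -(cexp_period (- w)).
    by have := VS _ _ V1; rewrite opprD -(cexp_period (- w - _)) subrK cexp_period.
  by rewrite /al /be; clear -vp0 vp1 e0 ev1 ev2 pi0; lra.
(* The middle direction of the overlap ]0, pi - varpi[ of the sectors 0 and 1. The glued function is
   [f 1] at height [th] and [f 0] at height [th - 2 * pi], for the same y. *)
pose th := (pi - varpi) / 2.
have [|Ta Za] := zero th.
  by rewrite /al /be /th; apply/andP; clear -vp0 vp1 e0 ev1 ev2 pi0; split; lra.
have [|Tb Zb] := zero (th - 2 * pi).
  by rewrite /al /be /th; apply/andP; clear -vp0 vp1 e0 ev1 ev2 pi0; split; lra.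
exists th, s; split=> //; exists (Num.max t0 (Num.max Ta Tb)) => x.
rewrite gt_max => /andP[xt]; rewrite gt_max => /andP[xa xb] /=.
pose w : C := x +i* (th - 2 * pi).
have wE : w + twopii R = x +i* th by apply: complex_eq; rewrite ?cReD ?cImD /= ?addr0 ?subrK.
have sw : strip t0 al be w.
  by split; rewrite /w //= /al /be /th; clear -vp0 vp1 e0 ev1 ev2 pi0; lra.
have sw' : strip t0 al be (w + twopii R).
  by rewrite wE; split; rewrite //= /al /be /th; clear -vp0 vp1 e0 ev1 ev2 pi0; lra.
have [V0 V1 E0 E1] := g_jump w sw sw'.
have yE : cexp (- (x +i* th)) = cexp (- w) :> C.
  by rewrite -wE opprD -(cexp_period (- w - _)) subrK.
split; rewrite ?yE; [exact: VS | by rewrite -yE -wE; exact: VS | by rewrite -E0 Zb |].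
by rewrite -E1 wE Za.
Qed.

End FourSectors.

(** * Nonvanishing Jacobian and uniqueness of the convergent member *)

Section Uniqueness.
Variable R : realType.
Local Notation C := R[i].
Local Notation nm := (@nm R).
Local Notation C2 := (C * C)%type.

(** The row (q, q') is near (0, 1), while (p, p') is near (m, m') with m near 1 and m' merely
    bounded; the product p' q is small because q is. *)
Lemma near_id_det (p p' q q' m m' : C) (t L : R) : nm (m - 1) <= 1 / 8 -> nm m' <= L ->
  nm (p - m) <= t -> nm (p' - m') <= t -> nm q <= t -> nm (q' - 1) <= t ->
  t * (L + 1) <= 1 / 16 -> p * q' - p' * q != 0.
Proof.
move=> c1 l2 p1 p2 q1 q2 tB.
have t0 := le_trans (nm_ge0 q) q1; have L0 := le_trans (nm_ge0 m') l2.
have t1 : t <= 1 / 16 by apply: le_trans tB; rewrite ler_peMr // lerDr.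
have a1 : nm (p - 1) <= 3 / 16 by have := nm_tri m p 1; lra.
have a2 : nm p' <= t + L by have := nmD (p' - m') m'; rewrite subrK; lra.
(* If the determinant vanished, 1 would be the modulus of a sum of terms of total modulus below
   1. *)
apply: contraTneq isT => J; suff : (1 : R) < 1 by rewrite ltxx.
have {1}-> : 1 = nm ((p - 1) + ((q' - 1) + ((p - 1) * (q' - 1) - p' * q))).
  by rewrite -nm1 -nmN; congr nm; rewrite -[RHS](subr0 _) -[in RHS]J; ring.
have b1 : nm ((p - 1) * (q' - 1)) <= 3 / 16 * t by rewrite nmM ler_pM ?nm_ge0.
have b2 : nm (p' * q) <= (t + L) * t by rewrite nmM ler_pM ?nm_ge0.
have b3 : (t + L) * t <= (1 + L) * t by rewrite ler_wpM2r //; lra.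
apply: le_lt_trans (nmD _ _) _; have c2 := nmD (q' - 1) ((p - 1) * (q' - 1) - p' * q).
have c3 := nmB ((p - 1) * (q' - 1)) (p' * q).
by lra.
Qed.

Variables (varpi : R) (tau z0 : C) (a b : nat -> C -> C) (phi : 'Z_4 -> C2 -> C2)
  (Psi : 'Z_4 -> C2 -> C2) (u0 v0 : C).
Hypotheses (vp : 0 < varpi < pi) (z00 : z0 != 0) (tau0 : tau != 0) (ab : formal_coefs a b)
  (SD : sector_data varpi z0 tau a b phi Psi)
  (tauE : tau = (nm tau)%:C * cis varpi)
  (phi12 : \forall p \near (0 : C2), phi 1 p = p)
  (phi23 : \forall p \near (0 : C2), phi 2 p = p)
  (phi34 : \forall p \near (0 : C2), phi 3 p = p)
  (phi41 : \forall p \near (0 : C2),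
     phi 4 (phi14 (tau * (v0 - u0)) u0 p) = p /\
     phi14 (tau * (v0 - u0)) u0 (phi 4 p) = p).

Local Notation Reg := (Reg varpi z0).
Local Notation ev := (ev varpi z0).
Local Notation ell := (ell tau Psi).
Local Notation P1 := (P1 Psi).
Local Notation P2 := (P2 Psi).
Local Notation XX := (XX Psi).
Local Notation YY := (YY tau Psi).

(** Psi_i is compared with the truncation of order 1, which is (z + a_1(z) y, y). The error O(y^2)
    has derivatives O(y) by Cauchy's estimates. *)
Lemma jacobian_neq0 i s : 0 < s <= 1 -> ev i (2 * s) (fun z y =>
  d1 (P1 i) z y * d2 (P2 i) z y - d2 (P1 i) z y * d1 (P2 i) z y != 0).
Proof.
move=> s01; have /andP[s0 s1] := s01; have [_ S2 _] := SD.
have [M HM] := S2 i s 1%N s0.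
pose T z y : C := (trunc a b 1 (z, y)).1.
have TN := trunc_near z00 ab 1 (@ltr01 R).
have hT : near0 z0 (hol2 T) by apply: near0_imp TN => z y [].
have T2E z y : (trunc a b 1 (z, y)).2 = y by rewrite /trunc /= big_geq // addr0.
have T0 z : T z 0 = z by rewrite /T /trunc /= big_nat1 mulr0 addr0.
have dT0 : d1 T z0 0 = 1.
  have D := dif2_dif1 (dif2_d (near0_at hT)).
  by apply: dif_unique D _; apply: (dif_ext ltr01) (@dif_id _ z0) => z _; rewrite T0.
have dT := near0_d hT; have e8 : 0 < 1 / 8 :> R by rewrite divr_gt0.
have C1 := near0_cts (near0_at dT).1 e8.
have [L LP] := near0_bounded (near0_imp (fun z y h => proj2 h) dT).
have psi := psi_near z00 ab SD i s0 (@ltr01 R).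
have [K1 KP1] : exists K, ev i (2 * s) (fun z y =>
    nm (d1 (fun z y => P1 i z y - T z y) z y) <= K * nm y ^+ 1 /\
    nm (d2 (fun z y => P1 i z y - T z y) z y) <= K * nm y ^+ 1).
  apply: ev_grad => //; apply: ev_imp (ev_and (ev_and psi HM) (near0_ev varpi i s hT)).
  move=> z y [[[h1 h2 _ _ _] [m1 _]] h3]; split; last exact: m1.
  exact: hol2_add h1 (hol2_opp h3).
have [K2 KP2] : exists K, ev i (2 * s) (fun z y =>
    nm (d1 (fun z y => P2 i z y - y) z y) <= K * nm y ^+ 1 /\
    nm (d2 (fun z y => P2 i z y - y) z y) <= K * nm y ^+ 1).
  apply: ev_grad => //; apply: ev_imp (ev_and psi HM).
  move=> z y [[h1 h2 _ _ _] [_]]; rewrite T2E => m2; split; last exact: m2.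
  exact: hol2_add h2 (hol2_opp (hol2_snd _ _)).
pose A := `|K1| + `|K2| + 1; have A0 : 0 < A by rewrite ltr_wpDl // addr_ge0.
pose B := `|L| + 1; have B0 : 0 < B by rewrite ltr_wpDl.
have [aK1 aK2] := (normr_ge0 K1, normr_ge0 K2).
have KA1 : K1 <= A by rewrite /A; have := ler_norm K1; lra.
have KA2 : K2 <= A by rewrite /A; have := ler_norm K2; lra.
have r0 : 0 < 1 / 16 / (A * B) by rewrite divr_gt0 // ?divr_gt0 // mulr_gt0.
have ss : s <= 2 * s by lra.
apply: ev_imp (ev_and (ev_and (ev_mono ss psi) (ev_and KP1 KP2))
  (near0_ev varpi i (2 * s) (near0_and (near0_and hT C1) (near0_and LP (near0_ball z0 r0))))).
move=> z y [[[h1 h2 _ _ _] [[p1 p2] [q1 q2]]] [[hTz c1] [l2 [_ yr]]]].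
have [_ E1 E2] := d_sub h1 hTz; have [_ E3 E4] := d_sub h2 (hol2_snd z y).
rewrite (d1E (dif2_snd z y)) subr0 in E3; rewrite (d2E (dif2_snd z y)) in E4.
rewrite E1 expr1 in p1; rewrite E2 expr1 in p2; rewrite E3 expr1 in q1; rewrite E4 expr1 in q2.
rewrite dT0 in c1.
have ny := nm_ge0 y; pose t := A * nm y.
have t0 : 0 <= t by rewrite mulr_ge0 // ltW.
have tB : t * B <= 1 / 16.
  by rewrite /t mulrAC mulrC -ler_pdivlMr ?ltW // mulr_gt0.
have K1t : K1 * nm y <= t by rewrite ler_wpM2r.
have K2t : K2 * nm y <= t by rewrite ler_wpM2r.
apply: (@near_id_det _ _ _ _ (d1 T z y) (d2 T z y) t `|L|) => //.
- exact: le_trans l2 (ler_norm L).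
- exact: le_trans p1 K1t.
- exact: le_trans p2 K1t.
- exact: le_trans q1 K2t.
exact: le_trans q2 K2t.
Qed.

(** In the coordinates (p, q) = Psi_0 and with k = X Y e^Y, d log k = (1 + Y) dp / p - 2 i pi (1 +
    tau (1 + Y)) dq / q^2 and dH = kap u dp / p - v dq / q^2. The last factor is their determinant;
    [m] gathers k / (1 + k) and 1 / (p q^2). *)
Lemma wedge_ell_H (u v p1 p2 q1 q2 : C) d z y : 0 < d ->
  (forall z, nm (z - 1) < d -> dif (@clog R) z z^-1) ->
  P1 0 z y != 0 -> P2 0 z y != 0 -> nm (P1 0 z y / z0 - 1) < d ->
  nm (XX 0 z y * YY 0 z y * cexp (YY 0 z y)) < Num.min d 1 ->
  dif2 (P1 0) z y p1 p2 -> dif2 (P2 0) z y q1 q2 ->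
  exists l1 l2 h1 h2 m, [/\ dif2 ell z y l1 l2, dif2 (H tau z0 Psi u v 0) z y h1 h2, m != 0 &
    l1 * h2 - l2 * h1 = (p1 * q2 - p2 * q1) * m *
      (u / tau * (1 + tau * (1 + YY 0 z y)) - v * (1 + YY 0 z y))].
Proof.
move=> d0 dl P0 Q0 Pd; rewrite lt_min => /andP[kd k1] DP DQ.
have DQi := dif2_comp DQ (dif_inv Q0).
have DX := dif2_comp (dif2_mulf (dif2_cst (twopii R) z y) DQi) (dif_cexp _).
have DE := dif2_comp (dif2_mulf (dif2_cst (twopii R * tau) z y) DQi) (dif_cexp _).
have DY := dif2_mulf DP DE.
have Dk := dif2_mulf (dif2_mulf DX DY) (dif2_comp DY (dif_cexp _)).
have D1 := dif2_addf (dif2_cst 1 z y) Dk.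
pose k := XX 0 z y * YY 0 z y * cexp (YY 0 z y).
have kd' : nm (1 + k - 1) < d by rewrite addrC addKr.
have Dl := @dif2_comp _ (@clog R) _ _ _ _ _ _ D1 (dl (1 + k) kd').
have DH1 := dif2_mulf (dif2_cst v z y) DQi.
have DH2 := dif2_mulf (dif2_cst (kap tau u) z y)
  (@dif2_comp _ (@clog R) _ _ _ _ _ _ (dif2_mulf DP (dif2_cst z0^-1 z y)) (dl _ Pd)).
have DH := dif2_addf DH1 DH2.
have tt := twopii_neq0 R.
have k0 : 1 + k != 0.
  apply/eqP => E; move: k1; rewrite -/k (_ : k = -1) ?nmN ?nm1 ?ltxx //.
  by rewrite -[k]add0r -(addNr 1) -addrA E addr0.
have c1 := cexp_neq0 (twopii R * (P2 0 z y)^-1).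
have c2 := cexp_neq0 (twopii R * tau * (P2 0 z y)^-1).
have c3 := cexp_neq0 (YY 0 z y).
have X0 : XX 0 z y != 0 := c1.
have Y0 : YY 0 z y != 0 := mulf_neq0 P0 c2.
have kn : k != 0 := mulf_neq0 (mulf_neq0 X0 Y0) c3.
do 4 eexists; exists (k / ((1 + k) * P1 0 z y * P2 0 z y ^+ 2)); split.
- exact: Dl.
- exact: DH.
- by rewrite mulf_neq0 // ?invr_neq0 // mulf_neq0 // ?expf_neq0 // mulf_neq0.
move: k0 P0 Q0 tt tau0; rewrite /k /kap /YY /XX.
set E1 := cexp (twopii R * tau * _); set E2 := cexp (twopii R * _); set E3 := cexp _.
move: {DX DE DY Dk D1 Dl DH1 DH2 DH DQi} E1 E2 E3 (P1 0 z y) (P2 0 z y) (twopii R).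
move=> e1 e2 e3 P Q t k0 P0 Q0 t0 tau0'.
by field; rewrite tau0' t0 z00 P0 Q0 k0.
Qed.

Lemma pencil_unique (u v : C) (eta : C2 -> C2) : (u, v) != (0, 0) ->
  (\forall p \near (z0, 0 : C), differentiable eta p) -> eta (z0, 0) != 0 ->
  formally_zero z0 (fun N p =>
     wedge (eta p) (pullback (trunc a b N) (pencil tau u v) p)) ->
  u * v0 = u0 * v.
Proof.
move=> uv eta_dif eta0 eta_formal.
pose e1 z y := (eta (z, y)).1; pose e2 z y := (eta (z, y)).2.
have eta_hol : near0 z0 (fun z y => hol2 e1 z y /\ hol2 e2 z y).
  have [r r0 P] := (near_C2P _ _ _).1 eta_dif; exists r => // z y zr yr.
  by apply: differentiable_hol2_pair; apply: P; rewrite ?subr0.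
have eta_neq0 : near0 z0 (fun z y => (e1 z y != 0) || (e2 z y != 0)).
  have cts e : hol2 e z0 0 -> e z0 0 != 0 -> near0 z0 (fun z y => e z y != 0).
    move=> he en; have h : 0 < nm (e z0 0) / 2 by rewrite divr_gt0 // nm_gt0.
    apply: near0_imp (near0_cts he h) => z y; apply: contraTneq => ->.
    by rewrite sub0r nmN -ltNge; lra.
  have [h1 h2] := near0_at eta_hol; have [E1|E1] := eqVneq (e1 z0 0) 0.
    have E2 : e2 z0 0 != 0.
      by apply: contraNneq eta0 => E2; apply/eqP; rewrite [eta _]surjective_pairing;
        congr pair.
    by apply: near0_imp (cts _ h2 E2) => z y ->; rewrite orbT.
  by apply: near0_imp (cts _ h1 E1) => z y ->.
apply/eqP; rewrite -subr_eq0 (mulrC u0); apply/negPn/negP => D0.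
have tt := twopii_neq0 R; set k := (u * v0 - v * u0) / twopii R.
have k0 : k != 0 by rewrite mulf_neq0 // invr_neq0.
have regz i s r y : 0 < r -> nm y < r -> sec (ang varpi i) s y -> Reg i s r z0 y.
  by move=> r0 yr h; apply/and3P; split=> //; rewrite subrr nm0.
have half (s : R) : 0 < s <= 1 -> 0 < s / 2 <= 1 by move=> /andP[s0 s1]; apply/andP; split; lra.
have s22 (s : R) : 2 * (s / 2) = s by rewrite mulrC divfK.
pose Hi := H tau z0 Psi u v; pose w := wedge_d eta.
have [th [s [s01 [T TP]]]] : exists theta s, 0 < s <= 1 /\ exists T, forall x, T < x ->
  let y := cexp (- (x +i* theta)) in
  [/\ sec (ang varpi 0) s y, sec (ang varpi 1) s y, w (Hi 0) z0 y = 0 & w (Hi 1) z0 y = 0].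
  apply: (@four_sectors_zero R varpi vp (fun i y => w (Hi i) z0 y)).
  - move=> i s /half s01; have [r r0 P] := wedge_d_hol z00 tau0 ab SD u v eta_hol i s01.
    exists r => // y yr h; have [|al [be D]] := P z0 y.
      by apply: regz => //; rewrite s22.
    by exists be; exact: dif2_dif2 D.
  - move=> i s n /half s01; have [K [r r0 P]] :=
      wedge_d_flat z00 tau0 ab SD eta_hol eta_formal i n s01.
    by exists K, r => // y yr h; apply: P; apply: regz => //; rewrite s22.
  - move=> i s /half s01 i0.
    have [r r0 P] := wedge_d_overlap z00 tau0 ab SD tauE phi12 phi23 phi34 u v eta s01 i0.
    by exists r => // y yr h h'; apply: P; apply: regz => //; rewrite s22.
  move=> s /half s01.
  have [K [c [c0 [r r0 P]]]] := wedge_d_jump z00 tau0 ab SD tauE phi41 u v eta_hol s01.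
  exists (nm k * K), c; split=> //; exists r => // y yr h h'.
  have [||_ E B] := P z0 y; try (by apply: regz => //; rewrite s22).
  by rewrite /w /Hi E [X in nm (X - _)]addrC addrK nmM -mulrA ler_wpM2l ?nm_ge0.
have s01' := half s s01; have /andP[s0 s1] := s01.
have [K [c [c0 [r1 r10 J]]]] := wedge_d_jump z00 tau0 ab SD tauE phi41 u v eta_hol s01'.
have [r2 r20 Jac] := jacobian_neq0 0 s01'.
have [d d0 dl] := dif_clog_near1 R.
have dd : 0 < Num.min d 1 by rewrite lt_min d0 ltr01.
have [r3 r30 N] := psi_near z00 ab SD 0 s0 dd.
(* For v different from u the final relation forces Y = [kp]. The bound |Y| < [dk] excludes this if
   [kp] is nonzero, and if [kp] = 0 it contradicts that Y never vanishes. *)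
pose kp := u / tau / (v - u) - 1.
pose dk := if kp == 0 then 1 else nm kp.
have dk0 : 0 < dk by rewrite /dk; case: eqP => // /eqP; rewrite nm_gt0.
have md : 0 < Num.min (Num.min d 1) (Num.min dk (1 / 8)) by rewrite !lt_min d0 ltr01 dk0 divr_gt0.
have [r4 r40 S] := chart_small z00 tau0 ab SD tauE s0 md (or_introl (erefl (0 : 'Z_4))).
have [r5 r50 E0] := eta_neq0.
pose r := Num.min (Num.min (Num.min r1 r2) (Num.min r3 r4)) r5.
have r0 : 0 < r by rewrite !lt_min r10 r20 r30 r40.
have [[[l1 l2] [l3 l4]] l5] : ((r <= r1 /\ r <= r2) /\ (r <= r3 /\ r <= r4)) /\ r <= r5.
  by rewrite !ge_min !lexx ?orbT.
pose x := `|T| + `|ln r| + 1; pose y := cexp (- (x +i* th)) : C.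
have Tx : T < x.
  by have := ler_norm T; have := normr_ge0 (ln r); rewrite /x; lra.
have [h0 h1 W0 W1] := TP x Tx.
have yr : nm y < r.
  rewrite /y nm_cexp cReN /= -[ltRHS]lnK ?posrE // ltr_expR.
  by have := ler_norm (- ln r); rewrite normrN; have := normr_ge0 T; rewrite /x; lra.
have RG i s' r' : r <= r' -> s' = s -> sec (ang varpi i) s y -> Reg i s' r' z0 y.
  by move=> rr -> h; apply: regz h; [exact: lt_le_trans rr | exact: lt_le_trans rr].
have [||hl WE _] := J z0 y; [exact: RG | exact: RG |].
(* Both functions vanish at this y and differ by k times eta /\ d ell, with k nonzero by the
   assumption [u : v] <> t0. *)
have We : w ell z0 y = 0.
  move: WE; rewrite [LHS]W1 [X in X + _]W0 add0r => /esym/eqP.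
  by rewrite mulf_eq0 (negPf k0) => /eqP.
have jac := Jac z0 y (RG 0 _ _ l2 (s22 s) h0).
have [hP hQ] := N z0 y (RG 0 _ _ l3 erefl h0).
rewrite lt_min => /andP[Pd P1'] Q4 y0.
have P0 : P1 0 z0 y != 0.
  by apply: contraTneq P1' => ->; rewrite mul0r sub0r nmN nm1 ltxx.
have Q0 : P2 0 z0 y != 0.
  by rewrite -nm_gt0; apply: lt_le_trans Q4; rewrite divr_gt0 // nm_gt0.
have [||X1 Y1] := S z0 y; [exact: RG | by rewrite add0r; exact: RG |].
move: X1 Y1; rewrite /= !lt_min => /andP[/andP[X1 X2] _] /andP[_ /andP[Yk Y8]].
have kd : nm (XX 0 z0 y * YY 0 z0 y * cexp (YY 0 z0 y)) < Num.min d 1.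
  by apply: le_lt_trans (nm_mul_cexp_le _ Y8) _; rewrite lt_min X1.
have [m1 [m2 [n1 [n2 [m [Dl DH m0 E]]]]]] :=
  wedge_ell_H u v d0 dl P0 Q0 Pd kd (dif2_d hP) (dif2_d hQ).
move: We W0; rewrite /w /wedge_d /Hi (d1E Dl) (d2E Dl) (d1E DH) (d2E DH) -/(e1 z0 y) -/(e2 z0 y).
move=> We W0.
(* d ell and dH both have zero wedge with the nonzero covector eta, hence they are proportional. *)
have L0 : m1 * n2 - m2 * n1 = 0.
  have e12 := E0 z0 y; rewrite subrr nm0 in e12.
  have /orP[f1|f2] := e12 r50 (lt_le_trans yr l5).
    apply: (mulfI f1); rewrite mulr0 -[RHS](subrr 0)
      -[X in _ = X - _](mulr0 m1) -[in X in _ = X - _]W0.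
    by rewrite -[X in _ = _ - X](mulr0 n1) -[in X in _ = _ - X]We; ring.
  apply: (mulfI f2); rewrite mulr0 -[RHS](subrr 0)
      -[X in _ = X - _](mulr0 m2) -[in X in _ = X - _]W0.
  by rewrite -[X in _ = _ - X](mulr0 n2) -[in X in _ = _ - X]We; ring.
move: E; rewrite L0 => /esym/eqP; rewrite !mulf_eq0 (negPf jac) (negPf m0) /= subr_eq0 => /eqP E.
have {}E : u / tau = (v - u) * (1 + YY 0 z0 y).
  rewrite mulrBl -E; set Y := YY 0 z0 y; field; exact: tau0.
(* For u = v the relation reads u / tau = 0, so both vanish, which is excluded. *)
have [vu|vu] := eqVneq v u.
  move: E uv; rewrite vu subrr mul0r => /eqP.
  by rewrite mulf_eq0 invr_eq0 (negPf tau0) orbF => /eqP ->; rewrite eqxx.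
have kpE : kp = YY 0 z0 y.
  by rewrite /kp E [(v - u) * _]mulrC mulfK ?subr_eq0 // addrC addKr.
move: Yk; rewrite /dk kpE; case: eqP => [Y0 _|_]; last by rewrite ltxx.
by move: Y0 => /eqP; rewrite mulf_eq0 (negPf P0) (negPf (cexp_neq0 _)).
Qed.

End Uniqueness.
Theorem theorem7p12 (R : realType) (tau : R[i]) (varpi : R)
  (tau_upper : 0 < complex.Im tau)
  (varpi_range : 0 < varpi < pi)
  (varpi_arg : tau = `|tau| * (cos varpi +i* sin varpi))
  (u0 v0 : R[i]) (t0_P1 : (u0, v0) != (0, 0))
  (phi : 'Z_4 -> R[i] * R[i] -> R[i] * R[i])
  (phi_cocycle : is_cocycle phi)
  (phi12 : \forall p \near (0 : R[i] * R[i]), phi 1 p = p)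
  (phi23 : \forall p \near (0 : R[i] * R[i]), phi 2 p = p)
  (phi34 : \forall p \near (0 : R[i] * R[i]), phi 3 p = p)
  (phi41 : \forall p \near (0 : R[i] * R[i]),
     phi 4 (phi14 (tau * (v0 - u0)) u0 p) = p /\
     phi14 (tau * (v0 - u0)) u0 (phi 4 p) = p)
  (F : R[i] * R[i] -> R[i] * R[i]) (a b : nat -> R[i] -> R[i])
  (F_germ : neighborhood_germ tau F)
  (F_formal : formal_conjugacy tau F a b)
  (F_cocycle : has_cocycle tau varpi F a b phi) :
  convergent tau a b u0 v0 /\
  forall u v : R[i], (u, v) != (0, 0) ->
    convergent tau a b u v -> u * v0 = u0 * v.
Proof.
have tau0 : tau != 0 by apply: contraTneq tau_upper => ->; rewrite ltxx.
have tauE : tau = (nm tau)%:C * cis varpi by rewrite {1}varpi_arg normE.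
have [ab _] := F_formal.
split=> [z0 z00|u v uv conv].
  have [Psi SD] := sector_dataP z00 F_cocycle.
  exact: (pencil_foliation varpi_range z00 tau0 ab SD tauE phi12 phi23 phi34 phi41 t0_P1).
(* Convergence near a single point of the curve already determines [u : v]; the point is z0 = 1. *)
have z00 : 1 != 0 :> R[i] by exact: oner_neq0.
have [Psi SD] := sector_dataP z00 F_cocycle.
have [eta [eta_dif eta0 eta_formal]] := conv 1 z00.
exact: (pencil_unique varpi_range z00 tau0 ab SD tauE phi12 phi23 phi34 phi41 uv eta_dif eta0
  eta_formal).
Qed.
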